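(* Let $H$ be the group of birational transformations of $\mathbb{C}^2$ generated by $\mathrm{SL}(2,\mathbb{Z})$ and by the map $P\colon (x,y)\dashrightarrow \left(y,\frac{y+1}{x}\right)$. Let $C=\begin{pmatrix}-1&1\\-1&0\end{pmatrix}$ and $I=\begin{pmatrix}0&-1\\1&0\end{pmatrix}$, viewed as elements of $H$. Then the following is a presentation of the group $H$: $$H=\langle I,C,P\ |\ I^4=C^3=[C,I^2]=P^5=1,\ PCP=I\rangle .$$
   Context: A matrix $\begin{pmatrix} a&b\\ c&d\end{pmatrix}\in\mathrm{SL}(2,\mathbb{Z})$ is identified with the birational map $(x,y)\dashrightarrow (x^ay^b,x^cy^d)$ of $\mathbb{C}^2$; thus $C\colon(x,y)\dashrightarrow(y/x,1/x)$ and $I\colon (x,y)\dashrightarrow (1/y,x)$. The group law is composition of birational maps ($fg$ means $f\circ g$). $[a,b]$ denotes the commutator. *)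

(* Defs.v *)
From HB Require Import structures.
From mathcomp Require Import all_boot all_order all_algebra.
From mathcomp Require Import complex.
From mathcomp Require Import boolp classical_sets reals.
From mathcomp Require Import mpoly.

Set Implicit Arguments.
Unset Strict Implicit.
Unset Printing Implicit Defensive.

Import GRing.Theory.
Local Open Scope ring_scope.

Local Notation "p %:F" := (FracField.tofrac p) : ring_scope.

Lemma fraction_numden (D : idomainType) (h : {fraction D}) :
  h = (\n_(repr h))%:F / (\d_(repr h))%:F.
Proof.
have dF0 : (\d_(repr h))%:F != 0 by rewrite tofrac_eq0 denom_ratioP.
rewrite -[LHS](mulfK dF0); congr (_ / _).
rewrite -{1}[h]reprK; move: (repr h) {dF0} => x.
unlock FracField.tofrac; rewrite -[LHS]FracField.pi_mul.
apply/eqmodP; rewrite /= FracField.equivfE /FracField.mulf.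
by rewrite !numden_Ratio ?mulf_neq0 ?oner_eq0 ?denom_ratioP // !mulr1 mulrC.
Qed.

Definition ratfun (F : fieldType) (n : nat) := {fraction {mpoly F[n]}}.

(* The field structure of {fraction {mpoly F[n]}}, locked only because
   unfolding it makes unification diverge. *)
HB.lock Definition ratfun_class (F : fieldType) (n : nat) :
  GRing.Field (ratfun F n) := GRing.Field.class {fraction {mpoly F[n]}}.

HB.instance Definition _ F n :=
  GRing.Field.copy (ratfun F n) (GRing.Field.Pack (ratfun_class F n)).

Section RationalMaps.
Variables (F : fieldType) (n : nat).
Local Notation ratfun := (ratfun F n).
Local Notation ratfield := (GRing.Field.Pack (ratfun_class F n)).

Definition rpoly (p : {mpoly F[n]}) : ratfun := p%:F.

Lemma rpoly_zmod : zmod_morphism rpoly.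
Proof.
suff: zmod_morphism (rpoly : _ -> ratfield) by [].
rewrite ratfun_class.unlock; exact: tofrac_is_zmod_morphism.
Qed.
Lemma rpoly_monoid : monoid_morphism rpoly.
Proof.
suff: monoid_morphism (rpoly : _ -> ratfield) by [].
rewrite ratfun_class.unlock; exact: tofrac_is_monoid_morphism.
Qed.
HB.instance Definition _ := GRing.isZmodMorphism.Build {mpoly F[n]} ratfun rpoly
  rpoly_zmod.
HB.instance Definition _ := GRing.isMonoidMorphism.Build {mpoly F[n]} ratfun
  rpoly rpoly_monoid.

Lemma rpoly_inj : injective rpoly.
Proof. by move=> p q E; apply/eqP; rewrite -tofrac_eq; apply/eqP. Qed.
Lemma rpoly_eq0 p : (rpoly p == 0) = (p == 0).
Proof. by rewrite -(inj_eq rpoly_inj) rmorph0. Qed.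

Lemma ratfun_numden (h : ratfun) :
  h = rpoly \n_(repr h) / rpoly \d_(repr h).
Proof.
suff: forall k : ratfield,
    k = (rpoly \n_(repr k) : ratfield) / (rpoly \d_(repr k) : ratfield)
  by exact.
rewrite ratfun_class.unlock; exact: (@fraction_numden {mpoly F[n]}).
Qed.

(* A rational map from F^n to F^n, given by its components. *)
Definition ratmap := {ffun 'I_n -> ratfun}.

HB.instance Definition _ := Choice.on ratmap.

Definition rconst (c : F) : ratfun := rpoly c%:MP.
Definition rcoord (i : 'I_n) : ratfun := rpoly 'X_i.

Lemma rconst_zmod : zmod_morphism rconst.
Proof. by move=> x y; rewrite /rconst mpolyCB rmorphB. Qed.
Lemma rconst_monoid : monoid_morphism rconst.
Proof.
by split=> [|x y]; rewrite /rconst ?mpolyCM ?rmorphM // mpolyC1 rmorph1.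
Qed.
HB.instance Definition _ := GRing.isZmodMorphism.Build F ratfun rconst
  rconst_zmod.
HB.instance Definition _ := GRing.isMonoidMorphism.Build F ratfun rconst
  rconst_monoid.

Definition psubst (s : ratmap) (p : {mpoly F[n]}) : ratfun :=
  mmap rconst s p.

(* The pull-back h(s_1, ..., s_n). It is meaningful when the denominator of h
   does not vanish at s, in particular for every h when s is dominant. *)
Definition rsubst (s : ratmap) (h : ratfun) : ratfun :=
  psubst s \n_(repr h) / psubst s \d_(repr h).

(* The image of s is Zariski dense: no nonzero polynomial vanishes on it. *)
Definition dominant (s : ratmap) := forall p, p != 0 -> psubst s p != 0.

Definition rid : ratmap := [ffun i => rcoord i].

(* s after t *)
Definition rcomp (s t : ratmap) : ratmap := [ffun i => rsubst t (s i)].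

Definition birational (s : ratmap) :=
  dominant s /\
  exists t, [/\ dominant t, rcomp s t = rid & rcomp t s = rid].

Lemma psubst_zmod s : zmod_morphism (psubst s).
Proof. by move=> p q; rewrite /psubst mmapB. Qed.
Lemma psubst_monoid s : monoid_morphism (psubst s).
Proof.
by split=> [|p q]; rewrite /psubst ?rmorph1 ?rmorphM.
Qed.
HB.instance Definition _ s := GRing.isZmodMorphism.Build {mpoly F[n]} ratfun
  (psubst s) (psubst_zmod s).
HB.instance Definition _ s := GRing.isMonoidMorphism.Build {mpoly F[n]} ratfun
  (psubst s) (psubst_monoid s).

Lemma psubstC s c : psubst s c%:MP = rconst c.
Proof. by rewrite /psubst mmapC. Qed.
Lemma psubstX s i : psubst s 'X_i = s i.
Proof. by rewrite /psubst mmapX mmap1U. Qed.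

Lemma psubst_id p : psubst rid p = rpoly p.
Proof.
elim/mpolyind: p => [|c m p _ _ IHp]; first by rewrite !rmorph0.
rewrite !rmorphD /= IHp; congr (_ + _).
rewrite -mul_mpolyC !rmorphM /= psubstC; congr (_ * _).
rewrite mpolyXE_id !rmorph_prod; apply: eq_bigr => i _.
by rewrite !rmorphXn /= psubstX ffunE.
Qed.

Lemma rsubst_frac s a b : dominant s -> b != 0 ->
  rsubst s (rpoly a / rpoly b) = psubst s a / psubst s b.
Proof.
move=> sD b0; set h := _ / _.
have dn0 : \d_(repr h) != 0 by exact: denom_ratioP.
rewrite /rsubst; apply/eqP; rewrite eqr_div ?sD // -!rmorphM /=.
apply/eqP; congr psubst; apply: rpoly_inj; rewrite !rmorphM /=; apply/eqP.
by rewrite -eqr_div ?rpoly_eq0 // -ratfun_numden.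
Qed.

Lemma ratfunP (h : ratfun) : exists a b : {mpoly F[n]},
  b != 0 /\ h = rpoly a / rpoly b.
Proof.
by exists \n_(repr h), \d_(repr h); rewrite denom_ratioP -ratfun_numden.
Qed.

Lemma rsubst_rpoly s p : dominant s -> rsubst s (rpoly p) = psubst s p.
Proof.
by move=> sD; have := rsubst_frac p sD (oner_neq0 _); rewrite !rmorph1 !divr1.
Qed.

Lemma rsubst_zmod s : dominant s -> zmod_morphism (rsubst s).
Proof.
move=> sD h k; have [a [b [b0 ->]]] := ratfunP h.
have [c [d [d0 ->]]] := ratfunP k.
rewrite -mulNr addf_div ?rpoly_eq0 // -rmorphN -!rmorphM -rmorphD.
rewrite !rsubst_frac ?mulf_neq0 // rmorphD !rmorphM rmorphN /=.
by rewrite -addf_div ?sD // mulNr.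
Qed.

Lemma rsubst_monoid s : dominant s -> monoid_morphism (rsubst s).
Proof.
move=> sD; split=> [|h k].
  by rewrite -(rmorph1 rpoly) rsubst_rpoly // !rmorph1.
have [a [b [b0 ->]]] := ratfunP h; have [c [d [d0 ->]]] := ratfunP k.
rewrite mulf_div -!rmorphM !rsubst_frac ?mulf_neq0 // !rmorphM /=.
by rewrite mulf_div.
Qed.

Definition rsubst_morph s (sD : dominant s) : {rmorphism ratfun -> ratfun} :=
  HB.pack (rsubst s)
    (GRing.isZmodMorphism.Build ratfun ratfun (rsubst s) (rsubst_zmod sD))
    (GRing.isMonoidMorphism.Build ratfun ratfun (rsubst s) (rsubst_monoid sD)).

Lemma rmorph_psubst (f : {rmorphism ratfun -> ratfun}) s p :
  (forall c, f (rconst c) = rconst c) ->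
  f (psubst s p) = psubst [ffun i => f (s i)] p.
Proof.
move=> fC; elim/mpolyind: p => [|c m p _ _ IHp]; first by rewrite !rmorph0.
rewrite rmorphD /= rmorphD /= IHp rmorphD /=; congr (_ + _).
rewrite -mul_mpolyC rmorphM /= rmorphM /= rmorphM /= !psubstC fC; congr (_ * _).
rewrite mpolyXE_id !rmorph_prod; apply: eq_bigr => i _.
by rewrite rmorphXn /= rmorphXn /= rmorphXn /= !psubstX ffunE.
Qed.

Lemma rsubst_psubst s t p : dominant t ->
  rsubst t (psubst s p) = psubst (rcomp s t) p.
Proof.
move=> tD; apply: (rmorph_psubst (f := rsubst_morph tD)) => c /=.
by rewrite rsubst_rpoly // psubstC.
Qed.

Lemma rcomp_dominant s t : dominant s -> dominant t -> dominant (rcomp s t).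
Proof.
move=> sD tD p p0; rewrite -rsubst_psubst //.
by rewrite -[rsubst t]/(rsubst_morph tD : ratfun -> ratfun) fmorph_eq0 sD.
Qed.

Lemma rsubst_comp s t h : dominant s -> dominant t ->
  rsubst t (rsubst s h) = rsubst (rcomp s t) h.
Proof.
move=> sD tD; have [a [b [b0 ->]]] := ratfunP h.
rewrite (rsubst_frac _ sD b0) (rsubst_frac _ (rcomp_dominant sD tD) b0).
rewrite -!rsubst_psubst // -[rsubst t]/(rsubst_morph tD : ratfun -> ratfun).
by rewrite fmorph_div.
Qed.

Lemma rid_dominant : dominant rid.
Proof. by move=> p p0; rewrite psubst_id rpoly_eq0. Qed.

Lemma rcompA s t u : dominant t -> dominant u ->
  rcomp s (rcomp t u) = rcomp (rcomp s t) u.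
Proof. by move=> tD uD; apply/ffunP => i; rewrite !ffunE rsubst_comp. Qed.

Lemma rcomp_id s : rcomp s rid = s.
Proof.
apply/ffunP => i; rewrite ffunE; have [a [b [b0 ->]]] := ratfunP (s i).
by rewrite rsubst_frac //; [rewrite !psubst_id | exact: rid_dominant].
Qed.

Lemma rid_comp s : dominant s -> rcomp rid s = s.
Proof.
by move=> sD; apply/ffunP => i; rewrite !ffunE rsubst_rpoly // psubstX.
Qed.

Lemma rid_birational : birational rid.
Proof.
by split; last exists rid; rewrite ?rcomp_id; do ?split; exact: rid_dominant.
Qed.

Lemma rcomp_birational s t :
  birational s -> birational t -> birational (rcomp s t).
Proof.
move=> [sD [s' [s'D ss' s's]]] [tD [t' [t'D tt' t't]]].
split; first exact: rcomp_dominant.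
exists (rcomp t' s'); split; first exact: rcomp_dominant.
  by rewrite rcompA // -(rcompA s tD t'D) tt' rcomp_id.
by rewrite rcompA // -(rcompA t' s'D sD) s's rcomp_id.
Qed.

(* Some representative a / b of h has b(t) <> 0 and a(t) / b(t) = z; t need
   not be dominant, and repr h need not be such a pair. *)
Definition reval (t : ratmap) (h z : ratfun) := exists a b : {mpoly F[n]},
  [/\ psubst t b != 0, h = rpoly a / rpoly b & z = psubst t a / psubst t b].

Lemma reval_fun t h z z' : reval t h z -> reval t h z' -> z = z'.
Proof.
have nz b : psubst t b != 0 -> b != 0.
  by apply: contraNneq => ->; rewrite rmorph0.
move=> [a [b [b0 -> ->]]] [c [d [d0 /eqP + ->]]].
rewrite eqr_div ?rpoly_eq0 ?nz // -!rmorphM => /eqP/rpoly_inj E.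
apply/eqP; rewrite (eqr_div _ _ b0 d0); apply/eqP.
by have := congr1 (psubst t) E; rewrite !rmorphM.
Qed.

Lemma reval_rpoly t p : reval t (rpoly p) (psubst t p).
Proof. by exists p, 1; rewrite !rmorph1 !divr1 oner_eq0. Qed.

Lemma reval0 t : reval t 0 0.
Proof. by have := reval_rpoly t 0; rewrite !rmorph0. Qed.
Lemma reval1 t : reval t 1 1.
Proof. by have := reval_rpoly t 1; rewrite !rmorph1. Qed.

Lemma revalD t h h' z z' : reval t h z -> reval t h' z' ->
  reval t (h + h') (z + z').
Proof.
have nz b : psubst t b != 0 -> b != 0.
  by apply: contraNneq => ->; rewrite rmorph0.
move=> [a [b [b0 -> ->]]] [c [d [d0 -> ->]]].
have bF0 : rpoly b != 0 by rewrite rpoly_eq0 nz.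
have dF0 : rpoly d != 0 by rewrite rpoly_eq0 nz.
exists (a * d + c * b), (b * d); split.
- by rewrite rmorphM mulf_neq0.
- by rewrite (addf_div _ _ bF0 dF0) rmorphD !rmorphM.
- by rewrite (addf_div _ _ b0 d0) rmorphD !rmorphM.
Qed.

Lemma revalM t h h' z z' : reval t h z -> reval t h' z' ->
  reval t (h * h') (z * z').
Proof.
move=> [a [b [b0 -> ->]]] [c [d [d0 -> ->]]].
exists (a * c), (b * d); split.
- by rewrite rmorphM mulf_neq0.
- by rewrite mulf_div !rmorphM.
- by rewrite mulf_div !rmorphM.
Qed.

Lemma revalV t h z : reval t h z -> z != 0 -> reval t h^-1 z^-1.
Proof.
move=> [a [b [b0 -> ->]]]; rewrite mulf_eq0 negb_or => /andP[a0 _].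
by exists b, a; rewrite !invf_div.
Qed.

Lemma revalXn t h z k : reval t h z -> reval t (h ^+ k) (z ^+ k).
Proof.
move=> hz; elim: k => [|k IHk]; last by rewrite !exprS; apply: revalM.
by rewrite !expr0; apply: reval1.
Qed.

Lemma revalXz t h z (k : int) : reval t h z -> z != 0 ->
  reval t (h ^ k) (z ^ k).
Proof.
move=> hz z0; case: k => k; first by rewrite -!exprnP; apply: revalXn.
by rewrite !NegzE -!exprnN; apply: revalV; [exact: revalXn | rewrite expf_neq0].
Qed.

Lemma reval_prod t (f g : 'I_n -> ratfun) : (forall i, reval t (f i) (g i)) ->
  reval t (\prod_i f i) (\prod_i g i).
Proof.
move=> fg; apply: (big_rec2 (reval t)) => [|i h z _]; first exact: reval1.
exact: revalM.
Qed.

Lemma reval_psubst t (s u : ratmap) p : (forall i, reval t (s i) (u i)) ->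
  reval t (psubst s p) (psubst u p).
Proof.
move=> su; elim/mpolyind: p => [|c m p _ _ IHp].
  by rewrite !rmorph0; apply: reval0.
rewrite !rmorphD /=; apply: revalD => //.
rewrite -mul_mpolyC !rmorphM /= !psubstC; apply: revalM.
  by rewrite -{2}(psubstC t); apply: reval_rpoly.
rewrite mpolyXE_id !rmorph_prod; apply: reval_prod => i.
by rewrite !rmorphXn /= !psubstX; apply: revalXn.
Qed.

Lemma reval_dominant (s t : ratmap) :
  (forall i, reval t (s i) (rcoord i)) -> dominant s.
Proof.
move=> st p; apply: contraNneq => sp0.
have := @reval_psubst t s rid p; rewrite sp0 => /(_ _)/reval_fun E.
rewrite -rpoly_eq0 -psubst_id; apply/eqP/E => [i|]; first by rewrite ffunE.
exact: reval0.
Qed.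

Lemma rsubst_reval t h z : dominant t -> reval t h z -> rsubst t h = z.
Proof.
move=> tD [a [b [b0 -> ->]]]; rewrite rsubst_frac //.
by apply: contraNneq b0 => ->; rewrite rmorph0.
Qed.

Lemma reval_birational (s t : ratmap) :
    (forall i, reval t (s i) (rcoord i)) ->
    (forall i, reval s (t i) (rcoord i)) ->
  birational s.
Proof.
move=> st ts; have sD := reval_dominant st; have tD := reval_dominant ts.
split=> //; exists t; split=> //; apply/ffunP => i; rewrite !ffunE;
  exact: rsubst_reval.
Qed.

Record bir := Bir { bir_map :> ratmap; bir_mapP : `[< birational bir_map >] }.

HB.instance Definition _ := [isSub for bir_map].
HB.instance Definition _ := [Choice of bir by <:].

Lemma bir_birational (f : bir) : birational f.
Proof. exact/asboolP/bir_mapP. Qed.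

Definition mkbir s (sB : birational s) : bir := Bir (asboolT sB).

Lemma bir_inv_ex (f : bir) : exists g : bir, rcomp f g = rid /\ rcomp g f = rid.
Proof.
have [fD [t [tD ft tf]]] := bir_birational f.
have tB : birational t by split=> //; exists f.
by exists (mkbir tB).
Qed.

Definition bir_one : bir := mkbir rid_birational.
Definition bir_mul (f g : bir) : bir :=
  mkbir (rcomp_birational (bir_birational f) (bir_birational g)).
Definition bir_inv (f : bir) : bir := projT1 (cid (bir_inv_ex f)).

Lemma bir_mulA : associative bir_mul.
Proof.
by move=> f g h; apply: val_inj; rewrite /= rcompA //;
   case: (bir_birational g) (bir_birational h) => ? _ [].
Qed.
Lemma bir_mul1 : left_id bir_one bir_mul.
Proof. by move=> f; apply: val_inj; case: (bir_birational f) => /rid_comp. Qed.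
Lemma bir_mulr1 : right_id bir_one bir_mul.
Proof. by move=> f; apply: val_inj; rewrite /= rcomp_id. Qed.
Lemma bir_mulV : left_inverse bir_one bir_inv bir_mul.
Proof. by move=> f; apply: val_inj; rewrite /= /bir_inv; case: cid => g []. Qed.
Lemma bir_mulrV : right_inverse bir_one bir_inv bir_mul.
Proof. by move=> f; apply: val_inj; rewrite /= /bir_inv; case: cid => g []. Qed.

(* The group law is composition: f * g is f after g. *)
HB.instance Definition _ := isGroup.Build bir
  bir_mulA bir_mul1 bir_mulr1 bir_mulV bir_mulrV.

(* The i-th component of monmap A is the monomial with exponents row i A. *)
Definition monmap (A : 'M[int]_n) : ratmap :=
  [ffun i => \prod_j rcoord j ^ A i j].

Lemma rcoord_neq0 i : rcoord i != 0.
Proof. by rewrite rpoly_eq0 -msupp_eq0 msuppX. Qed.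

Lemma rcoordD1_neq0 i : rcoord i + 1 != 0.
Proof.
rewrite -(rmorph1 rpoly) -rmorphD rpoly_eq0; apply/eqP => /(congr1 (mcoeff 0)).
rewrite mcoeffD mcoeffX mcoeff1 mcoeff0 eqxx mnm1_eq0 add0r.
by move/eqP; rewrite oner_eq0.
Qed.

Lemma reval_monmap (A B : 'M[int]_n) i :
  reval (monmap B) (monmap A i) (monmap (A *m B) i).
Proof.
have mB0 j : monmap B j != 0.
  by rewrite ffunE; apply/prodf_neq0 => k _; rewrite expfz_neq0 ?rcoord_neq0.
have -> : monmap (A *m B) i = \prod_j monmap B j ^ A i j.
  rewrite ffunE; under [RHS]eq_bigr => j _ do rewrite ffunE.
  transitivity (\prod_k \prod_j rcoord k ^ (A i j * B j k)).
    apply: eq_bigr => k _; rewrite mxE.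
    apply: (big_morph (fun m : int => rcoord k ^ m)) => [m m'|//].
    by rewrite expfzDr ?rcoord_neq0.
  rewrite exchange_big; apply: eq_bigr => j _ /=.
  elim/big_rec2: _ => [|k y z _ ->]; first by rewrite exp1rz.
  by rewrite expfzMl exprz_exp [A i j * _]mulrC.
rewrite ffunE; apply: reval_prod => j; apply: revalXz => //.
by rewrite -(psubstX (monmap B)); apply: reval_rpoly.
Qed.

Lemma monmap1 : monmap 1%:M = rid.
Proof.
apply/ffunP => i; rewrite !ffunE (bigD1 i) //= mxE eqxx expr1z big1 ?mulr1 //.
by move=> j ji; rewrite mxE eq_sym (negPf ji) expr0z.
Qed.

Lemma monmap_birational A : A \in unitmx -> birational (monmap A).
Proof.
move=> uA; apply: (@reval_birational _ (monmap (invmx A))) => i.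
  by have := reval_monmap A (invmx A) i; rewrite mulmxV // monmap1 [rid _]ffunE.
by have := reval_monmap (invmx A) A i; rewrite mulVmx // monmap1 [rid _]ffunE.
Qed.

Definition monbir A (uA : A \in unitmx) : bir := mkbir (monmap_birational uA).

End RationalMaps.

Section Presentations.
Local Open Scope classical_set_scope.
Local Open Scope group_scope.

Definition is_subgroup (G : groupType) (A : set G) :=
  [/\ A 1, forall x y, A x -> A y -> A (x * y) & forall x, A x -> A x^-1].

Definition generated_by (G : groupType) (S : set G) : set G :=
  smallest (@is_subgroup G) S.

(* Words in the letters x = (x, false) and x^-1 = (x, true). *)
Definition word (X : Type) := seq (X * bool).

Definition letter (X : Type) (x : X) : word X := [:: (x, false)].
Definition winv (X : Type) (w : word X) : word X :=
  rev [seq (l.1, ~~ l.2) | l <- w].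
Definition wpow (X : Type) (w : word X) (k : nat) : word X :=
  flatten (nseq k w).
Definition wcomm (X : Type) (v w : word X) : word X :=
  winv v ++ winv w ++ v ++ w.

Definition weval (X : Type) (G : groupType) (g : X -> G) (w : word X) : G :=
  \prod_(l <- w) (if l.2 then (g l.1)^-1 else g l.1).

(* Equality in the group <X | l = r for (l, r) in rels>: the congruence on words
   generated by x x^-1 = x^-1 x = 1 and by the relations. *)
Inductive pres_eq (X : Type) (rels : set (word X * word X)) :
    word X -> word X -> Prop :=
| pres_refl w : pres_eq rels w w
| pres_sym v w : pres_eq rels v w -> pres_eq rels w v
| pres_trans u v w : pres_eq rels u v -> pres_eq rels v w -> pres_eq rels u w
| pres_free u x b v : pres_eq rels (u ++ [:: (x, b); (x, ~~ b)] ++ v) (u ++ v)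
| pres_rel u l r v : rels (l, r) -> pres_eq rels (u ++ l ++ v) (u ++ r ++ v).

(* The assignment g induces an isomorphism from <X | rels> onto H. *)
Definition presents (X : Type) (G : groupType) (H : set G) (g : X -> G)
    (rels : set (word X * word X)) :=
  range (weval g) = H /\
  forall v w, weval g v = weval g w <-> pres_eq rels v w.

End Presentations.

Section PlaneMaps.
Variable F : fieldType.
Local Open Scope classical_set_scope.

Definition mat2 (a b c d : int) : 'M[int]_2 :=
  \matrix_(i < 2, j < 2)
    if i == 0 then (if j == 0 then a else b) else (if j == 0 then c else d).

Lemma det_mat2 a b c d : \det (mat2 a b c d) = a * d - b * c.
Proof.
rewrite (expand_det_row _ 0) !big_ord_recl big_ord0 /cofactor !det_mx11 !mxE /=.
by rewrite expr0 expr1 mul1r addr0 mulN1r mulrN.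
Qed.

Definition matI : 'M[int]_2 := mat2 0 (-1) 1 0.
Definition matC : 'M[int]_2 := mat2 (-1) 1 (-1) 0.

Lemma unit_matI : matI \in unitmx.
Proof. by rewrite unitmxE det_mat2. Qed.
Lemma unit_matC : matC \in unitmx.
Proof. by rewrite unitmxE det_mat2. Qed.

Definition ratmap2 (f g : ratfun F 2) : ratmap F 2 :=
  [ffun i => if i == 0 then f else g].

Local Notation x := (rcoord F (0 : 'I_2)).
Local Notation y := (rcoord F (1 : 'I_2)).

Definition pentagon := ratmap2 y ((y + 1) / x).

Lemma pentagon_birational : birational pentagon.
Proof.
have x0 : x != 0 by exact: rcoord_neq0.
have y0 : y != 0 by exact: rcoord_neq0.
pose Q := ratmap2 ((x + 1) / y) x.
have rv t i : reval t (rcoord F i) (t i).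
  by rewrite -(psubstX t); apply: reval_rpoly.
have rdiv t f g u v : reval t f u -> reval t g v -> v != 0 ->
  reval t ((f + 1) / g) ((u + 1) / v).
  move=> fu gv v0; apply: revalM; last exact: revalV.
  by apply: revalD => //; apply: reval1.
have inv u v : v != 0 -> u != 0 -> v / (v / u) = u :> ratfun F 2.
  by move=> v0 u0; rewrite invf_div mulrCA divff ?mulr1.
have x10 := rcoordD1_neq0 F (0 : 'I_2); have y10 := rcoordD1_neq0 F (1 : 'I_2).
have neq01 (i : 'I_2) : i != 0 -> i = 1.
  by move=> i0; apply: val_inj; case: i i0 => [[|[|]]].
have P0 : pentagon 0 = y by rewrite ffunE.
have P1 : pentagon 1 = (y + 1) / x by rewrite ffunE.
have Q0 : Q 0 = (x + 1) / y by rewrite ffunE.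
have Q1 : Q 1 = x by rewrite ffunE.
apply: (@reval_birational _ _ _ Q) => i; have [->|/neq01 ->] := eqVneq i 0.
- by rewrite P0 -Q1; apply: rv.
- rewrite P1 -[X in reval _ _ X](inv _ (x + 1)) // -Q0 -[X in (X + 1) / Q 0]Q1.
  by apply: rdiv; [exact: rv | exact: rv | rewrite Q0 mulf_neq0 ?invr_eq0].
- rewrite Q0 -[X in reval _ _ X](inv _ (y + 1)) // -P1.
  rewrite -[X in (X + 1) / pentagon 1]P0.
  by apply: rdiv; [exact: rv | exact: rv | rewrite P1 mulf_neq0 ?invr_eq0].
- by rewrite Q1 -P0; apply: rv.
Qed.

Definition birI : bir F 2 := monbir F unit_matI.
Definition birC : bir F 2 := monbir F unit_matC.
Definition birP : bir F 2 := mkbir pentagon_birational.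

(* SL(2, Z) seen inside the group of birational maps; by monmap_birational
   every matrix of determinant 1 contributes an element. *)
Definition SL2Z : set (bir F 2) :=
  [set f | exists A : 'M[int]_2, \det A = 1 /\ bir_map f = monmap F A].

Definition groupH : set (bir F 2) := generated_by (SL2Z `|` [set birP]).

End PlaneMaps.

Arguments SL2Z F _ : clear implicits.
Arguments groupH F _ : clear implicits.

Inductive Hgen := HgenI | HgenC | HgenP.

Definition Hgen_bir (F : fieldType) (g : Hgen) : bir F 2 :=
  match g with HgenI => birI F | HgenC => birC F | HgenP => birP F end.

Definition relations : set (word Hgen * word Hgen) :=
  let I := letter HgenI in let C := letter HgenC in let P := letter HgenP in
  [set (wpow I 4, [::]); (wpow C 3, [::]); (wcomm C (wpow I 2), [::]);
       (wpow P 5, [::]); (P ++ C ++ P, I)]%classic.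

(* Main.v *)
(* Write Q = I^2, U = C^-1 I^-1, M = P I in the presented group G. The relations give
   U M = M U and Q M Q^-1 = U M^-1, so J = {U^p M^q Q^e} is a subgroup. To a coset g J
   attach the fibre degree (degree in y) of the polynomial f_g obtained from
   1 + l x + l^2 y (l an indeterminate) by pulling back along g and removing
   denominators and common factors: this is its height. Two cosets are adjacent when
   both are of the form k C^i P^e J (e = 0, 1) for one k, so that adjacent cosets are
   joined by the relations C^3 = P^5 = 1 and PCP = I, and every g J is joined to J.
   The neighbours of g J are indexed by integers, and their heights are read off
   three convex functions attached to the Newton polygon of f_g (at x = 0, infinity
   and -1) and the multiplicities of f_g at certain points at infinity. An exchange
   argument on these functions shows that two neighbours of g J of height at most that
   of g J, one of them strictly lower, are joined by a path of neighbours of g J whose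
   interior is strictly lower. Hence any path from J to a coset of height 1 can be pushed
   down to heights at most 1; such a path never leaves the six cosets C^i P^e J. An
   element of G acting trivially has height 1, hence lies in some C^i P^e J, where it
   is the identity by inspection. *)

From HB Require Import structures.
From Stdlib Require Import ZArith Lia.
Require Import Defs.
From mathcomp Require Import all_boot all_order all_algebra polyXY.
From mathcomp Require Import complex reals.
From mathcomp Require Import boolp classical_sets zify ring mpoly.

Set Implicit Arguments.
Unset Strict Implicit.
Unset Printing Implicit Defensive.
Import Order.TTheory GRing.Theory Num.Theory.

(* Up to x -> 1/x, J preserves the pencil of vertical lines, so a coset g J stands for the image of
   that pencil under g, and the height is the degree of its curves. The six cosets k C^i P^e J
   become pencils of lines in the frame k: through the vertices of the coordinate triangle, and
   through the three points where x + y + 1 = 0 meets its sides. The heights of neighbours are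
   therefore intersection numbers with the curves f_g = 0. The obstacle is indeterminacy: rational
   maps can be composed only where they are defined. The formulas of I, C and P are free of
   subtractions and these maps have finite order, so the whole group acts on pairs of positive
   numbers, inverses included. Polynomials are compared with group elements only there, and the same
   points later detect whether a birational map is the identity. Since 1, l, l^2 are independent
   over the scalars, a single polynomial with coefficients in F[l] carries the three homogeneous
   coordinates of g. The absence of a common factor is then expressed by finiteness of the zeros off
   the axes, without greatest common divisors in two variables. *)
Delimit Scope Z_scope with ZZ.
Local Arguments Z.add : simpl never.
Local Arguments Z.sub : simpl never.
Local Arguments Z.opp : simpl never.
Local Arguments Z.mul : simpl never.

(** * The link of a coset *)

Section LinkOfAFibration.
Local Open Scope Z_scope.

(* The neighbours of a coset [g J]: with [tau = U^-b M^-c], they are the cosets of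
   [g tau I] (VT), of [g tau I M^-1 I] and [g tau I^-1 M I] (VBp, VBm), and of the
   elements obtained from these two through [I^2] (VAp, VAm). *)
Inductive lvert :=
  | VT of Z & Z | VBp of Z & Z | VBm of Z & Z | VAp of Z & Z | VAm of Z & Z.

Inductive lplane := PlP of Z & Z | PlM of Z & Z | PlB of Z & Z | PlA of Z & Z.

Definition on_plane (P : lplane) (v : lvert) : Prop :=
  match P with
  | PlP b c => [\/ v = VT b c, v = VT (b - 1) c, v = VT b (c - 1)
               | v = VBp b c \/ v = VAp b c]
  | PlM b c => [\/ v = VT b c, v = VT (b + 1) c, v = VT b (c + 1)
               | v = VBm b c \/ v = VAm b c]
  | PlB b c => [\/ v = VT b c, v = VBp b c, v = VBp b (c + 1)
               | v = VBm b c \/ v = VBm b (c - 1)]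
  | PlA b c => [\/ v = VT b c, v = VAp (b + 1) c, v = VAp b (c + 1)
               | v = VAm (b - 1) c \/ v = VAm b (c - 1)]
  end.

Definition ladj (u v : lvert) := exists P, on_plane P u /\ on_plane P v.

Lemma ladj_sym u v : ladj u v -> ladj v u.
Proof. by case=> P [? ?]; exists P. Qed.

(* For a polynomial [f = sum_j f_j(x) y^j] of degree [w] in [y]: [lR a], [lL b] and
   [lB c] are the maxima over [j] of [a j + deg f_j], [b j - ord_0 f_j] and
   [c j - ord_(-1) f_j]; [lm b] and [ln a] are the multiplicities of [f] at the
   points at infinity blown up to reach the vertices VBp, VBm and VAp, VAm. *)
Record ldata := LData
  { lR : Z -> Z; lL : Z -> Z; lB : Z -> Z; lm : Z -> Z; ln : Z -> Z; lw : Z }.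

Definition lval (D : ldata) (v : lvert) : Z :=
  match v with
  | VT b c => lR D (- b - c) + lL D b + lB D c
  | VBp b c => lR D (1 - b - c) + lL D b + lB D c - lm D b
  | VBm b c => lw D + lR D (-1 - b - c) + lL D b + lB D c - lm D b
  | VAp b c => lR D (1 - b - c) + lL D b + lB D c - ln D (1 - b - c)
  | VAm b c => lw D + lR D (-1 - b - c) + lL D b + lB D c - ln D (-1 - b - c)
  end.

Definition wconvex (w : Z) (F : Z -> Z) :=
  (forall x, 0 <= F (x + 1) - F x <= w) /\
  (forall x y, x <= y -> F (x + 1) - F x <= F (y + 1) - F y).

Definition lok (D : ldata) :=
  [/\ [/\ wconvex (lw D) (lR D), wconvex (lw D) (lL D) & wconvex (lw D) (lB D)],
      (forall b, lm D b <= (lL D (b + 1) - lL D b) - (lL D b - lL D (b - 1))) /\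
      (forall a, ln D a <= (lR D (a + 1) - lR D a) - (lR D a - lR D (a - 1))) &
      (forall b c, 2 * lw D <= lR D (2 - b - c) + lL D b + lB D c) /\
      (forall b c, 0 <= lR D (- 2 - b - c) + lL D b + lB D c)].

(** * Paths with low interior and the symmetries of a link *)

Inductive lnk (D : ldata) : lvert -> lvert -> Prop :=
  | lnk_adj u v : ladj u v -> lnk D u v
  | lnk_trans u z v : lval D z < lw D -> lnk D u z -> lnk D z v -> lnk D u v.

Lemma lnk_sym D u v : lnk D u v -> lnk D v u.
Proof.
elim=> [{}u {}v /ladj_sym|{}u z {}v zw _ zu _ vz]; first exact: lnk_adj.
exact: lnk_trans zw vz zu.
Qed.

Lemma lnk_morph D E (phi : lvert -> lvert) :
    (forall P u v, on_plane P u -> on_plane P v -> ladj (phi u) (phi v)) ->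
    (forall v, lval E (phi v) = lval D v) -> lw E = lw D ->
  forall u v, lnk D u v -> lnk E (phi u) (phi v).
Proof.
move=> adjP valP wP u v; elim=> [{}u {}v [P [Pu Pv]]|{}u z {}v zw _ uz _ zv].
  by apply: lnk_adj; apply: adjP Pu Pv.
by apply: lnk_trans uz zv; rewrite valP wP.
Qed.

(** The substitution x -> 1/x: it fixes -1 and exchanges degrees with orders at 0, up to constants
    that cancel in [lval]. Its determinant is -1, so it is a symmetry of the numerical data only. *)
Definition lswap_vert v := match v with
  | VT b c => VT (- b - c) c
  | VBp b c => VAp (1 - b - c) c
  | VBm b c => VAm (-1 - b - c) c
  | VAp b c => VBp (1 - b - c) c
  | VAm b c => VBm (-1 - b - c) c
  end.
Definition lswap D := LData (lL D) (lR D) (lB D) (ln D) (lm D) (lw D).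

(** The substitution y -> 1/y: reversing the coefficients turns a maximum F(x) into w x + F(-x),
    which is [fneg]. Composed with the substitution x -> 1/x it gives the map Q. *)
Definition lneg_vert v := match v with
  | VT b c => VT (- b) (- c)
  | VBp b c => VBm (- b) (- c)
  | VBm b c => VBp (- b) (- c)
  | VAp b c => VAm (- b) (- c)
  | VAm b c => VAp (- b) (- c)
  end.
Definition fneg w (F : Z -> Z) (x : Z) := w * x + F (- x).
Definition lneg D := LData (fneg (lw D) (lR D)) (fneg (lw D) (lL D))
  (fneg (lw D) (lB D)) (fun b => lm D (- b)) (fun a => ln D (- a)) (lw D).

Lemma lswap_vertK : involutive lswap_vert.
Proof. by case=> b c /=; f_equal; lia. Qed.
Lemma lneg_vertK : involutive lneg_vert.
Proof. by case=> b c /=; f_equal; lia. Qed.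

Lemma wconvex_neg w F : wconvex w F -> wconvex w (fneg w F).
Proof.
move=> [Fs Fm]; split=> [x|x y xy]; rewrite /fneg.
  have := Fs (- x - 1).
  have -> : - x - 1 + 1 = - x by lia.
  have -> : - (x + 1) = - x - 1 by lia.
  lia.
have xy1 : - y - 1 <= - x - 1 by lia.
have := Fm _ _ xy1.
have -> : - x - 1 + 1 = - x by lia.
have -> : - y - 1 + 1 = - y by lia.
have -> : - (x + 1) = - x - 1 by lia.
have -> : - (y + 1) = - y - 1 by lia.
lia.
Qed.

Lemma lok_swap D : lok D -> lok (lswap D).
Proof.
move=> [[RP LP BP] [mP nP] [p2 n2]]; split=> //; split=> b c /=.
  have := p2 (2 - b - c) c; have -> : 2 - (2 - b - c) - c = b by lia.
  lia.
have := n2 (-2 - b - c) c; have -> : -2 - (-2 - b - c) - c = b by lia.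
lia.
Qed.

Lemma lok_neg D : lok D -> lok (lneg D).
Proof.
move=> [[RP LP BP] [mP nP] [p2 n2]]; split; first by split; apply: wconvex_neg.
  split=> b; [have := mP (- b) | have := nP (- b)]; rewrite /= /fneg;
  have -> : - (b + 1) = - b - 1 by lia.
    have -> : - (b - 1) = - b + 1 by lia.
    lia.
  have -> : - (b - 1) = - b + 1 by lia.
  lia.
split=> b c; rewrite /= /fneg.
  have := n2 (- b) (- c).
  have -> : -2 - - b - - c = - (2 - b - c) by lia.
  lia.
have := p2 (- b) (- c).
have -> : 2 - - b - - c = - (-2 - b - c) by lia.
lia.
Qed.

Ltac onp := rewrite /on_plane /=;
  solve [ constructor 1; f_equal; lia | constructor 2; f_equal; lia
        | constructor 3; f_equal; lia
        | constructor 4; left; f_equal; lia | constructor 4; right; f_equal; lia].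

Lemma lswap_adj P u v : on_plane P u -> on_plane P v ->
  ladj (lswap_vert u) (lswap_vert v).
Proof.
have gen Q : (forall w, on_plane P w -> on_plane Q (lswap_vert w)) ->
    on_plane P u -> on_plane P v -> ladj (lswap_vert u) (lswap_vert v).
  by move=> PQ Pu Pv; exists Q; split; apply: PQ.
case: P gen => b c gen.
- by apply: (gen (PlP (1 - b - c) c)) => w [|||[]] ->; onp.
- by apply: (gen (PlM (-1 - b - c) c)) => w [|||[]] ->; onp.
- by apply: (gen (PlA (- b - c) c)) => w [|||[]] ->; onp.
- by apply: (gen (PlB (- b - c) c)) => w [|||[]] ->; onp.
Qed.

Lemma lneg_adj P u v : on_plane P u -> on_plane P v ->
  ladj (lneg_vert u) (lneg_vert v).
Proof.
have gen Q : (forall w, on_plane P w -> on_plane Q (lneg_vert w)) ->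
    on_plane P u -> on_plane P v -> ladj (lneg_vert u) (lneg_vert v).
  by move=> PQ Pu Pv; exists Q; split; apply: PQ.
case: P gen => b c gen.
- by apply: (gen (PlM (- b) (- c))) => w [|||[]] ->; onp.
- by apply: (gen (PlP (- b) (- c))) => w [|||[]] ->; onp.
- by apply: (gen (PlB (- b) (- c))) => w [|||[]] ->; onp.
- by apply: (gen (PlA (- b) (- c))) => w [|||[]] ->; onp.
Qed.

Lemma lswap_val D v : lval D (lswap_vert v) = lval (lswap D) v.
Proof.
case: v => b c /=.
- have -> : - (- b - c) - c = b by lia. lia.
- have -> : 1 - (1 - b - c) - c = b by lia. lia.
- have -> : -1 - (-1 - b - c) - c = b by lia. lia.
- have -> : 1 - (1 - b - c) - c = b by lia. lia.
- have -> : -1 - (-1 - b - c) - c = b by lia. lia.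
Qed.

Lemma lneg_val D v : lval D (lneg_vert v) = lval (lneg D) v.
Proof.
case: v => b c /=; rewrite /fneg.
- have -> : - - b - - c = - (- b - c) by lia. lia.
- have -> : -1 - - b - - c = - (1 - b - c) by lia. lia.
- have -> : 1 - - b - - c = - (-1 - b - c) by lia. lia.
- have -> : -1 - - b - - c = - (1 - b - c) by lia. lia.
- have -> : 1 - - b - - c = - (-1 - b - c) by lia. lia.
Qed.

Lemma lnk_swap D u v :
  lnk (lswap D) u v -> lnk D (lswap_vert u) (lswap_vert v).
Proof.
by apply: lnk_morph => //; [exact: lswap_adj | exact: lswap_val].
Qed.

Lemma lnk_neg D u v : lnk (lneg D) u v -> lnk D (lneg_vert u) (lneg_vert v).
Proof.
by apply: lnk_morph => //; [exact: lneg_adj | exact: lneg_val].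
Qed.

(** * Exchange by convexity *)

Lemma wconvex_exchange w F x y x' y' : wconvex w F -> x < y ->
  x' = x + 1 -> y' = y - 1 -> F x' + F y' <= F x + F y.
Proof.
move=> [_ Fm] xy -> ->; have xy' : x <= y - 1 by lia.
have := Fm _ _ xy'; have -> : y - 1 + 1 = y by lia.
lia.
Qed.

Lemma wconvex_mono w F x x' y y' : wconvex w F -> x <= y ->
  x' = x + 1 -> y' = y + 1 -> F x' - F x <= F y' - F y.
Proof. by move=> [_ Fm] xy -> ->; apply: Fm. Qed.

Lemma wconvex_slope w F x x' : wconvex w F -> x' = x + 1 ->
  0 <= F x' - F x <= w.
Proof. by move=> [Fs _] ->. Qed.

Definition low D u v := [/\ lval D u <= lw D, lval D v <= lw D &
  lval D u < lw D \/ lval D v < lw D].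

(** The heights of u and v sum to less than 2w, hence so do those of u' and v'. One of these two is
    then strictly below w and can be inserted in the path, which leaves a smaller instance. *)
Lemma lnk_exchange D u v u' v' : low D u v -> ladj u u' -> ladj v' v ->
    lval D u' + lval D v' <= lval D u + lval D v ->
    (low D u' v -> lnk D u' v) -> (low D u v' -> lnk D u v') ->
  lnk D u v.
Proof.
move=> [uw vw uvw] uu' vv' le IHu IHv.
have [u'w|v'w] : lval D u' < lw D \/ lval D v' < lw D by lia.
  by apply: (lnk_trans u'w (lnk_adj _ uu')); apply: IHu; split; [lia|lia|left].
by apply: (lnk_trans v'w _ (lnk_adj _ vv')); apply: IHv; split; [lia|lia|right].
Qed.

Lemma ladj_T b c b' c' :
  [\/ b' = b /\ c' = c + 1, b' = b + 1 /\ c' = c | b' = b + 1 /\ c' = c - 1] ->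
  ladj (VT b c) (VT b' c').
Proof.
case=> -[-> ->].
- by exists (PlM b c); split; onp.
- by exists (PlM b c); split; onp.
- by exists (PlP (b + 1) c); split; onp.
Qed.

Ltac or3 := solve [constructor 1; lia | constructor 2; lia | constructor 3; lia].
Ltac tadj := solve [apply: ladj_T; or3 | apply: ladj_sym; apply: ladj_T; or3].

(** The vertex [VT b c] has three coordinates -b-c, b, c of sum 0, each of which enters one convex
    function. Two distinct triples differ with opposite signs in two places; moving one unit between
    these places brings both ends closer and does not raise the sum of their heights. *)
Lemma lnk_TT D b c b' c' : lok D -> low D (VT b c) (VT b' c') ->
  lnk D (VT b c) (VT b' c').
Proof.
move=> [[RP LP BP] _ _].
have [n] : exists n : nat,
    Z.abs (b - b') + Z.abs (c - c') + Z.abs (b + c - b' - c') <= Z.of_nat n.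
  by exists (Z.to_nat (Z.abs (b - b') + Z.abs (c - c') +
    Z.abs (b + c - b' - c'))); lia.
elim: n b c b' c' => [|n IHn] b c b' c' dist lo.
  have [-> ->] : b = b' /\ c = c' by lia.
  by apply: lnk_adj; exists (PlP b' c'); split; onp.
have [[bb cc]|nE] : b = b' /\ c = c' \/ ~ (b = b' /\ c = c') by lia.
  by apply: lnk_adj; exists (PlP b' c'); rewrite bb cc; split; onp.
have R_ex x y x' y' := @wconvex_exchange _ _ x y x' y' RP.
have L_ex x y x' y' := @wconvex_exchange _ _ x y x' y' LP.
have B_ex x y x' y' := @wconvex_exchange _ _ x y x' y' BP.
have [H|[H|[H|[H|[H|H]]]]] : (b' + c' < b + c /\ b' < b) \/
    ((b' + c' < b + c /\ c' < c) \/ ((b + c < b' + c' /\ b < b') \/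
    ((b + c < b' + c' /\ c < c') \/ ((b < b' /\ c' < c) \/ (b' < b /\ c < c')))))
  by lia.
- apply: (lnk_exchange (u' := VT (b - 1) c) (v' := VT (b' + 1) c') lo);
    [tadj | tadj | | by apply: IHn; lia | by apply: IHn; lia].
  have := R_ex (- b - c) (- b' - c') (- (b - 1) - c) (- (b' + 1) - c').
  have := L_ex b' b (b' + 1) (b - 1); rewrite /=; lia.
- apply: (lnk_exchange (u' := VT b (c - 1)) (v' := VT b' (c' + 1)) lo);
    [tadj | tadj | | by apply: IHn; lia | by apply: IHn; lia].
  have := R_ex (- b - c) (- b' - c') (- b - (c - 1)) (- b' - (c' + 1)).
  have := B_ex c' c (c' + 1) (c - 1); rewrite /=; lia.
- apply: (lnk_exchange (u' := VT (b + 1) c) (v' := VT (b' - 1) c') lo);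
    [tadj | tadj | | by apply: IHn; lia | by apply: IHn; lia].
  have := R_ex (- b' - c') (- b - c) (- (b' - 1) - c') (- (b + 1) - c).
  have := L_ex b b' (b + 1) (b' - 1); rewrite /=; lia.
- apply: (lnk_exchange (u' := VT b (c + 1)) (v' := VT b' (c' - 1)) lo);
    [tadj | tadj | | by apply: IHn; lia | by apply: IHn; lia].
  have := R_ex (- b' - c') (- b - c) (- b' - (c' - 1)) (- b - (c + 1)).
  have := B_ex c c' (c + 1) (c' - 1); rewrite /=; lia.
- apply: (lnk_exchange (u' := VT (b + 1) (c - 1)) (v' := VT (b' - 1) (c' + 1)) lo);
    [tadj | tadj | | by apply: IHn; lia | by apply: IHn; lia].
  have := L_ex b b' (b + 1) (b' - 1); have := B_ex c' c (c' + 1) (c - 1).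
  rewrite /=; have -> : - (b + 1) - (c - 1) = - b - c by lia.
  have -> : - (b' - 1) - (c' + 1) = - b' - c' by lia.
  lia.
- apply: (lnk_exchange (u' := VT (b - 1) (c + 1)) (v' := VT (b' + 1) (c' - 1)) lo);
    [tadj | tadj | | by apply: IHn; lia | by apply: IHn; lia].
  have := L_ex b' b (b' + 1) (b - 1); have := B_ex c c' (c + 1) (c' - 1).
  rewrite /=; have -> : - (b - 1) - (c + 1) = - b - c by lia.
  have -> : - (b' + 1) - (c' - 1) = - b' - c' by lia.
  lia.
Qed.

Lemma lnk_step D u v' v : low D u v -> lval D v' < lw D -> ladj v' v ->
  (low D u v' -> lnk D u v') -> lnk D u v.
Proof.
move=> [uw _ _] v'w vv' IH.
by apply: (lnk_trans v'w _ (lnk_adj _ vv')); apply: IH; split; [|lia|right].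
Qed.

Lemma ladj_Bp b c c' : c' = c + 1 \/ c = c' + 1 -> ladj (VBp b c) (VBp b c').
Proof.
by case=> ->; [exists (PlB b c) | exists (PlB b c')]; split; onp.
Qed.

Ltac badj := solve [apply: ladj_Bp; lia].

(** The coordinates 1-b-c, b, c of the first end have sum 1, and b is frozen because the
    multiplicity depends on it. Exchanges use the two other coordinates. When b would have to move,
    only the second end moves, and the bound of [lm] by the kink of [lL] keeps it strictly low. *)
Lemma lnk_BpT D b c b' c' : lok D -> low D (VBp b c) (VT b' c') ->
  lnk D (VBp b c) (VT b' c').
Proof.
move=> Dok; have [[RP LP BP] [mP _] [p2 _]] := Dok.
have [n] : exists n : nat, Z.abs (b - b') + Z.abs (c - c') +
    Z.abs (b + c - b' - c' - 1) <= Z.of_nat n.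
  by exists (Z.to_nat (Z.abs (b - b') + Z.abs (c - c') +
    Z.abs (b + c - b' - c' - 1))); lia.
(* Distance 0 is impossible, since the two triples of coordinates have sums 1 and 0. *)
elim: n b c b' c' => [|n IHn] b c b' c' dist lo; first lia.
have R_ex x y x' y' := @wconvex_exchange _ _ x y x' y' RP.
have B_ex x y x' y' := @wconvex_exchange _ _ x y x' y' BP.
have L_mon x x' y y' := @wconvex_mono _ _ x x' y y' LP.
have B_mon x x' y y' := @wconvex_mono _ _ x x' y y' BP.
have R_mon x x' y y' := @wconvex_mono _ _ x x' y y' RP.
have ex_up : 1 - b - c < - b' - c' -> c' < c -> lnk D (VBp b c) (VT b' c').
  move=> Aa cc.
  apply: (lnk_exchange (u' := VBp b (c - 1)) (v' := VT b' (c' + 1)) lo);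
    [badj | tadj | | by apply: IHn; lia | by apply: IHn; lia].
  have := R_ex (1 - b - c) (- b' - c') (1 - b - (c - 1)) (- b' - (c' + 1)).
  have := B_ex c' c (c' + 1) (c - 1); rewrite /=; lia.
have ex_dn : - b' - c' < 1 - b - c -> c < c' -> lnk D (VBp b c) (VT b' c').
  move=> Aa cc.
  apply: (lnk_exchange (u' := VBp b (c + 1)) (v' := VT b' (c' - 1)) lo);
    [badj | tadj | | by apply: IHn; lia | by apply: IHn; lia].
  have := R_ex (- b' - c') (1 - b - c) (- b' - (c' - 1)) (1 - b - (c + 1)).
  have := B_ex c c' (c + 1) (c' - 1); rewrite /=; lia.
have [Aa|Aa] := Z.lt_ge_cases (1 - b - c) (- b' - c').
  have [cc|cc] := Z.lt_ge_cases c' c; first exact: ex_up.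
  have bb : b' < b by lia.
  apply: (lnk_step (v' := VT (b' + 1) c') lo);
    [|tadj | by apply: IHn; lia].
  (* With m = [lm D b], [p2] makes the slope of [lR] after 1-b-c at least w - m, while [mP] makes
     the slope of [lL] before b at most w - m. The move therefore does not raise the height, and
     lowers it when the first end is low. *)
  have [] := lo; have := mP b; have := p2 b c; rewrite /=.
  have := L_mon b' (b' + 1) (b - 1) b.
  have := wconvex_slope (x := b) (x' := b + 1) LP.
  have := R_mon (1 - b - c) (2 - b - c) (- (b' + 1) - c') (- b' - c').
  lia.
have [cc|cc] := Z.lt_ge_cases c c'.
  have [Aa'|Aa'] := Z.lt_ge_cases (- b' - c') (1 - b - c); first exact: ex_dn.
  apply: (lnk_step (v' := VT (b' + 1) (c' - 1)) lo);
    [|tadj | by apply: IHn; lia].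
  have [] := lo; have := mP b; have := p2 b (c + 1); rewrite /=.
  have -> : 2 - b - (c + 1) = 1 - b - c by lia.
  have -> : - (b' + 1) - (c' - 1) = - b' - c' by lia.
  have := L_mon b' (b' + 1) (b - 1) b.
  have := wconvex_slope (x := b) (x' := b + 1) LP.
  have := B_mon c (c + 1) (c' - 1) c'.
  lia.
have [bb|bb] : b' <= b \/ b < b' by lia.
  apply: lnk_adj; exists (PlP b c); split; first by onp.
  have [[-> ->]|[[-> ->]|[-> ->]]] : b' = b - 1 /\ c' = c \/
    (b' = b /\ c' = c \/ b' = b /\ c' = c - 1) by lia.
  - by onp.
  - by onp.
  - by onp.
have [cc'|cc'] : c' = c \/ c' < c by lia.
  have t0adj : ladj (VBp b c) (VT b c) by exists (PlP b c); split; onp.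
  (* If [VT b c] is not low, the slope of [lR] before 1-b-c is at most [lm D b], and the slope of
     [lL] after b is at least that: the second end can move along b. *)
  have [t0w|t0w] := Z.lt_ge_cases (lval D (VT b c)) (lw D).
    apply: (lnk_trans t0w (lnk_adj _ t0adj)); apply: lnk_TT => //.
    by have [_ tw _] := lo; split; [lia | | left].
  apply: (lnk_step (v' := VT (b' - 1) c') lo);
    [|tadj | by apply: IHn; lia].
  have [] := lo; have := mP b; move: t0w; rewrite /=.
  have := L_mon b (b + 1) (b' - 1) b'.
  have := wconvex_slope (x := b - 1) (x' := b) LP.
  have := R_mon (- b' - c') (- (b' - 1) - c') (- b - c) (1 - b - c).
  lia.
have t0adj : ladj (VBp b c) (VT b (c - 1)) by exists (PlP b c); split; onp.
have [t0w|t0w] := Z.lt_ge_cases (lval D (VT b (c - 1))) (lw D).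
  apply: (lnk_trans t0w (lnk_adj _ t0adj)); apply: lnk_TT => //.
  by have [_ tw _] := lo; split; [lia | | left].
apply: (lnk_step (v' := VT (b' - 1) (c' + 1)) lo);
  [|tadj | by apply: IHn; lia].
have [] := lo; have := mP b; move: t0w; rewrite /=.
have -> : - b - (c - 1) = 1 - b - c by lia.
have -> : - (b' - 1) - (c' + 1) = - b' - c' by lia.
have := L_mon b (b + 1) (b' - 1) b'.
have := wconvex_slope (x := b - 1) (x' := b) LP.
have := B_mon c' (c' + 1) (c - 1) c.
lia.
Qed.

Lemma low_sym D u v : low D u v -> low D v u.
Proof. by case=> ? ? []; split=> //; [right|left]. Qed.

Lemma lnk_via D (phi : ldata -> ldata) (psi : lvert -> lvert) u v :
    (forall E, lok E -> lok (phi E)) -> (forall E, lw (phi E) = lw E) ->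
    involutive psi -> (forall E v, lval E (psi v) = lval (phi E) v) ->
    (forall E u v, lnk (phi E) u v -> lnk E (psi u) (psi v)) ->
    (forall E, lok E -> low E (psi u) (psi v) -> lnk E (psi u) (psi v)) ->
  lok D -> low D u v -> lnk D u v.
Proof.
move=> phiP wP psiK valP lnkP IH Dok [uw vw uvw].
rewrite -[u]psiK -[v]psiK; apply: lnkP; apply: IH; first exact: phiP.
by rewrite /low -!valP !psiK wP.
Qed.

Lemma lnk_via_neg D u v :
    (forall E, lok E -> low E (lneg_vert u) (lneg_vert v) ->
      lnk E (lneg_vert u) (lneg_vert v)) ->
  lok D -> low D u v -> lnk D u v.
Proof.
by apply: lnk_via; [exact: lok_neg | | exact: lneg_vertK | exact: lneg_val
  | exact: lnk_neg].
Qed.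

Lemma lnk_via_swap D u v :
    (forall E, lok E -> low E (lswap_vert u) (lswap_vert v) ->
      lnk E (lswap_vert u) (lswap_vert v)) ->
  lok D -> low D u v -> lnk D u v.
Proof.
by apply: lnk_via; [exact: lok_swap | | exact: lswap_vertK | exact: lswap_val
  | exact: lnk_swap].
Qed.

Lemma lnk_T D v b c : lok D -> low D v (VT b c) -> lnk D v (VT b c).
Proof.
case: v => b' c'.
- exact: lnk_TT.
- exact: lnk_BpT.
- by apply: lnk_via_neg => E Eok; apply: lnk_BpT.
- by apply: lnk_via_swap => E Eok; apply: lnk_BpT.
- apply: lnk_via_swap => E Eok; apply: lnk_via_neg => // E' Eok'.
  exact: lnk_BpT.
Qed.

Definition vB (s : bool) b c := if s then VBp b c else VBm b c.
Definition vA (s : bool) b c := if s then VAp b c else VAm b c.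
Definition sg (s : bool) : Z := if s then 1 else -1.

(** The common b makes the multiplicities cancel in the comparison, so the exchange takes place
    between [lR] and [lB] alone. *)
Lemma lnk_BpB D s b c c' : lok D -> low D (VBp b c) (vB s b c') ->
  lnk D (VBp b c) (vB s b c').
Proof.
move=> [[RP LP BP] _ _].
have [n] : exists n : nat, Z.abs (c - c') <= Z.of_nat n.
  by exists (Z.to_nat (Z.abs (c - c'))); lia.
elim: n c c' => [|n IHn] c c' dist lo.
  have -> : c' = c by lia.
  by apply: lnk_adj; exists (PlB b c); case: (s); split; onp.
have R_ex x y x' y' := @wconvex_exchange _ _ x y x' y' RP.
have B_ex x y x' y' := @wconvex_exchange _ _ x y x' y' BP.
have [Aa|Aa] := Z.lt_ge_cases (1 - b - c) (sg s - b - c').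
  have cc : c' < c by move: Aa; case: (s) => /=; lia.
  apply: (lnk_exchange (u' := VBp b (c - 1)) (v' := vB s b (c' + 1)) lo);
    [badj | | | by apply: IHn; lia | by apply: IHn; lia].
    case: (s); first by badj.
    by exists (PlB b (c' + 1)); split; onp.
  have := R_ex (1 - b - c) (sg s - b - c') (1 - b - (c - 1)) (sg s - b - (c' + 1)).
  have := B_ex c' c (c' + 1) (c - 1).
  by move: Aa; case: (s) => /=; lia.
have [cc|cc] := Z.lt_ge_cases c c'.
  apply: (lnk_exchange (u' := VBp b (c + 1)) (v' := vB s b (c' - 1)) lo);
    [badj | | | by apply: IHn; lia | by apply: IHn; lia].
    case: (s); first by badj.
    by exists (PlB b c'); split; onp.
  have := R_ex (sg s - b - c') (1 - b - c) (sg s - b - (c' - 1)) (1 - b - (c + 1)).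
  have := B_ex c c' (c + 1) (c' - 1).
  by move: Aa; case: (s) => /=; lia.
apply: lnk_adj; case: (s) Aa => /= Aa.
  by exists (PlB b c); split; onp.
have [c0 [H1 H2]] : exists c0, (c = c0 \/ c = c0 + 1) /\ (c' = c0 \/ c' = c0 - 1).
  have [->|[-> | ->]] : c' = c \/ (c' = c - 1 \/ c' = c - 2) by lia.
  - by exists c; lia.
  - by exists c; lia.
  - by exists (c - 1); lia.
by exists (PlB b c0); split; [case: H1 => -> | case: H2 => ->]; onp.
Qed.

Lemma lnk_BB D s s' b c c' : lok D -> low D (vB s b c) (vB s' b c') ->
  lnk D (vB s b c) (vB s' b c').
Proof.
case: s; first exact: lnk_BpB.
apply: lnk_via_neg => E Eok.
have -> : lneg_vert (vB s' b c') = vB (~~ s') (- b) (- c') by case: s'.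
exact: lnk_BpB.
Qed.

Lemma lnk_AA D s s' b c b' c' : lok D -> sg s - b - c = sg s' - b' - c' ->
  low D (vA s b c) (vA s' b' c') -> lnk D (vA s b c) (vA s' b' c').
Proof.
move=> Dok aa; apply: lnk_via_swap Dok => E Eok.
have -> : lswap_vert (vA s b c) = vB s (sg s - b - c) c by case: s {aa}.
have -> : lswap_vert (vA s' b' c') = vB s' (sg s' - b' - c') c' by case: s' {aa}.
rewrite aa; exact: lnk_BB.
Qed.

(** * Links without low vertices of type [VT] *)

Definition slopes_in (F : Z -> Z) x lo hi := F x - F (x - 1) <= lo /\
  hi <= F (x + 1) - F x.

(* If no vertex of type VT is low, a leaf of mass m and height w - d sees
   slopes at most m - d before it and at least w - (m - d) after it. *)
Definition noT D := forall b c, lw D <= lval D (VT b c).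

Definition leafP D A b c m v := let d := lw D - lval D v in
  [/\ slopes_in (lR D) A (m - d) (lw D - (m - d)),
      slopes_in (lL D) b (m - d) (lw D - (m - d)) &
      slopes_in (lB D) c (m - d) (lw D - (m - d))].

(** The three adjacent vertices of type [VT] have height at least w, which bounds the slopes before
    the leaf; [p2], one unit further in each coordinate, bounds the slopes after it. *)
Lemma leafBp D b c : lok D -> noT D -> lval D (VBp b c) <= lw D ->
  leafP D (1 - b - c) b c (lm D b) (VBp b c).
Proof.
move=> [_ _ [p2 _]] nT vw.
have := nT b c; have := nT (b - 1) c; have := nT b (c - 1).
have := p2 b c; have := p2 (b + 1) c; have := p2 b (c + 1).
rewrite /leafP /slopes_in /= in vw *.
have -> : - b - c = 1 - b - c - 1 by lia.
have -> : - (b - 1) - c = 1 - b - c by lia.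
have -> : - b - (c - 1) = 1 - b - c by lia.
have -> : 2 - b - c = 1 - b - c + 1 by lia.
have -> : 2 - (b + 1) - c = 1 - b - c by lia.
have -> : 2 - b - (c + 1) = 1 - b - c by lia.
by move=> *; split; split; lia.
Qed.

Lemma noT_neg D : noT D -> noT (lneg D).
Proof. by move=> nT b c; rewrite -lneg_val; apply: nT. Qed.
Lemma noT_swap D : noT D -> noT (lswap D).
Proof. by move=> nT b c; rewrite -lswap_val; apply: nT. Qed.

Lemma leafB D s b c : lok D -> noT D -> lval D (vB s b c) <= lw D ->
  leafP D (sg s - b - c) b c (lm D b) (vB s b c).
Proof.
case: s => Dok nT; first exact: leafBp.
rewrite /vB -[VBm b c](lneg_vertK) lneg_val => vw.
have := leafBp (lok_neg Dok) (noT_neg nT) vw.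
rewrite /leafP /slopes_in -lneg_val lneg_vertK; move: (lval D _) => x.
rewrite [lw (lneg D)]/= [lR (lneg D)]/= [lL (lneg D)]/= [lB (lneg D)]/=.
rewrite [lm (lneg D) _]/= /fneg !Z.opp_involutive.
have -> : - (1 - - b - - c) = -1 - b - c by lia.
have -> : - (1 - - b - - c - 1) = -1 - b - c + 1 by lia.
have -> : - (1 - - b - - c + 1) = -1 - b - c - 1 by lia.
have -> : - (- b - 1) = b + 1 by lia.
have -> : - (- b + 1) = b - 1 by lia.
have -> : - (- c - 1) = c + 1 by lia.
have -> : - (- c + 1) = c - 1 by lia.
by rewrite /sg => -[[? ?] [? ?] [? ?]]; split; split; lia.
Qed.

Lemma leafA D s b c : lok D -> noT D -> lval D (vA s b c) <= lw D ->
  leafP D (sg s - b - c) b c (ln D (sg s - b - c)) (vA s b c).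
Proof.
move=> Dok nT.
have <- : lswap_vert (vB s (sg s - b - c) c) = vA s b c.
  by case: s => /=; f_equal; lia.
rewrite lswap_val => vw.
have := leafB (lok_swap Dok) (noT_swap nT) vw.
rewrite /leafP /slopes_in lswap_val; move: (lval _ _) => x /=.
have -> : sg s - (sg s - b - c) - c = b by lia.
by move=> [? ? ?]; split.
Qed.

Lemma vB_val D s b c : lval D (vB s b c) = (if s then 0 else lw D) +
  lR D (sg s - b - c) + lL D b + lB D c - lm D b.
Proof. by case: s => /=; lia. Qed.
Lemma vA_val D s b c : lval D (vA s b c) = (if s then 0 else lw D) +
  lR D (sg s - b - c) + lL D b + lB D c - ln D (sg s - b - c).
Proof. by case: s => /=; lia. Qed.

Lemma vBA_adj s b c : ladj (vB s b c) (vA s b c).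
Proof. by case: s; [exists (PlP b c) | exists (PlM b c)]; split; onp. Qed.

(* Two distinct centres of the same fibration cannot both carry more than
   the slopes between them allow. *)
Lemma slopes_in_le w F x y lo hi : wconvex w F -> x < y ->
  slopes_in F x lo hi -> hi <= F y - F (y - 1).
Proof.
move=> Fc xy [_ h]; have xy' : x <= y - 1 by lia.
have := wconvex_mono (x' := x + 1) (y' := y) Fc xy'; lia.
Qed.

(** If b and b' differ, let m, m' be the multiplicities and w - d, w - d' the heights of the leaves.
    Convexity of [lL] between b and b' gives m <= m' - d' and m' <= m - d, whereas lowness means d +
    d' > 0: the case is void. *)
Lemma lnk_BB_noT D s s' b c b' c' : lok D -> noT D ->
  low D (vB s b c) (vB s' b' c') -> lnk D (vB s b c) (vB s' b' c').
Proof.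
move=> Dok nT; have [<-|nb] := Z.eq_dec b b'; first exact: lnk_BB.
move=> lo; case: (Dok) => [[_ LP _] [mP _] _]; case: (lo) => uw vw _.
have [_ Lb _] := leafB Dok nT uw; have [_ Lb' _] := leafB Dok nT vw.
have := mP b; have := mP b'.
have := wconvex_slope (x := b) (x' := b + 1) LP.
have := wconvex_slope (x := b') (x' := b' + 1) LP.
have := wconvex_slope (x := b - 1) (x' := b) LP.
have := wconvex_slope (x := b' - 1) (x' := b') LP.
have := @slopes_in_le _ _ b b' _ _ LP _ Lb.
have := @slopes_in_le _ _ b' b _ _ LP _ Lb'.
case: Lb Lb' lo => ? ? [? ?] [? ? ?].
have [lt|lt] : b <= b' - 1 \/ b' <= b - 1 by lia.
  have := wconvex_mono (x' := b + 1) (y' := b') LP lt; lia.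
have := wconvex_mono (x' := b' + 1) (y' := b) LP lt; lia.
Qed.

(** If both centres differ, [nm] and [mn] contradict lowness. If one is shared, the path turns
    around it through the leaf that combines the position of one end with the type of the other;
    trading the smaller multiplicity for the larger makes this leaf low. *)
Lemma lnk_BA_noT D s s' b c b' c' : lok D -> noT D ->
  low D (vB s b c) (vA s' b' c') -> lnk D (vB s b c) (vA s' b' c').
Proof.
move=> Dok nT lo; case: (Dok) => [[RP LP _] [mP nP] _]; case: (lo) => uw vw uvw.
have [Ru Lu _] := leafB Dok nT uw; have [Rv Lv _] := leafA Dok nT vw.
set A := sg s - b - c in Ru; set a := sg s' - b' - c' in Rv Lv.
(* The centre with the smaller mass is passed by both leaves. *)
have nm : A <> a -> ln D a <= lm D b - (lw D - lval D (vB s b c)).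
  move=> Aa; have [lt|lt] : A < a \/ a < A by lia.
    have := slopes_in_le RP lt Ru; have := nP a.
    have := wconvex_slope (x := a) (x' := a + 1) RP.
    lia.
  have lt' : a <= A - 1 by lia.
  have := wconvex_mono (x' := a + 1) (y' := A) RP lt'; have := nP a.
  have := wconvex_slope (x := a - 1) (x' := a) RP.
  case: Ru; lia.
have mn : b <> b' -> lm D b <= ln D a - (lw D - lval D (vA s' b' c')).
  move=> bb; have [lt|lt] : b' < b \/ b < b' by lia.
    have := slopes_in_le LP lt Lv; have := mP b.
    have := wconvex_slope (x := b) (x' := b + 1) LP.
    lia.
  have lt' : b <= b' - 1 by lia.
  have := wconvex_mono (x' := b + 1) (y' := b') LP lt'; have := mP b.
  have := wconvex_slope (x := b - 1) (x' := b) LP.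
  case: Lv; lia.
have viaB : b = b' -> lval D (vA s' b' c') + ln D a - lm D b < lw D ->
    lnk D (vB s b c) (vA s' b' c').
  move=> bb zw; have zE : lval D (vB s' b c') < lw D.
    by move: zw; rewrite vB_val vA_val /a -bb; lia.
  apply: (lnk_trans zE); last by rewrite -bb; apply: lnk_adj; apply: vBA_adj.
  by apply: lnk_BB => //; split; [|lia|right].
have viaA : A = a -> lval D (vB s b c) + lm D b - ln D a < lw D ->
    lnk D (vB s b c) (vA s' b' c').
  move=> Aa zw; have zE : lval D (vA s b c) < lw D.
    by move: zw; rewrite vB_val vA_val -Aa /A; lia.
  apply: (lnk_trans zE); first by apply: lnk_adj; apply: vBA_adj.
  by apply: lnk_AA => //; split; [lia| |left].
have [bb|bb] := Z.eq_dec b b'; have [Aa|Aa] := Z.eq_dec A a.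
- have [lt|lt] := Z.lt_ge_cases
    (lval D (vA s' b' c') + ln D a - lm D b) (lw D); first exact: viaB.
  by apply: viaA => //; lia.
- by apply: viaB => //; have := nm Aa; lia.
- by apply: viaA => //; have := mn bb; lia.
- by have := nm Aa; have := mn bb; lia.
Qed.

Lemma lnk_AA_noT D s s' b c b' c' : lok D -> noT D ->
  low D (vA s b c) (vA s' b' c') -> lnk D (vA s b c) (vA s' b' c').
Proof.
have sw r x y : vA r x y = lswap_vert (vB r (sg r - x - y) y).
  by case: r => /=; f_equal; lia.
rewrite !sw => Dok nT lo; apply: lnk_swap; apply: lnk_BB_noT.
- exact: lok_swap.
- exact: noT_swap.
- by move: lo; rewrite /low !lswap_val.
Qed.

Lemma lvert_cases v :
  [\/ exists b c, v = VT b c, exists s b c, v = vB s b c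
    | exists s b c, v = vA s b c].
Proof.
case: v => b c.
- by constructor 1; exists b, c.
- by constructor 2; exists true, b, c.
- by constructor 2; exists false, b, c.
- by constructor 3; exists true, b, c.
- by constructor 3; exists false, b, c.
Qed.

(** A low vertex of type [VT], if there is one, relays between any two ends; otherwise the bounds on
    leaves apply. *)
Lemma lnk_low D u v : lok D -> low D u v -> lnk D u v.
Proof.
move=> Dok lo; have [[t [b [c [tE tw]]]]|noT'] := EM (exists v, exists b c,
    v = VT b c /\ lval D v < lw D).
  subst t; have [uw vw _] := lo; apply: (lnk_trans tw).
    by apply: lnk_T => //; split; [|lia|right].
  by apply: lnk_sym; apply: lnk_T => //; split; [|lia|right].
have nT : noT D.
  move=> b c; have [//|lt] := Z.le_gt_cases (lw D) (lval D (VT b c)).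
  by case: noT'; exists (VT b c), b, c.
case: (lvert_cases u) lo => [[b [c ->]]|[s [b [c ->]]]|[s [b [c ->]]]] lo.
- by apply: lnk_sym; apply: lnk_T => //; apply: low_sym.
- case: (lvert_cases v) lo => [[b' [c' ->]]|[s' [b' [c' ->]]]|[s' [b' [c' ->]]]] lo.
  + exact: lnk_T.
  + exact: lnk_BB_noT.
  + exact: lnk_BA_noT.
- case: (lvert_cases v) lo => [[b' [c' ->]]|[s' [b' [c' ->]]]|[s' [b' [c' ->]]]] lo.
  + exact: lnk_T.
  + by apply: lnk_sym; apply: lnk_BA_noT => //; apply: low_sym.
  + exact: lnk_AA_noT.
Qed.
End LinkOfAFibration.

Local Open Scope ring_scope.

(** * Orders of vanishing and support functions *)

Section IntegerPowers.
Variable F : fieldType.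

Definition fz (x : F) (n : Z) : F := match n with
  | Z0 => 1 | Zpos k => x ^+ Pos.to_nat k | Zneg k => x ^- Pos.to_nat k end.

Lemma fz_nat x n : fz x (Z.of_nat n) = x ^+ n.
Proof. by case: n => // n; rewrite /= SuccNat2Pos.id_succ. Qed.

Lemma fz_to_nat x n : (0 <= n)%ZZ -> x ^+ Z.to_nat n = fz x n.
Proof. by move=> n0; rewrite -fz_nat Z2Nat.id. Qed.

Lemma fzN x n : fz x (- n) = (fz x n)^-1.
Proof. by case: n => [|k|k] /=; rewrite ?invr1 ?invrK. Qed.

Lemma fzD x m n : x != 0 -> fz x (m + n) = fz x m * fz x n.
Proof.
move=> x0.
have S k : fz x (k + 1) = fz x k * x.
  have [k0|k0] := Z.le_gt_cases 0 k.
    have -> : k = Z.of_nat (Z.to_nat k) by lia.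
    have -> : (Z.of_nat (Z.to_nat k) + 1 = Z.of_nat (Z.to_nat k).+1)%ZZ by lia.
    by rewrite !fz_nat exprSr.
  have -> : k = (- Z.of_nat (Z.to_nat (- k - 1)).+1)%ZZ by lia.
  have -> : (- Z.of_nat (Z.to_nat (- k - 1)).+1 + 1 =
    - Z.of_nat (Z.to_nat (- k - 1)))%ZZ by lia.
  by rewrite !fzN !fz_nat exprS invfM mulrAC mulVf ?mul1r.
have [n0|n0] := Z.le_gt_cases 0 n.
  have -> : n = Z.of_nat (Z.to_nat n) by lia.
  elim: (Z.to_nat n) => [|k IHk]; first by rewrite Z.add_0_r mulr1.
  have -> : Z.of_nat k.+1 = (Z.of_nat k + 1)%ZZ by lia.
  by rewrite Z.add_assoc !S IHk mulrA.
have -> : n = (- Z.of_nat (Z.to_nat (- n)))%ZZ by lia.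
elim: (Z.to_nat (- n)) => [|k IHk]; first by rewrite Z.add_0_r mulr1.
apply: (mulIf x0); rewrite -S.
have -> : (m + - Z.of_nat k.+1 + 1 = m + - Z.of_nat k)%ZZ by lia.
by rewrite IHk -mulrA -S; congr (_ * fz x _); lia.
Qed.

Lemma fz_neq0 x n : x != 0 -> fz x n != 0.
Proof. by move=> x0; case: n => [|k|k] /=; rewrite ?oner_eq0 ?invr_eq0 ?expf_neq0. Qed.

Lemma fzM x m (n : nat) : x != 0 -> fz x (m * Z.of_nat n) = fz x m ^+ n.
Proof.
move=> x0; elim: n => [|n IHn]; first by rewrite Z.mul_0_r.
have -> : (m * Z.of_nat n.+1 = m + m * Z.of_nat n)%ZZ by lia.
by rewrite fzD // IHn exprS.
Qed.
End IntegerPowers.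

Section Orders.
Variable E : idomainType.
Implicit Types p q u v : {poly E}.

Definition ordp (a : E) p : nat := sval (multiplicity_XsubC p a).

Lemma ordpP p a : p != 0 ->
  exists2 q, q.[a] != 0 & p = q * ('X - a%:P) ^+ ordp a p.
Proof.
move=> p0; rewrite /ordp; case: multiplicity_XsubC => m [q] /=.
by rewrite p0 /= => qa pE; exists q.
Qed.

Lemma ordp_unique p a q m : q.[a] != 0 -> p = q * ('X - a%:P) ^+ m ->
  ordp a p = m.
Proof.
move=> qa pE; have p0 : p != 0.
  rewrite pE mulf_neq0 ?expf_neq0 ?polyXsubC_eq0 //.
  by apply: contraNneq qa => ->; rewrite horner0.
have [r ra pE'] := ordpP a p0.
have cancel k l s t : s.[a] != 0 -> t.[a] != 0 ->
    s * ('X - a%:P) ^+ k = t * ('X - a%:P) ^+ l -> (k <= l)%N -> k = l.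
  move=> sa ta st kl; move: st; rewrite -(subnK kl) exprD mulrA.
  have X0 : ('X - a%:P) ^+ k != 0 by rewrite expf_neq0 ?polyXsubC_eq0.
  move/(mulIf X0)/(congr1 (horner^~ a)); case E0 : (l - k)%N => [|d] /=.
    by [].
  rewrite hornerM horner_exp hornerXsubC subrr expr0n mulr0 => /eqP.
  by rewrite (negPf sa).
have [le|le] := leqP (ordp a p) m.
  by apply: (cancel _ _ r q) => //; rewrite -pE' -pE.
by apply/esym; apply: (cancel _ _ q r) => //; rewrite -?pE' -?pE // ltnW.
Qed.

Lemma ordpM a p q : p != 0 -> q != 0 ->
  ordp a (p * q) = (ordp a p + ordp a q)%N.
Proof.
move=> p0 q0; have [r ra rE] := ordpP a p0; have [s sa sE] := ordpP a q0.
apply: (@ordp_unique _ _ (r * s)); first by rewrite hornerM mulf_neq0.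
by rewrite {1}rE {1}sE exprD mulrACA.
Qed.

Lemma ordp0 a p : p.[a] != 0 -> ordp a p = 0%N.
Proof. by move=> pa; apply: (ordp_unique pa); rewrite expr0 mulr1. Qed.

Lemma decomp u : exists v, u != 0 -> [/\ v.[0] != 0, v.[-1] != 0 &
  u = 'X ^+ ordp 0 u * ('X + 1) ^+ ordp (-1) u * v].
Proof.
have [->|u0] := eqVneq u 0; first by exists 0 => /eqP.
have [q q0 uE] := ordpP 0 u0.
have qn0 : q != 0 by apply: contraNneq q0 => ->; rewrite horner0.
have [v v1 qE] := ordpP (-1) qn0; exists v => _; split=> //.
  by apply: contraNneq q0 => v0; rewrite qE hornerM v0 mul0r.
have o1 : ordp (-1) u = ordp (-1) q.
  rewrite {1}uE ordpM ?expf_neq0 ?polyXsubC_eq0 // [X in (_ + X)%N]ordp0 ?addn0 //.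
  by rewrite horner_exp hornerXsubC subr0 expf_neq0 // oppr_eq0 oner_eq0.
rewrite o1 {1}uE {1}qE subr0 rmorphN opprK rmorph1.
by rewrite mulrC [v * _]mulrC mulrA.
Qed.

Definition core u : {poly E} := projT1 (cid (decomp u)).

Lemma coreP u : u != 0 -> [/\ (core u).[0] != 0, (core u).[-1] != 0 &
  u = 'X ^+ ordp 0 u * ('X + 1) ^+ ordp (-1) u * core u].
Proof. by rewrite /core; case: cid => v vP /vP. Qed.

Lemma X1_neq0 : ('X + 1 : {poly E}) != 0.
Proof. by rewrite -polyC1 -size_poly_eq0 size_XaddC. Qed.

Lemma size_mono k l v : v != 0 ->
  size ('X ^+ k * ('X + 1) ^+ l * v : {poly E}) = (k + l + size v)%N.
Proof.
move=> v0; rewrite size_mul ?mulf_neq0 ?expf_neq0 ?polyX_eq0 ?X1_neq0 //.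
rewrite size_mul ?expf_neq0 ?polyX_eq0 ?X1_neq0 // size_polyXn.
have -> : size (('X + 1 : {poly E}) ^+ l) = l.+1.
  elim: l => [|l IHl]; first by rewrite expr0 size_poly1.
  rewrite exprS size_mul ?expf_neq0 ?X1_neq0 // IHl -polyC1 size_XaddC.
  by [].
by rewrite addnS.
Qed.

Lemma ord0_mono k l v : v.[0] != 0 ->
  ordp 0 ('X ^+ k * ('X + 1) ^+ l * v) = k.
Proof.
move=> v0; apply: (@ordp_unique _ _ (('X + 1) ^+ l * v)).
  rewrite hornerM horner_exp hornerD hornerX hornerC add0r expr1n mul1r //.
by rewrite subr0 -mulrA mulrC.
Qed.

Lemma ord1_mono k l v : v.[-1] != 0 ->
  ordp (-1) ('X ^+ k * ('X + 1) ^+ l * v) = l.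
Proof.
move=> v1; apply: (@ordp_unique _ _ ('X ^+ k * v)).
  by rewrite hornerM horner_exp hornerX mulf_neq0 // expf_neq0 // oppr_eq0 oner_eq0.
by rewrite rmorphN opprK rmorph1 mulrAC.
Qed.

Lemma core_neq0 u : u != 0 -> core u != 0.
Proof. by case/coreP => c0 _ _; apply: contraNneq c0 => ->; rewrite horner0. Qed.

Definition degz u : Z := Z.of_nat (size u).-1.
Definition oz0 u : Z := Z.of_nat (ordp 0 u).
Definition oz1 u : Z := Z.of_nat (ordp (-1) u).

Lemma degz_core u : u != 0 -> degz u = (oz0 u + oz1 u + degz (core u))%ZZ.
Proof.
move=> u0; have [_ _ uE] := coreP u0; have c0 := core_neq0 u0.
rewrite /degz {1}uE size_mono // /oz0 /oz1.
have : (0 < size (core u))%N by rewrite lt0n size_poly_eq0.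
move: (size (core u)) => [//|n] _; rewrite addnS /=; lia.
Qed.

(* [h 0] is the default value, so [s] is meant to contain 0. *)
Definition supz (s : seq nat) (h : nat -> Z) : Z :=
  foldr (fun j m => Z.max (h j) m) (h 0%N) s.

Lemma supz_ge s h j : j \in s -> (h j <= supz s h)%ZZ.
Proof.
elim: s => //= i s IHs; rewrite inE => /orP[/eqP->|/IHs]; lia.
Qed.

Lemma supz_max s h : 0%N \in s -> exists2 j, j \in s & supz s h = h j.
Proof.
move=> s0; suff [->|[j js ->]] : supz s h = h 0%N \/
    exists2 j, j \in s & supz s h = h j; [by exists 0%N | by exists j |].
elim: s {s0} => [|i s [E1|[j js E1]]] /=; first by left.
  have [E2|E2] : supz (i :: s) h = h i \/ supz (i :: s) h = supz s h.
    by rewrite /=; lia.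
    by right; exists i; rewrite ?mem_head.
  by left; rewrite -[LHS]/(supz (i :: s) h) E2.
right; have [E2|E2] : supz (i :: s) h = h i \/ supz (i :: s) h = supz s h.
  by rewrite /=; lia.
  by exists i; rewrite ?mem_head.
by exists j; rewrite ?inE ?js ?orbT // -[LHS]/(supz (i :: s) h) E2.
Qed.

Arguments supz_ge [s] h [j].
Arguments supz_max [s] h.

Lemma supz_unique s h m : 0%N \in s -> (forall j, j \in s -> (h j <= m)%ZZ) ->
  (exists2 j, j \in s & h j = m) -> supz s h = m.
Proof.
move=> s0 hm [j js jm]; have := supz_ge h js; have [i si ->] := supz_max h s0.
by have := hm _ si; lia.
Qed.

Lemma supz_wconvex s h (w : nat) : 0%N \in s -> w \in s ->
    (forall j, j \in s -> (j <= w)%N) ->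
  wconvex (Z.of_nat w) (fun x => supz s (fun j => x * Z.of_nat j + h j)%ZZ).
Proof.
move=> s0 sw sle.
have jw j : j \in s -> (0 <= Z.of_nat j <= Z.of_nat w)%ZZ.
  by move=> /sle; lia.
split=> [x|x y xy].
  have [j sj E1] := supz_max (fun j => (x + 1) * Z.of_nat j + h j)%ZZ s0.
  have [i si E2] := supz_max (fun j => x * Z.of_nat j + h j)%ZZ s0.
  have := supz_ge (fun j => (x + 1) * Z.of_nat j + h j)%ZZ si.
  have := supz_ge (fun j => x * Z.of_nat j + h j)%ZZ sj.
  have := jw _ si; have := jw _ sj; rewrite E1 E2; lia.
have [j sj E1] := supz_max (fun j => (x + 1) * Z.of_nat j + h j)%ZZ s0.
have [i si E2] := supz_max (fun j => y * Z.of_nat j + h j)%ZZ s0.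
have /= := supz_ge (fun j => x * Z.of_nat j + h j)%ZZ sj.
have /= := supz_ge (fun j => x * Z.of_nat j + h j)%ZZ si.
have /= := supz_ge (fun j => (y + 1) * Z.of_nat j + h j)%ZZ sj.
have /= := supz_ge (fun j => (y + 1) * Z.of_nat j + h j)%ZZ si.
rewrite E1 E2; move: (supz _ _) (supz _ _) (Z.of_nat j) (Z.of_nat i) (h j) (h i).
(* J is optimal at x + 1 and I at y. If J <= I, both numbers separate the two slopes; otherwise
   exchanging the two maximisers gains (y - x)(J - I). *)
move=> u v J I p q; have [le|le] := Z.le_gt_cases J I; first lia.
have : (0 <= (y - x) * (J - I))%ZZ by apply: Z.mul_nonneg_nonneg; lia.
lia.
Qed.
End Orders.

Arguments supz_ge [s] h [j].
Arguments supz_max [s] h.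

(** * Support functions of a polynomial in two variables *)

Section Bivariate.
Variable E : idomainType.
Implicit Types (f g : {poly {poly E}}) (u v : {poly E}).

Definition supp f := [seq j <- iota 0 (size f) | f`_j != 0].

Lemma mem_supp f j : (j \in supp f) = (f`_j != 0).
Proof.
rewrite mem_filter mem_iota add0n /=; case: (boolP (f`_j != 0)) => //= fj.
by rewrite ltnNge; apply: contraNN fj => /leq_sizeP -> .
Qed.

Lemma supp_le f j : j \in supp f -> (j <= (size f).-1)%N.
Proof.
by rewrite mem_filter mem_iota => /andP[_]; case: (size f) => [|n] /=; lia.
Qed.

Lemma supp_last f : f != 0 -> (size f).-1 \in supp f.
Proof. by rewrite mem_supp -lead_coefE lead_coef_eq0. Qed.

Lemma coef_le f j : f`_j != 0 -> (j <= (size f).-1)%N.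
Proof. by rewrite -mem_supp => /supp_le. Qed.

Definition wz f : Z := Z.of_nat (size f).-1.

Lemma wzB f j : (j <= (size f).-1)%N ->
  Z.of_nat ((size f).-1 - j) = (wz f - Z.of_nat j)%ZZ.
Proof. by rewrite /wz; move: (size f).-1 => n; lia. Qed.

Definition fR f (a : Z) := supz (supp f) (fun j => a * Z.of_nat j + degz f`_j)%ZZ.
Definition fL f (b : Z) := supz (supp f) (fun j => b * Z.of_nat j + - oz0 f`_j)%ZZ.
Definition fB f (c : Z) := supz (supp f) (fun j => c * Z.of_nat j + - oz1 f`_j)%ZZ.

Section Normalised.
Variable f : {poly {poly E}}.
Hypothesis f0 : f`_0 != 0.
Let s0 : 0%N \in supp f. Proof. by rewrite mem_supp. Qed.
Let fn0 : f != 0. Proof. by apply: contraNneq f0 => ->; rewrite coef0. Qed.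

Lemma fR_wconvex : wconvex (wz f) (fR f).
Proof. by apply: supz_wconvex => //; [exact: supp_last | exact: supp_le]. Qed.
Lemma fL_wconvex : wconvex (wz f) (fL f).
Proof. by apply: supz_wconvex => //; [exact: supp_last | exact: supp_le]. Qed.
Lemma fB_wconvex : wconvex (wz f) (fB f).
Proof. by apply: supz_wconvex => //; [exact: supp_last | exact: supp_le]. Qed.

(** The term j = 0 suffices: the degree of the constant coefficient in y is at least the sum of its
    orders at 0 and -1. *)
Lemma fRLB_ge0 a b c : (0 <= fR f a + fL f b + fB f c)%ZZ.
Proof.
have := supz_ge (fun j => a * Z.of_nat j + degz f`_j)%ZZ s0.
have := supz_ge (fun j => b * Z.of_nat j + - oz0 f`_j)%ZZ s0.
have := supz_ge (fun j => c * Z.of_nat j + - oz1 f`_j)%ZZ s0.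
rewrite -/(fR f a) -/(fL f b) -/(fB f c) (degz_core f0) /degz; lia.
Qed.

(** The same comparison of degree and orders, for the leading coefficient in y. *)
Lemma fRLB_ge a b c : ((a + b + c) * wz f <= fR f a + fL f b + fB f c)%ZZ.
Proof.
have sw := supp_last fn0; have fw : f`_(size f).-1 != 0 by rewrite -mem_supp.
have := supz_ge (fun j => a * Z.of_nat j + degz f`_j)%ZZ sw.
have := supz_ge (fun j => b * Z.of_nat j + - oz0 f`_j)%ZZ sw.
have := supz_ge (fun j => c * Z.of_nat j + - oz1 f`_j)%ZZ sw.
rewrite -/(fR f a) -/(fL f b) -/(fB f c) (degz_core fw) /degz /wz; lia.
Qed.

(** Unlike [fB], the functions [fR] and [fL] depend only on which monomials occur: they are support
    functions of the Newton polygon, and are computed below from its extreme points. *)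
Lemma fR_ge a i j : f`_j`_i != 0 -> (a * Z.of_nat j + Z.of_nat i <= fR f a)%ZZ.
Proof.
move=> fji; have fj : f`_j != 0.
  by apply: contraNneq fji => ->; rewrite coef0.
have sj : j \in supp f by rewrite mem_supp.
have := supz_ge (fun j => a * Z.of_nat j + degz f`_j)%ZZ sj; rewrite -/(fR f a).
have : (i < size (f`_j)%R)%N by rewrite ltnNge; apply: contraNN fji => /leq_sizeP ->.
by rewrite /degz; lia.
Qed.

Arguments fR_ge a [i j].

Lemma fR_ex a : exists i j, f`_j`_i != 0 /\ fR f a = (a * Z.of_nat j + Z.of_nat i)%ZZ.
Proof.
have [j sj E1] := supz_max (fun j => a * Z.of_nat j + degz f`_j)%ZZ s0.
exists (size f`_j).-1, j; split; last exact: E1.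
by rewrite -lead_coefE lead_coef_eq0 -mem_supp.
Qed.

Lemma coef_ord0 u : u != 0 -> u`_(ordp 0 u) != 0 /\
  forall i, u`_i != 0 -> (ordp 0 u <= i)%N.
Proof.
move=> u0; have [q q0 uE] := ordpP 0 u0; rewrite subr0 in uE.
split; first by rewrite {1}uE coefMXn ltnn subnn -horner_coef0.
by move=> i; rewrite {1}uE coefMXn; case: ltnP => //; rewrite eqxx.
Qed.

Lemma fL_ge b i j : f`_j`_i != 0 -> (b * Z.of_nat j - Z.of_nat i <= fL f b)%ZZ.
Proof.
move=> fji; have fj : f`_j != 0.
  by apply: contraNneq fji => ->; rewrite coef0.
have sj : j \in supp f by rewrite mem_supp.
have := supz_ge (fun j => b * Z.of_nat j + - oz0 f`_j)%ZZ sj; rewrite -/(fL f b).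
by have [_ /(_ _ fji)] := coef_ord0 fj; rewrite /oz0; lia.
Qed.

Arguments fL_ge b [i j].

Lemma fL_ex b : exists i j, f`_j`_i != 0 /\ fL f b = (b * Z.of_nat j - Z.of_nat i)%ZZ.
Proof.
have [j sj E1] := supz_max (fun j => b * Z.of_nat j + - oz0 f`_j)%ZZ s0.
rewrite mem_supp in sj; have [c0 _] := coef_ord0 sj.
by exists (ordp 0 f`_j), j; split; last by rewrite [LHS]E1 /oz0; lia.
Qed.

Lemma fR_unique a m : (forall i j, f`_j`_i != 0 -> (a * Z.of_nat j + Z.of_nat i <= m)%ZZ) ->
  (exists i j, f`_j`_i != 0 /\ (a * Z.of_nat j + Z.of_nat i = m)%ZZ) -> fR f a = m.
Proof.
move=> le [i [j [fji E1]]]; have := fR_ge a fji.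
by have [k [l [fkl E2]]] := fR_ex a; have := le _ _ fkl; lia.
Qed.

Lemma fL_unique b m : (forall i j, f`_j`_i != 0 -> (b * Z.of_nat j - Z.of_nat i <= m)%ZZ) ->
  (exists i j, f`_j`_i != 0 /\ (b * Z.of_nat j - Z.of_nat i = m)%ZZ) -> fL f b = m.
Proof.
move=> le [i [j [fji E1]]]; have := fL_ge b fji.
by have [k [l [fkl E2]]] := fL_ex b; have := le _ _ fkl; lia.
Qed.
End Normalised.

Arguments fR_ge [f] f0 a [i j].
Arguments fL_ge [f] f0 b [i j].
Arguments fR_ex [f].
Arguments fL_ex [f].

(** Not divisible by x, the inner variable; a nonzero coefficient of index 0 expresses the same for
    y. *)
Definition xnormal f := exists j, f`_j`_0 != 0.

Lemma fL0 f : f`_0 != 0 -> xnormal f -> fL f 0 = 0%ZZ.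
Proof.
move=> f0 [j fj0]; apply: fL_unique => // [i k _|]; first lia.
by exists 0%N, j; split=> //; lia.
Qed.

Lemma swap_coef0 f : ((swapXY f)`_0 != 0) <-> xnormal f.
Proof.
split=> [|[j fj]].
  rewrite -lead_coef_eq0 lead_coefE coef_swapXY => fj; by eexists; exact: fj.
by apply: contraNneq fj => E0; rewrite -coef_swapXY E0 coef0.
Qed.

Lemma swap_xnormal f : f`_0 != 0 -> xnormal (swapXY f).
Proof.
rewrite -lead_coef_eq0 lead_coefE => f0.
by exists (size f`_0).-1; rewrite coef_swapXY.
Qed.

Lemma wz_swap f : f`_0 != 0 -> wz (swapXY f) = fR f 0.
Proof.
move=> f0; have fn0 : swapXY f != 0.
  by rewrite swapXY_eq0; apply: contraNneq f0 => ->; rewrite coef0.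
apply/esym/fR_unique => // [i j fji|].
  have : (swapXY f)`_i != 0.
    by apply: contraNneq fji => E0; rewrite -coef_swapXY E0 coef0.
  by move/coef_le; rewrite /wz; move: (size _).-1 => n; lia.
have := fn0; rewrite -lead_coef_eq0 lead_coefE -lead_coef_eq0 lead_coefE.
rewrite coef_swapXY => fji; do 2!eexists; split; first exact: fji.
by rewrite Z.mul_0_l.
Qed.

Definition yrev f : {poly {poly E}} := \poly_(i < size f) f`_((size f).-1 - i).

Lemma size_yrev f : f`_0 != 0 -> size (yrev f) = size f.
Proof.
by move=> f0; apply: size_poly_eq; rewrite subnn.
Qed.

Lemma coef_yrev f j : (j <= (size f).-1)%N -> (yrev f)`_((size f).-1 - j) = f`_j.
Proof.
move=> jw; rewrite coef_poly subKn //; case: ifP => // /negbT.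
rewrite -leqNgt => le; rewrite nth_default //.
by move: le jw; case: (size f) => [|n] //=; lia.
Qed.

Lemma coef_yrevE f i : f`_0 != 0 -> (yrev f)`_i != 0 ->
  exists2 j, (yrev f)`_i = f`_j & (Z.of_nat i = wz f - Z.of_nat j)%ZZ.
Proof.
move=> f0; rewrite coef_poly; case: ifP => [iw _|]; last by rewrite eqxx.
by exists ((size f).-1 - i)%N => //; rewrite /wz; lia.
Qed.

Lemma yrev0 f : f`_0 != 0 -> (yrev f)`_0 != 0.
Proof.
move=> f0; have fn0 : f != 0 by apply: contraNneq f0 => ->; rewrite coef0.
by rewrite coef_poly subn0 size_poly_gt0 fn0 -lead_coefE lead_coef_eq0.
Qed.

Lemma yrev_xnormal f : f`_0 != 0 -> xnormal f -> xnormal (yrev f).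
Proof.
move=> f0 [j fj]; exists ((size f).-1 - j)%N; rewrite coef_yrev //.
apply: supp_le; rewrite mem_supp; apply: contraNneq fj => ->; by rewrite coef0.
Qed.

Lemma coef2_le f i j : f`_j`_i != 0 -> (j <= (size f).-1)%N.
Proof. by move=> fji; apply: coef_le; apply: contraNneq fji => ->; rewrite coef0. Qed.

Lemma fR_yrev f a : f`_0 != 0 -> fR (yrev f) a = (a * wz f + fR f (- a))%ZZ.
Proof.
move=> f0; apply: (fR_unique (yrev0 f0)) => [i j fji|].
  have fj : (yrev f)`_j != 0 by apply: contraNneq fji => ->; rewrite coef0.
  have [k E1 E2] := coef_yrevE f0 fj; rewrite E1 in fji.
  by have := fR_ge f0 (- a) fji; lia.
have [i [j [fji ->]]] := fR_ex f0 (- a); have jw := coef2_le fji.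
by exists i, ((size f).-1 - j)%N; rewrite coef_yrev // wzB //; split=> //; lia.
Qed.

Lemma fL_yrev f b : f`_0 != 0 -> fL (yrev f) b = (b * wz f + fL f (- b))%ZZ.
Proof.
move=> f0; apply: (fL_unique (yrev0 f0)) => [i j fji|].
  have fj : (yrev f)`_j != 0 by apply: contraNneq fji => ->; rewrite coef0.
  have [k E1 E2] := coef_yrevE f0 fj; rewrite E1 in fji.
  by have := fL_ge f0 (- b) fji; lia.
have [i [j [fji ->]]] := fL_ex f0 (- b); have jw := coef2_le fji.
by exists i, ((size f).-1 - j)%N; rewrite coef_yrev // wzB //; split=> //; lia.
Qed.

Lemma fB_yrev f c : f`_0 != 0 -> fB (yrev f) c = (c * wz f + fB f (- c))%ZZ.
Proof.
move=> f0; have y0 := yrev0 f0.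
have s0 : 0%N \in supp f by rewrite mem_supp.
apply: supz_unique => [|j|]; first by rewrite mem_supp.
  rewrite mem_supp => fj; have [k E1 E2] := coef_yrevE f0 fj; rewrite E1 in fj *.
  have sk : k \in supp f by rewrite mem_supp.
  have := supz_ge (fun j => - c * Z.of_nat j + - oz1 f`_j)%ZZ sk.
  by rewrite -/(fB f (- c)); lia.
have [j sj E1] := supz_max (fun j => - c * Z.of_nat j + - oz1 f`_j)%ZZ s0.
have jw := supp_le sj; rewrite mem_supp in sj.
exists ((size f).-1 - j)%N; first by rewrite mem_supp coef_yrev.
by rewrite coef_yrev // wzB // [fB f _]E1; lia.
Qed.

(** The value of [fR] at 1 is the total degree, which is symmetric in the two variables. *)
Lemma fR1_swap f : f`_0 != 0 -> xnormal f -> fR (swapXY f) 1 = fR f 1.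
Proof.
move=> f0 fx; have s0 : (swapXY f)`_0 != 0 by apply/swap_coef0.
apply: fR_unique => // [i j|].
  by rewrite coef_swapXY => fji; have := fR_ge f0 1 fji; lia.
have [i [j [fji ->]]] := fR_ex f0 1; exists j, i; rewrite coef_swapXY.
by split=> //; lia.
Qed.

End Bivariate.
Arguments fR_ge [E f] f0 a [i j].
Arguments fL_ge [E f] f0 b [i j].
Arguments fR_wconvex [E f].
Arguments fL_wconvex [E f].
Arguments fB_wconvex [E f].
Arguments fRLB_ge0 [E f].
Arguments fRLB_ge [E f].
Arguments fR_ex [E f].
Arguments fL_ex [E f].

(** * Reversal and the order at -1 *)

Section Reverse.
Variable E : idomainType.
Implicit Types (f g : {poly {poly E}}) (u v : {poly E}).

Definition urev n u : {poly E} := \poly_(k < n.+1) u`_(n - k).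

Lemma urev_X1 n v : (size v <= n.+1)%N ->
  urev n.+1 (v * ('X + 1)) = urev n v * ('X + 1).
Proof.
move=> sv; apply/polyP => k.
rewrite !mulrDr !mulr1 coefD coefMX !coef_poly coefD coefMX.
case: k => [|k] /=.
  by rewrite !subn0 /= add0r [v`_n.+1]nth_default ?addr0.
rewrite !ltnS subSS; case: (ltngtP k n) => [lt|lt|->].
- have -> : (n - k)%N = (n - k.+1).+1 by lia.
  by rewrite /= addrC.
- by rewrite addr0.
- by rewrite subnn /= add0r addr0.
Qed.

Lemma horner_urev n u : (size u <= n.+1)%N ->
  (urev n u).[-1] = (-1) ^+ n * u.[-1].
Proof.
move=> su; rewrite horner_poly (horner_coef_wide _ su) big_distrr /=.
rewrite (reindex_inj rev_ord_inj); apply: eq_bigr => i _ /=.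
rewrite subSS subKn; last by rewrite -ltnS.
rewrite mulrCA; congr (_ * _).
have -> : (-1) ^+ n = (-1) ^+ (n - i) * (-1) ^+ i :> E.
  by rewrite -exprD subnK // -ltnS.
by rewrite -mulrA -expr2 sqrr_sign mulr1.
Qed.

Lemma urev_neq0 n u : (size u <= n.+1)%N -> (urev n u == 0) = (u == 0).
Proof.
move=> su; apply/eqP/eqP => [u0|->]; last first.
  by apply/polyP => k; rewrite coef_poly !coef0 if_same.
apply/polyP => k; rewrite coef0; case: (leqP k n) => kn.
  have := congr1 (fun p : {poly E} => p`_(n - k)) u0.
  by rewrite coef_poly coef0 ltnS leq_subr subKn.
by rewrite nth_default // (leq_trans su).
Qed.

(** The point -1 is fixed by X -> 1/X: X + 1 is its own reversal, so the powers of X + 1 come out of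
    the reversal, and the reversed cofactor still does not vanish at -1. *)
Lemma ordp_urev n u : (size u <= n.+1)%N -> u != 0 ->
  ordp (-1) (urev n u) = ordp (-1) u.
Proof.
move=> su u0; have [q q1 uE] := ordpP (-1) u0.
have q0 : q != 0 by apply: contraNneq q1 => ->; rewrite horner0.
have uE' : u = q * ('X + 1) ^+ ordp (-1) u.
  by rewrite {1}uE rmorphN opprK rmorph1.
have sz m : size (q * ('X + 1) ^+ m) = (size q + m)%N.
  by have := size_mono 0 m q0; rewrite expr0 mul1r add0n addnC mulrC.
have rev m k : (size q <= k.+1)%N ->
    urev (k + m) (q * ('X + 1) ^+ m) = urev k q * ('X + 1) ^+ m.
  move=> sq; elim: m => [|m IHm]; first by rewrite addn0 !expr0 !mulr1.
  rewrite addnS exprSr mulrA urev_X1 ?IHm ?mulrA //.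
  by rewrite sz -addSn leq_add2r.
set m := ordp (-1) u in uE' *.
have sq : (size q + m <= n.+1)%N by rewrite -sz -uE'.
have q1' : (0 < size q)%N by rewrite lt0n size_poly_eq0.
have [k nE] : exists k, n = (k + m)%N by exists (n - m)%N; lia.
have sk : (size q <= k.+1)%N by rewrite nE -addSn leq_add2r in sq.
rewrite {1}uE' nE rev //; apply: (@ordp_unique _ _ _ (urev k q)).
  by rewrite horner_urev // mulf_neq0 // signr_eq0.
by rewrite rmorphN opprK rmorph1.
Qed.

Lemma coef_swap_yrev f i : f`_0 != 0 ->
  (swapXY (yrev f))`_i = urev (size f).-1 (swapXY f)`_i.
Proof.
move=> f0; have fn0 : f != 0 by apply: contraNneq f0 => ->; rewrite coef0.
apply/polyP => j; rewrite coef_swapXY !coef_poly coef_swapXY.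
rewrite prednK ?size_poly_gt0 //; case: ifP => // _; by rewrite coef0.
Qed.

Lemma size_swap_coef f i : f != 0 ->
  (size ((swapXY f)`_i)%R <= (size f).-1.+1)%N.
Proof.
move=> fn0; rewrite prednK ?size_poly_gt0 //.
by have := max_size_coefXY (swapXY f) i; rewrite sizeYE swapXYK.
Qed.

Lemma fB_swap_yrev f c : f`_0 != 0 -> xnormal f ->
  fB (swapXY (yrev f)) c = fB (swapXY f) c.
Proof.
move=> f0 fx; have fn0 : f != 0 by apply: contraNneq f0 => ->; rewrite coef0.
have y0 := yrev0 f0; have yx := yrev_xnormal f0 fx.
have s0 : 0%N \in supp (swapXY f) by rewrite mem_supp; apply/swap_coef0.
have memE j : (j \in supp (swapXY (yrev f))) = (j \in supp (swapXY f)).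
  by rewrite !mem_supp coef_swap_yrev // urev_neq0 // size_swap_coef.
have oE j : j \in supp (swapXY f) ->
    oz1 (swapXY (yrev f))`_j = oz1 (swapXY f)`_j.
  by rewrite mem_supp => fj; rewrite /oz1 coef_swap_yrev // ordp_urev // size_swap_coef.
apply: supz_unique => [|j sj|]; first by rewrite memE.
  by rewrite memE in sj; rewrite oE //; apply: supz_ge.
by have [j sj E1] := supz_max (fun j => c * Z.of_nat j + - oz1 (swapXY f)`_j)%ZZ s0;
  exists j; rewrite ?memE // oE // E1.
Qed.
End Reverse.

(** * Twists and multiplicities *)

Section Twist.
Variable E : idomainType.
Implicit Types (f g : {poly {poly E}}) (u v : {poly E}).

(** Substitutes y x^p (x+1)^q for y, then removes the powers of x and x + 1 common to all
    coefficients; by the choice of [fL f (- p)] and [fB f (- q)] the least exponents become 0. The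
    value of [core] at 0 is arbitrary, hence the separate case. *)
Definition tw (p q : Z) f : {poly {poly E}} := \poly_(j < size f)
  if f`_j == 0 then 0 else
  'X ^+ Z.to_nat (p * Z.of_nat j + oz0 f`_j + fL f (- p)) *
  ('X + 1) ^+ Z.to_nat (q * Z.of_nat j + oz1 f`_j + fB f (- q)) * core f`_j.

Section Fixed.
Variables (p q : Z) (f : {poly {poly E}}).
Hypothesis f0 : f`_0 != 0.

Lemma tw_exp0 j : f`_j != 0 ->
  (0 <= p * Z.of_nat j + oz0 f`_j + fL f (- p))%ZZ.
Proof.
rewrite -mem_supp => sj.
have := supz_ge (fun j => - p * Z.of_nat j + - oz0 f`_j)%ZZ sj.
by rewrite -/(fL f (- p)); lia.
Qed.

Lemma tw_exp1 j : f`_j != 0 ->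
  (0 <= q * Z.of_nat j + oz1 f`_j + fB f (- q))%ZZ.
Proof.
rewrite -mem_supp => sj.
have := supz_ge (fun j => - q * Z.of_nat j + - oz1 f`_j)%ZZ sj.
by rewrite -/(fB f (- q)); lia.
Qed.

Lemma coef_tw j : (tw p q f)`_j = if f`_j == 0 then 0 else
  'X ^+ Z.to_nat (p * Z.of_nat j + oz0 f`_j + fL f (- p)) *
  ('X + 1) ^+ Z.to_nat (q * Z.of_nat j + oz1 f`_j + fB f (- q)) * core f`_j.
Proof.
rewrite coef_poly; case: ifP => // /negbT; rewrite -leqNgt => le.
by rewrite nth_default // eqxx.
Qed.

Lemma tw_coef_eq0 j : ((tw p q f)`_j == 0) = (f`_j == 0).
Proof.
rewrite coef_tw; case: ifPn => [_|fj]; first by rewrite eqxx.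
apply/negbTE; rewrite !mulf_neq0 ?expf_neq0 ?polyX_eq0 ?X1_neq0 //.
exact: core_neq0.
Qed.

Lemma tw0 : (tw p q f)`_0 != 0. Proof. by rewrite tw_coef_eq0. Qed.

Lemma size_tw : size (tw p q f) = size f.
Proof.
have fn0 : f != 0 by apply: contraNneq f0 => ->; rewrite coef0.
apply/eqP; rewrite eqn_leq size_poly /=.
have : (tw p q f)`_(size f).-1 != 0.
  by rewrite tw_coef_eq0 -lead_coefE lead_coef_eq0.
have : (0 < size f)%N by rewrite size_poly_gt0.
case: (size f) => // n _ /=; rewrite ltnNge.
by apply: contraNN => /leq_sizeP ->.
Qed.

Lemma supp_tw : supp (tw p q f) = supp f.
Proof. by rewrite /supp size_tw; apply: eq_filter => j; rewrite tw_coef_eq0. Qed.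

Lemma oz0_tw j : f`_j != 0 -> oz0 (tw p q f)`_j =
  (p * Z.of_nat j + oz0 f`_j + fL f (- p))%ZZ.
Proof.
move=> fj; have [c0 _ _] := coreP fj.
by rewrite coef_tw (negPf fj) [LHS]/oz0 ord0_mono // Z2Nat.id //; apply: tw_exp0.
Qed.

Lemma oz1_tw j : f`_j != 0 -> oz1 (tw p q f)`_j =
  (q * Z.of_nat j + oz1 f`_j + fB f (- q))%ZZ.
Proof.
move=> fj; have [_ c1 _] := coreP fj.
by rewrite coef_tw (negPf fj) [LHS]/oz1 ord1_mono // Z2Nat.id //; apply: tw_exp1.
Qed.

Lemma degz_tw j : f`_j != 0 -> degz (tw p q f)`_j =
  ((p + q) * Z.of_nat j + degz f`_j + fL f (- p) + fB f (- q))%ZZ.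
Proof.
move=> fj; have c0 := core_neq0 fj.
rewrite (degz_core fj) coef_tw (negPf fj) [LHS]/degz size_mono //.
have := tw_exp0 fj; have := tw_exp1 fj.
have -> : ((p + q) * Z.of_nat j = p * Z.of_nat j + q * Z.of_nat j)%ZZ by lia.
have : (0 < size (core (f`_j)%R))%N by rewrite size_poly_gt0.
rewrite /degz; move: (size (core _)) (oz0 _) (oz1 _) (fL f _) (fB f _).
move: (p * _)%ZZ (q * _)%ZZ => P Q [//|n] x y l b _; rewrite addnS /=; lia.
Qed.

Lemma s0f : 0%N \in supp f. Proof. by rewrite mem_supp. Qed.

Lemma supz_shift (h k : nat -> Z) m : (forall j, f`_j != 0 -> k j = (h j + m)%ZZ) ->
  supz (supp f) k = (supz (supp f) h + m)%ZZ.
Proof.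
move=> hk; apply: supz_unique s0f _ _ => [j sj|].
  by rewrite hk -?mem_supp //; have := supz_ge h sj; lia.
have [j sj ->] := supz_max h s0f; exists j => //.
by rewrite hk -?mem_supp.
Qed.

Lemma fR_tw a : fR (tw p q f) a = (fR f (a + p + q) + fL f (- p) + fB f (- q))%ZZ.
Proof.
rewrite /fR supp_tw -Z.add_assoc; apply: supz_shift => j fj.
by rewrite degz_tw //; lia.
Qed.

Lemma fL_tw b : fL (tw p q f) b = (fL f (b - p) - fL f (- p))%ZZ.
Proof.
rewrite {1}/fL supp_tw -Z.add_opp_r; apply: supz_shift => j fj.
by rewrite oz0_tw //; lia.
Qed.

Lemma tw_xnormal : xnormal (tw p q f).
Proof.
have [j sj E1] := supz_max (fun j => - p * Z.of_nat j + - oz0 f`_j)%ZZ s0f.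
rewrite mem_supp in sj; rewrite -/(fL f (- p)) in E1.
have o0 : ordp 0 (tw p q f)`_j = 0%N.
  by have := oz0_tw sj; rewrite E1 /oz0; lia.
exists j; have : (tw p q f)`_j != 0 by rewrite tw_coef_eq0.
by move/coef_ord0; rewrite o0 => -[].
Qed.

Lemma tw_x1normal : exists j, ((tw p q f)`_j).[-1] != 0.
Proof.
have [j sj E1] := supz_max (fun j => - q * Z.of_nat j + - oz1 f`_j)%ZZ s0f.
rewrite mem_supp in sj; rewrite -/(fB f (- q)) in E1.
have o1 : ordp (-1) (tw p q f)`_j = 0%N.
  by have := oz1_tw sj; rewrite E1 /oz1; lia.
exists j; have tj : (tw p q f)`_j != 0 by rewrite tw_coef_eq0.
have [r r1 ->] := ordpP (-1) tj.
by rewrite o1 expr0 mulr1.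
Qed.
End Fixed.
End Twist.

(** * Multiplicity at (0, -1) and its invariance *)

Section Multiplicity.
Variable E : idomainType.
Implicit Types (f g h : {poly {poly E}}) (u v : {poly E}).

(* The multiplicity of f at (0, -1). *)
Definition mz f : Z := (- fB (swapXY f) (-1))%ZZ.

(* The k-th power of the ideal (X, Y + 1), the outer variable being X. *)
Definition inO k h := forall i, exists v, h`_i = v * ('X + 1) ^+ (k - i).

Lemma ordp_ge a u v m : u != 0 -> u = v * ('X - a%:P) ^+ m -> (m <= ordp a u)%N.
Proof.
move=> u0 uE; have v0 : v != 0 by apply: contraNneq u0 => v0; rewrite uE v0 mul0r.
have [q qa vE] := ordpP a v0.
rewrite (@ordp_unique _ _ _ q (ordp a v + m)) ?leq_addl //.
by rewrite exprD mulrA -vE.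
Qed.

(** Membership in a power of an ideal is stable under sums and products, so it can be followed
    through a substitution, which the minimum of orders defining [mz] does not allow directly. *)
Lemma inOP k f : f`_0 != 0 -> xnormal f ->
  (Z.of_nat k <= mz f)%ZZ <-> inO k (swapXY f).
Proof.
move=> f0 fx; set s := swapXY f.
have s0 : 0%N \in supp s by rewrite mem_supp; apply/swap_coef0.
have X1E : 'X - (-1)%:P = 'X + 1 :> {poly E} by rewrite rmorphN opprK rmorph1.
rewrite /mz -/s; split=> [le i|sO].
  have [->|si] := eqVneq s`_i 0; first by exists 0; rewrite mul0r.
  have [q _ sE] := ordpP (-1) si; rewrite X1E in sE.
  have si' : i \in supp s by rewrite mem_supp.
  have := supz_ge (fun j => -1 * Z.of_nat j + - oz1 s`_j)%ZZ si'.
  rewrite -/(fB s (-1)) /oz1 => le2.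
  exists (q * ('X + 1) ^+ (ordp (-1) s`_i - (k - i))).
  rewrite -mulrA -exprD subnK //; lia.
have [i si E1] := supz_max (fun j => -1 * Z.of_nat j + - oz1 s`_j)%ZZ s0.
rewrite [fB _ _]E1 /oz1; rewrite mem_supp in si; have [v vE] := sO i.
rewrite -X1E in vE; have := ordp_ge si vE.
by move: (ordp _ _) => o /=; lia.
Qed.

Lemma mz_ge0 f : f`_0 != 0 -> xnormal f -> (0 <= mz f)%ZZ.
Proof.
move=> f0 fx; apply/(inOP 0) => // i; exists ((swapXY f)`_i).
by rewrite sub0n expr0 mulr1.
Qed.

Lemma inO_le k l h : (l <= k)%N -> inO k h -> inO l h.
Proof.
move=> lk hO i; have [v ->] := hO i; exists (v * ('X + 1) ^+ ((k - i) - (l - i))).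
by rewrite -mulrA -exprD subnK // leq_sub2r.
Qed.

Lemma inO0 k : inO k 0.
Proof. by move=> i; exists 0; rewrite coef0 mul0r. Qed.

Lemma inO_any h : inO 0 h.
Proof. by move=> i; exists h`_i; rewrite sub0n expr0 mulr1. Qed.

Lemma inOD k g h : inO k g -> inO k h -> inO k (g + h).
Proof.
move=> gO hO i; have [u uE] := gO i; have [v vE] := hO i.
by exists (u + v); rewrite coefD uE vE mulrDl.
Qed.

Lemma inO_sum k (I : Type) (r : seq I) (P : pred I) (G : I -> {poly {poly E}}) :
  (forall i, P i -> inO k (G i)) -> inO k (\sum_(i <- r | P i) G i).
Proof. by move=> GO; elim/big_rec: _ => [|i h Pi]; [exact: inO0 | apply/inOD/GO]. Qed.

Lemma inOM k l g h : inO k g -> inO l h -> inO (k + l) (g * h).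
Proof.
move=> gO hO i; rewrite coefM.
elim/big_rec: _ => [|a v _ [u ->]]; first by exists 0; rewrite mul0r.
have [x ->] := gO a; have [y ->] := hO (i - a)%N.
exists (x * y * ('X + 1) ^+ ((k - a) + (l - (i - a)) - (k + l - i)) + u).
rewrite mulrDl mulrACA -exprD -[in RHS]mulrA -exprD subnK //.
by have := ltn_ord a; lia.
Qed.

Lemma inOX k h : inO 1 h -> inO k (h ^+ k).
Proof.
move=> hO; elim: k => [|k IHk]; first exact: inO_any.
by rewrite exprS -add1n; apply: inOM.
Qed.

Lemma inO1_X : inO 1 'X.
Proof.
move=> [|i]; rewrite coefX; first by exists 0; rewrite mul0r.
by exists ((i.+1 == 1%N)%:R); rewrite subSS sub0n expr0 mulr1.
Qed.

Lemma inO1_Y1 : inO 1 ('X + 1)%:P.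
Proof.
move=> i; rewrite coefC; case: eqP => [->|_]; first by exists 1; rewrite mul1r.
by exists 0; rewrite mul0r.
Qed.

(** X + 1 is invertible at X = 0: the coefficients of h are recovered from those of the product,
    from the lowest upwards. *)
Lemma inO_unit k h m : inO k (h * ('X + 1) ^+ m) -> inO k h.
Proof.
elim: m h => [|m IHm] h; first by rewrite expr0 mulr1.
rewrite exprSr mulrA => gO; apply: IHm; move: gO; move: (h * _) => g gO.
elim=> [|i [u uE]].
  by have [v] := gO 0%N; rewrite mulrDr mulr1 coefD coefMX add0r => ->; exists v.
have [v] := gO i.+1; rewrite mulrDr mulr1 coefD coefMX /= uE => hE.
exists (v - u * ('X + 1) ^+ ((k - i) - (k - i.+1))).
rewrite mulrBl -hE -[X in _ - X]mulrA -exprD subnK; last by lia.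
by rewrite addrC addKr.
Qed.

Section Homogenise.
Variables Y1 Y2 : {poly {poly E}}.

(** This is Y2^n u(Y1 / Y2), so that each factor X + 1 of u yields a factor Y1 + Y2. *)
Definition hom n u : {poly {poly E}} :=
  \sum_(j < n.+1) (u`_j)%:P%:P * Y1 ^+ j * Y2 ^+ (n - j).

Lemma hom_X1 n v : (size v <= n.+1)%N ->
  hom n.+1 (v * ('X + 1)) = (Y1 + Y2) * hom n v.
Proof.
move=> sv.
have -> : hom n.+1 (v * ('X + 1)) =
    (\sum_(j < n.+2) ((v * 'X)`_j)%:P%:P * Y1 ^+ j * Y2 ^+ (n.+1 - j)) +
    \sum_(j < n.+2) (v`_j)%:P%:P * Y1 ^+ j * Y2 ^+ (n.+1 - j).
  rewrite -big_split; apply: eq_bigr => j _ /=.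
  by rewrite mulrDr mulr1 coefD !rmorphD !mulrDl.
rewrite mulrDl /hom; congr (_ + _).
  rewrite big_ord_recl coefMX /= !rmorph0 !mul0r add0r big_distrr /=.
  apply: eq_bigr => j _; rewrite /bump /= add1n coefMX /= subSS exprS.
  by rewrite [Y1 * _]mulrC !mulrA [Y1 * _]mulrC -!mulrA; congr (_ * _);
     rewrite mulrCA.
rewrite big_ord_recr /= [v`_n.+1]nth_default // !rmorph0 !mul0r addr0 big_distrr.
apply: eq_bigr => j _; have jn : (j <= n)%N by rewrite -ltnS ltn_ord.
by rewrite subSn // [Y2 ^+ (n - j).+1]exprS mulrCA.
Qed.

Lemma hom_ord n u v r : u != 0 -> (size u <= n.+1)%N -> u = v * ('X + 1) ^+ r ->
  exists h, hom n u = (Y1 + Y2) ^+ r * h.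
Proof.
move=> u0 su uE; have v0 : v != 0 by apply: contraNneq u0 => v0; rewrite uE v0 mul0r.
have sz m : size (v * ('X + 1) ^+ m) = (size v + m)%N.
  by have := size_mono 0 m v0; rewrite expr0 mul1r add0n addnC mulrC.
have v1 : (0 < size v)%N by rewrite size_poly_gt0.
rewrite uE sz in su *.
have nE : n = ((n - r) + r)%N by move: (size v) v1 su => x; lia.
move: su; rewrite nE; move: (n - r)%N => k {nE}; rewrite -addSn leq_add2r => sv; exists (hom k v).
elim: r {uE} => [|r IHr]; first by rewrite !expr0 mulr1 mul1r addn0.
rewrite addnS [('X + 1) ^+ _]exprSr mulrA hom_X1 ?IHr ?exprS ?mulrA //.
by rewrite sz -addSn leq_add2r.
Qed.

(** The sum is f at y = Y1 / Y2, cleared of denominators. As y + 1 becomes (Y1 + Y2) / Y2 with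
    numerator in the ideal (x, y + 1), the k-th power of the ideal is carried into itself. *)
Lemma hom_inO k n f : inO 1 (Y1 + Y2) -> inO k (swapXY f) -> (size f <= n.+1)%N ->
  inO k (\sum_(j < n.+1) map_poly polyC f`_j * Y1 ^+ j * Y2 ^+ (n - j)).
Proof.
move=> YO fO sf; have [->|fn0] := eqVneq f 0.
  by apply: inO_sum => j _; rewrite coef0 map_poly0 !mul0r; apply: inO0.
have -> : \sum_(j < n.+1) map_poly polyC f`_j * Y1 ^+ j * Y2 ^+ (n - j) =
    \sum_(i < sizeY f) 'X^i * hom n (swapXY f)`_i.
  under [RHS]eq_bigr => i _ do rewrite big_distrr /=.
  rewrite exchange_big; apply: eq_bigr => j _ /=.
  rewrite (poly_def _ _ : map_poly polyC f`_j = _) -mulrA big_distrl /=.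
  rewrite (big_ord_widen (sizeY f)
    (fun i => (f`_j`_i)%:P *: 'X^i * (Y1 ^+ j * Y2 ^+ (n - j)))) ?max_size_coefXY //.
  rewrite big_mkcond; apply: eq_bigr => i _; case: ifP => [_|/negbT].
    by rewrite -mul_polyC coef_swapXY -!mulrA mulrCA.
  rewrite -leqNgt => le; rewrite coef_swapXY nth_default //.
  by rewrite !rmorph0 !mul0r mulr0.
apply: inO_sum => i _; have [si0|si0] := eqVneq (swapXY f)`_i 0.
  rewrite si0 /hom big1 ?mulr0; first exact: inO0.
  by move=> j _; rewrite coef0 !rmorph0 !mul0r.
have [v vE] := fO i.
have ssi : (size ((swapXY f)`_i)%R <= n.+1)%N.
  by apply: leq_trans (max_size_coefXY _ _) _; rewrite sizeYE swapXYK.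
have [h ->] := hom_ord si0 ssi vE.
apply: (@inO_le (i + ((k - i) + 0))); first lia.
by apply: inOM; [exact/inOX/inO1_X | apply: inOM; [exact: inOX | exact: inO_any]].
Qed.
End Homogenise.

Lemma expX1 a : exists r, ('X + 1 : {poly {poly E}}) ^+ a = 1 + 'X * r.
Proof.
elim: a => [|a [r rE]]; first by exists 0; rewrite expr0 mulr0 addr0.
by exists (r + 1 + 'X * r); rewrite exprS rE; ring.
Qed.

(** Up to powers of x + 1, g is f with y replaced by y (x+1)^(a-b). At x = 0 this fixes the point y
    = -1, and x + 1 is invertible there, so multiplicity cannot drop. Two exponents a and b avoid
    negative powers. *)
Lemma mz_le_gen f g n a b M M' : f`_0 != 0 -> xnormal f -> g`_0 != 0 -> xnormal g ->
    (size f <= n.+1)%N -> (size g <= n.+1)%N ->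
    (forall j, (j <= n)%N -> f`_j * ('X + 1) ^+ (a * j + b * (n - j) + M) =
      g`_j * ('X + 1) ^+ M') ->
  (mz f <= mz g)%ZZ.
Proof.
move=> f0 fx g0 gx sf sg fg.
have [k mE] : exists k, mz f = Z.of_nat k.
  by exists (Z.to_nat (mz f)); have := mz_ge0 f0 fx; lia.
rewrite mE; apply/inOP => //; apply: (@inO_unit _ _ M').
have /(inOP k f0 fx) fO : (Z.of_nat k <= mz f)%ZZ by lia.
pose U : {poly {poly E}} := 'X + 1.
have YO : inO 1 (U ^+ a * 'X%:P + U ^+ b).
  have [r rE] := expX1 a; have [s sE] := expX1 b; rewrite /U rE sE.
  have -> : (1 + 'X * r) * 'X%:P + (1 + 'X * s) =
      ('X + 1)%:P + 'X * (r * 'X%:P + s) :> {poly {poly E}}.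
    rewrite mulrDl mul1r rmorphD rmorph1 mulrDr mulrA -!addrA; congr (_ + _).
    by rewrite addrCA.
  apply: inOD; first exact: inO1_Y1.
  by rewrite -[1%N]addn0; apply: inOM; [exact: inO1_X | exact: inO_any].
have := hom_inO YO fO sf; set H := \sum_(_ < _) _ => HO.
suff <- : H * U ^+ M = swapXY g * U ^+ M'.
  by rewrite -[k]addn0; apply: inOM => //; exact: inO_any.
have -> : swapXY g = \sum_(j < n.+1) map_poly polyC g`_j * 'X%:P ^+ j.
  have gE : g = \poly_(j < n.+1) g`_j.
    apply/polyP => j; rewrite coef_poly; case: ltnP => // nj.
    by rewrite nth_default // (leq_trans sg).
  rewrite {1}gE poly_def rmorph_sum; apply: eq_bigr => j _ /=.
  by rewrite -mul_polyC rmorphM rmorphXn /= swapXY_polyC swapXY_X.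
rewrite /H !big_distrl /=; apply: eq_bigr => j _.
have jn : (j <= n)%N by rewrite -ltnS.
have := congr1 (map_poly polyC) (fg j jn).
rewrite !rmorphM !rmorphXn !rmorphD !rmorph1 /= map_polyX -/U !exprD !exprM.
move: (map_poly _ _) (map_poly _ _) => fj gj E1.
rewrite exprMn -!exprM in E1 *; rewrite [RHS]mulrAC -E1; ring.
Qed.

Lemma mz_tw_le p q q' f : f`_0 != 0 -> (mz (tw p q f) <= mz (tw p q' f))%ZZ.
Proof.
move=> f0; pose d := (q' - q)%ZZ; pose n := (size f).-1.
pose a := Z.to_nat d; pose b := Z.to_nat (- d).
(* The power of x + 1 that remains between the two normalised twists; its sign is unknown, so D and
   -D, truncated at 0, go to opposite sides. *)
pose D := (fB f (- q) - fB f (- q') + Z.of_nat b * Z.of_nat n)%ZZ.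
have fn0 : f != 0 by apply: contraNneq f0 => ->; rewrite coef0.
have sn : (size f <= n.+1)%N by rewrite /n prednK // size_poly_gt0.
apply: (@mz_le_gen _ _ n a b (Z.to_nat (- D)) (Z.to_nat D)).
- exact: tw0.
- exact: tw_xnormal.
- exact: tw0.
- exact: tw_xnormal.
- by rewrite size_tw.
- by rewrite size_tw.
move=> j jn; rewrite !coef_tw; case: ifPn => [_|fj]; first by rewrite !mul0r.
rewrite mulrAC -[RHS]mulrAC -![_ * _ * ('X + 1) ^+ _]mulrA -!exprD.
do 2!congr (_ * _); congr (_ ^+ _).
have := tw_exp1 (q := q) f0 fj; have := tw_exp1 (q := q') f0 fj; move: (oz1 _) => o.
rewrite /D /a /b /d; move: (fB _ _) (fB _ _) => B1 B2; clearbody n => H1 H2.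
nia.
Qed.

Lemma mz_tw p q q' f : f`_0 != 0 -> mz (tw p q f) = mz (tw p q' f).
Proof.
move=> f0; have := @mz_tw_le p q q' f f0; have := @mz_tw_le p q' q f f0; lia.
Qed.

(** The multiplicity is at most the order at -1 of f(0, y), hence at most the degree minus the order
    at 0 of this polynomial. Its two extreme monomials bound [fL f 1] and [fL f (-1)] from below. As
    [fL f 0] is 0, the right-hand side is the kink of [fL f] at 0. *)
Lemma mz_kink f : f`_0 != 0 -> xnormal f -> (mz f <= fL f 1 + fL f (-1))%ZZ.
Proof.
move=> f0 fx; have s0 : (swapXY f)`_0 != 0 by apply/swap_coef0.
have m0 : 0%N \in supp (swapXY f) by rewrite mem_supp.
have := supz_ge (fun j => -1 * Z.of_nat j + - oz1 (swapXY f)`_j)%ZZ m0.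
rewrite -/(fB (swapXY f) (-1)) => le.
have := degz_core s0; have [c0 _] := coef_ord0 s0.
have l0 : ((swapXY f)`_0)`_(size ((swapXY f)`_0)%R).-1 != 0.
  by rewrite -lead_coefE lead_coef_eq0.
rewrite !coef_swapXY in c0 l0.
have := fL_ge f0 1%ZZ l0; have := fL_ge f0 (-1)%ZZ c0.
rewrite /mz; move: le; rewrite /degz /oz0 /oz1; move: (fL f 1) (fL f (-1))
  (fB _ _) (ordp 0 _) (ordp (-1) _) (size _).-1 (size (core _)).-1. lia.
Qed.
End Multiplicity.

(** * Polynomials representing a map on positive points *)

Section Points.
Variable F : numClosedFieldType.
Local Notation E := {poly F}.
Implicit Types (f g : {poly {poly E}}) (u v : {poly E}) (s t : F).

Definition ev f s t : E := f.[(t%:P)%:P].[s%:P].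

Definition at_x s f : {poly E} := map_poly (horner_eval s%:P) f.

Lemma coef_at_x s f j : (at_x s f)`_j = (f`_j).[s%:P].
Proof. by rewrite coef_map. Qed.

Lemma ev_at_x f s t : ev f s t = (at_x s f).[t%:P].
Proof.
have := horner_map (horner_eval s%:P) f (t%:P)%:P.
by rewrite /= /horner_eval hornerC => E1; rewrite /ev -E1.
Qed.

Lemma evE f s t : ev f s t = \sum_(j < size f) (f`_j).[s%:P] * (t ^+ j)%:P.
Proof.
rewrite ev_at_x (horner_coef_wide _ (size_poly _ _)); apply: eq_bigr => j _.
by rewrite coef_at_x rmorphXn.
Qed.

Lemma ev_swap f s t : ev (swapXY f) s t = ev f t s.
Proof. exact: horner2_swapXY. Qed.

Lemma ev_yrev f s t : t != 0 ->
  ev (yrev f) s t = (t ^+ (size f).-1)%:P * ev f s t^-1.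
Proof.
move=> t0; rewrite ev_at_x (horner_coef_wide _ (n := size f)); last first.
  by apply: leq_trans (size_poly _ _) (size_poly _ _).
rewrite evE big_distrr (reindex_inj rev_ord_inj); apply: eq_bigr => j _ /=.
have sf : (size f).-1.+1 = size f by rewrite prednK // (leq_ltn_trans _ (ltn_ord j)).
have jw : (j <= (size f).-1)%N by rewrite -ltnS sf.
have -> : (size f - j.+1)%N = ((size f).-1 - j)%N.
  by rewrite subnS -subn1 subnAC subn1.
rewrite coef_at_x.
rewrite coef_yrev // mulrCA -rmorphXn -rmorphM /=; congr (_ * _%:P).
by rewrite exprVn -{2}(subnK jw) exprD mulfK // expf_neq0.
Qed.

Lemma horner_mono k l v s : ('X ^+ k * ('X + 1) ^+ l * v).[s%:P] =
  (s ^+ k * (s + 1) ^+ l)%:P * v.[s%:P].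
Proof.
rewrite hornerM hornerM !horner_exp hornerD hornerX hornerC.
by rewrite -[1 : E]polyC1 -polyCD -!polyC_exp -polyCM.
Qed.

Lemma polyC_swap (a b : F) (c : E) : a%:P * c * b%:P = (a * b)%:P * c.
Proof. by rewrite polyCM mulrAC. Qed.
Lemma polyC_swap2 (a b d : F) (c : E) :
  a%:P * (b%:P * c * d%:P) = (a * (b * d))%:P * c.
Proof. by rewrite polyC_swap mulrA -polyCM. Qed.

Lemma ev_tw p q f s t : s != 0 -> s + 1 != 0 -> f`_0 != 0 ->
  ev (tw p q f) s t = (fz s (fL f (- p)) * fz (s + 1) (fB f (- q)))%:P *
    ev f s (t * fz s p * fz (s + 1) q).
Proof.
move=> s0 s1 f0; rewrite !evE size_tw // big_distrr; apply: eq_bigr => j _ /=.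
rewrite coef_tw; case: eqVneq => [->|fj]; first by rewrite !horner0 !mul0r mulr0.
have [_ _ fE] := coreP fj; rewrite [f`_j in RHS]fE.
rewrite !horner_mono (fz_to_nat _ (tw_exp0 (p := p) f0 fj)).
rewrite (fz_to_nat _ (tw_exp1 (q := q) f0 fj)).
rewrite !(fzD _ _ s0) !(fzD _ _ s1) !fzM // /oz0 /oz1 !fz_nat !exprMn.
rewrite polyC_swap polyC_swap2; congr (_%:P * _).
move: (fz s p ^+ j) (fz (s + 1) q ^+ j) (s ^+ _) ((s + 1) ^+ _) (t ^+ j).
by move: (fz s _) (fz (s + 1) _) => *; ring.
Qed.

Lemma horner_map_coefp k u t : (map_poly (coefp k) u).[t] = (u.[t%:P])`_k.
Proof.
rewrite (horner_coef_wide _ (size_poly _ _)) horner_coef coef_sum.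
by apply: eq_bigr => j _; rewrite coef_map /= -rmorphXn coefMC.
Qed.

Lemma coefp_neq0 u : u != 0 -> exists k, map_poly (coefp k) u != 0.
Proof.
rewrite -lead_coef_eq0 lead_coefE -lead_coef_eq0 lead_coefE => uk.
exists (size u`_(size u).-1).-1; apply: contraNneq uk => E0.
by have := congr1 (fun p : E => p`_(size u).-1) E0; rewrite coef_map coef0 /= => ->.
Qed.

Lemma fin_roots u : u != 0 -> exists r : seq F, forall t, u.[t%:P] = 0 -> t \in r.
Proof.
move=> /coefp_neq0[k uk]; have [r rE] := closed_field_poly_normal (map_poly (coefp k) u).
exists r => t ut; have := horner_map_coefp k u t; rewrite ut coef0 rE => /eqP.
rewrite hornerZ mulf_eq0 lead_coef_eq0 (negPf uk) /= horner_prod.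
rewrite prodf_seq_eq0 => /hasP[x xr]; rewrite hornerXsubC subr_eq0.
by move=> /andP[_ /eqP->].
Qed.

Lemma pos_avoid (r : seq F) : exists2 s, 0 < s & s \notin r.
Proof.
pose l := [seq n.+1%:R : F | n <- iota 0 (size r).+1].
have /allPn[s /mapP[n _ ->] sr] : ~~ all (mem r) l.
  apply/negP => /allP lr; have ul : uniq l.
    by rewrite map_inj_uniq ?iota_uniq // => m n /eqP; rewrite eqr_nat => /eqP[].
  have := uniq_leq_size ul lr; by rewrite size_map size_iota ltnn.
by exists n.+1%:R; rewrite ?ltr0Sn.
Qed.

Lemma poly_pos_eq u v : (forall t, 0 < t -> u.[t%:P] = v.[t%:P]) -> u = v.
Proof.
move=> uv; apply/eqP; rewrite -subr_eq0; apply/negPn/negP => /fin_roots[r rP].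
have [t t0 /negP[]] := pos_avoid r; apply: rP.
by rewrite hornerD hornerN uv // subrr.
Qed.

(** Since u and v have no zeros in F, every root of a is a root of b and conversely. Cancelling the
    common roots one by one leaves nonzero constants, the field being closed. *)
Lemma size_eq_ratio (a b : {poly F}) u v : a != 0 -> b != 0 ->
    (forall t, u.[t%:P] != 0) -> (forall t, v.[t%:P] != 0) ->
    map_poly polyC b * u = map_poly polyC a * v -> size u = size v.
Proof.
move=> a0 b0 u0 v0; have un0 : u != 0.
  by apply: contraNneq (u0 0) => ->; rewrite horner0.
have vn0 : v != 0 by apply: contraNneq (v0 0) => ->; rewrite horner0.
have hC (p : {poly F}) t : (map_poly polyC p).[t%:P] = (p.[t])%:P.
  by rewrite horner_map.
have C0 (p : {poly F}) : p != 0 -> map_poly polyC p != 0.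
  by rewrite map_polyC_eq0.
have root_ab (p q : {poly F}) w z x : (forall t, w.[t%:P] != 0) ->
    map_poly polyC q * w = map_poly polyC p * z -> root p x -> root q x.
  move=> w0 E1 /rootP px; have := congr1 (fun r : {poly E} => r.[x%:P]) E1.
  rewrite !hornerM !hC px mul0r => /eqP; rewrite mulf_eq0 (negPf (w0 x)) orbF.
  by rewrite polyC_eq0 => /rootP/rootP.
have [n] := ubnP (size a); elim: n => // n IHn in a b a0 b0 *; rewrite ltnS => an.
move=> E1; have [[x ax]|na] := pselect (exists x, root a x).
  have bx := root_ab _ _ _ _ _ u0 E1 ax.
  have /factor_theorem[a' aE] := ax; have /factor_theorem[b' bE] := bx.
  have a'0 : a' != 0 by apply: contraNneq a0 => E0; rewrite aE E0 mul0r.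
  have b'0 : b' != 0 by apply: contraNneq b0 => E0; rewrite bE E0 mul0r.
  apply: (IHn a' b') => //.
    by rewrite aE size_mul ?polyXsubC_eq0 // size_XsubC addn2 in an.
  have X0 : map_poly polyC ('X - x%:P) != 0 by rewrite C0 ?polyXsubC_eq0.
  by apply: (mulIf X0); move: E1; rewrite aE bE !rmorphM /= mulrAC => ->; rewrite mulrAC.
have size1 (p : {poly F}) : p != 0 -> ~ (exists x, root p x) -> size p = 1%N.
  by move=> p0 np; apply/eqP/negPn/negP => /closed_rootP[x px]; apply: np; exists x.
have nb : ~ exists x, root b x.
  by move=> [x bx]; apply: na; exists x; apply: root_ab v0 (esym E1) bx.
have := congr1 (fun p : {poly E} => size p) E1.
rewrite !size_mul ?C0 // !size_map_polyC // (size1 a) // (size1 b) //.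
Qed.

(** A general line, with the indeterminate l as only parameter: the point z is determined by this
    value, even up to a scalar, because 1, l, l^2 are independent over F. *)
Definition L3 (z : F * F) : E := 1 + 'X * (z.1)%:P + 'X^2 * (z.2)%:P.

Definition pos (z : F * F) := 0 < z.1 /\ 0 < z.2.

(** The scalar c may depend on the point; it absorbs the denominators and the common factors removed
    from f. *)
Definition rep (phi : F * F -> F * F) f := forall s t, 0 < s -> 0 < t ->
  exists2 c : F, c != 0 & ev f s t = c%:P * L3 (phi (s, t)).

(** Finitely many zeros off the axes means that the coefficients of the powers of l have no common
    factor besides x and y, which the two other conditions exclude. *)
Definition good f := [/\ f`_0 != 0, xnormal f &
  exists r : seq (F * F), forall s t, s != 0 -> t != 0 -> ev f s t = 0 -> (s, t) \in r].

Lemma good_at_x f : good f -> exists r : seq F, forall s, s != 0 -> s \notin r ->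
  size (at_x s f) = size f /\ forall t, (at_x s f).[t%:P] != 0.
Proof.
move=> [f0 fx [Z ZP]]; have fn0 : f != 0 by apply: contraNneq f0 => ->; rewrite coef0.
have [r0 r0P] := fin_roots f0.
have lf : lead_coef f != 0 by rewrite lead_coef_eq0.
have [r1 r1P] := fin_roots lf.
exists (r0 ++ r1 ++ [seq z.1 | z <- Z]) => s s0.
rewrite !mem_cat !negb_or => /and3P[sr0 sr1 sZ]; split.
  by apply: size_map_poly_id0; apply: contraNneq sr1 => /r1P.
move=> t; have [->|t0] := eqVneq t 0.
  rewrite polyC0 horner_coef0 coef_at_x; apply: contraNneq sr0 => /r0P //.
rewrite -ev_at_x; apply: contraNneq sZ => /(ZP _ _ s0 t0) stZ.
by apply/mapP; exists (s, t).
Qed.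

(** On a general vertical line the two restrictions keep their degrees, vanish at no scalar, and are
    proportional at all positive t. Their ratio is that of the coefficients of a fixed power of l,
    hence a quotient of polynomials in t, to which [size_eq_ratio] applies. *)
Lemma rep_unique phi f g : good f -> good g -> rep phi f -> rep phi g ->
  size f = size g.
Proof.
move=> fG gG fR gR; have [r rP] := good_at_x fG; have [q qP] := good_at_x gG.
have [s s0] := pos_avoid (r ++ q); rewrite mem_cat negb_or => /andP[sr sq].
have sn0 : s != 0 by rewrite gt_eqF.
have [<- u0] := rP s sn0 sr; have [<- v0] := qP s sn0 sq.
set u := at_x s f in u0 *; set v := at_x s g in v0 *.
have uv t : 0 < t -> exists2 c : F, c != 0 & u.[t%:P] = c%:P * v.[t%:P].
  move=> t0; have [c c0 fE] := fR s t s0 t0; have [d d0 gE] := gR s t s0 t0.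
  exists (c / d); first by rewrite mulf_neq0 ?invr_eq0.
  by rewrite /u /v -!ev_at_x fE gE mulrA -rmorphM /= divfK.
have vn0 : v != 0 by apply: contraNneq (v0 0) => ->; rewrite horner0.
have [k bk] := coefp_neq0 vn0.
set b := map_poly (coefp k) v in bk; pose a := map_poly (coefp k) u.
have ab t : 0 < t -> exists2 c : F, c != 0 & a.[t] = c * b.[t].
  by move=> /uv[c c0 E1]; exists c; rewrite // /a /b !horner_map_coefp E1 coefCM.
have ak : a != 0.
  have [t t0 tr] := pos_avoid (sval (closed_field_poly_normal b)).
  move: tr; case: closed_field_poly_normal => /= l bE tl.
  have bt : b.[t] != 0.
    rewrite bE hornerZ mulf_neq0 ?lead_coef_eq0 // horner_prod prodf_seq_neq0.
    apply/allP => x xl; rewrite hornerXsubC subr_eq0 /=.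
    by apply: contraNneq tl => ->.
  have [c c0 E1] := ab t t0.
  by apply: contraNneq (mulf_neq0 c0 bt) => E0; rewrite -E1 E0 horner0.
apply: (size_eq_ratio ak bk u0 v0); apply: poly_pos_eq => t t0.
rewrite !hornerM !horner_map /= /a /b !horner_map_coefp.
by have [c c0 ->] := uv t t0; rewrite coefCM rmorphM /= mulrCA mulrA.
Qed.
End Points.

(** * Pull-back by I, its inverse, and the twists *)

Definition aI (K : fieldType) (z : K * K) : K * K := (z.2^-1, z.1).
Arguments aI {K} z.

Section Moves.
Variable F : numClosedFieldType.
Local Notation E := {poly F}.
Implicit Types (f g : {poly {poly E}}) (s t : F) (z : F * F) (phi psi : F * F -> F * F).

Definition fI f := yrev (swapXY f).
Definition fJ f := swapXY (yrev f).

Definition aJ z : F * F := (z.2, z.1^-1).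
Definition aT p q z : F * F := (z.1, z.2 * fz z.1 p * fz (z.1 + 1) q).

Lemma fz_gt0 s n : 0 < s -> 0 < fz s n.
Proof. by move=> s0; case: n => [|k|k] /=; rewrite ?ltr01 ?invr_gt0 ?exprn_gt0. Qed.

Lemma pos_aI z : pos z -> pos (aI z).
Proof. by case=> z1 z2; split; rewrite /= ?invr_gt0. Qed.
Lemma pos_aJ z : pos z -> pos (aJ z).
Proof. by case=> z1 z2; split; rewrite /= ?invr_gt0. Qed.
Lemma pos_aT p q z : pos z -> pos (aT p q z).
Proof. by case=> z1 z2; split; rewrite //= !mulr_gt0 ?fz_gt0 ?addr_gt0. Qed.

Lemma rep_sub phi psi f f' : (forall z, pos z -> pos (psi z)) ->
    (forall s t, 0 < s -> 0 < t -> exists2 c : F, c != 0 &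
      ev f' s t = c%:P * ev f (psi (s, t)).1 (psi (s, t)).2) ->
  rep phi f -> rep (phi \o psi) f'.
Proof.
move=> psiP ff' fR s t s0 t0; have [c c0 ->] := ff' s t s0 t0.
have [] := psiP (s, t) (conj s0 t0); rewrite /=; case: (psi _) => s' t' /= s'0 t'0.
have [d d0 ->] := fR s' t' s'0 t'0; exists (c * d); first exact: mulf_neq0.
by rewrite mulrA -polyCM.
Qed.

Lemma ev_fI f s t : t != 0 -> ev (fI f) s t = (t ^+ (size (swapXY f)).-1)%:P * ev f t^-1 s.
Proof. by move=> t0; rewrite ev_yrev // ev_swap. Qed.

Lemma ev_fJ f s t : s != 0 -> ev (fJ f) s t = (s ^+ (size f).-1)%:P * ev f t s^-1.
Proof. by move=> s0; rewrite ev_swap ev_yrev. Qed.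

Lemma rep_fI phi f : rep phi f -> rep (phi \o aI) (fI f).
Proof.
apply: rep_sub => [|s t s0 t0]; first exact: pos_aI.
exists (t ^+ (size (swapXY f)).-1); first by rewrite expf_neq0 // gt_eqF.
by rewrite ev_fI // gt_eqF.
Qed.

Lemma rep_fJ phi f : rep phi f -> rep (phi \o aJ) (fJ f).
Proof.
apply: rep_sub => [|s t s0 t0]; first exact: pos_aJ.
exists (s ^+ (size f).-1); first by rewrite expf_neq0 // gt_eqF.
by rewrite ev_fJ // gt_eqF.
Qed.

Lemma rep_tw p q phi f : f`_0 != 0 -> rep phi f -> rep (phi \o aT p q) (tw p q f).
Proof.
move=> f0; apply: rep_sub => [|s t s0 t0]; first exact: pos_aT.
have s1 : 0 < s + 1 by rewrite addr_gt0.
exists (fz s (fL f (- p)) * fz (s + 1) (fB f (- q))).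
  by rewrite mulf_neq0 // fz_neq0 // gt_eqF.
by rewrite ev_tw // gt_eqF.
Qed.

Lemma good_fI f : good f -> good (fI f).
Proof.
move=> [f0 fx [r rP]]; have s0 : (swapXY f)`_0 != 0 by apply/swap_coef0.
split; first exact: yrev0.
  by apply: yrev_xnormal => //; apply: swap_xnormal.
exists [seq (z.2, z.1^-1) | z <- r] => s t sn0 tn0.
rewrite ev_fI // => /eqP; rewrite mulf_eq0 polyC_eq0 expf_eq0 (negPf tn0) andbF /=.
move=> /eqP/(rP _ _ (invr_neq0 tn0) sn0) h; apply/mapP.
by exists (t^-1, s); rewrite //= invrK.
Qed.

Lemma good_fJ f : good f -> good (fJ f).
Proof.
move=> [f0 fx [r rP]]; split.
- by apply/swap_coef0; apply: yrev_xnormal.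
- by apply: swap_xnormal; apply: yrev0.
exists [seq (z.2^-1, z.1) | z <- r] => s t sn0 tn0.
rewrite ev_fJ // => /eqP; rewrite mulf_eq0 polyC_eq0 expf_eq0 (negPf sn0) andbF /=.
move=> /eqP/(rP _ _ tn0 (invr_neq0 sn0)) h; apply/mapP.
by exists (t, s^-1); rewrite //= invrK.
Qed.

(** Off the axes and the line x = -1 the twist is a bijection of points. On that line the
    normalisation leaves a nonzero polynomial in y, which adds finitely many zeros. *)
Lemma good_tw p q f : good f -> good (tw p q f).
Proof.
move=> [f0 fx [r rP]]; split; [exact: tw0 | exact: tw_xnormal |].
have [j tj] := tw_x1normal p q f0.
have h0 : at_x (-1) (tw p q f) != 0.
  apply: contraNneq tj => E0; have := coef_at_x (-1) (tw p q f) j.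
  by rewrite E0 coef0 rmorphN rmorph1 => <-.
have [r1 r1P] := fin_roots h0.
exists ([seq (z.1, z.2 / (fz z.1 p * fz (z.1 + 1) q)) | z <- r] ++
        [seq (-1, t) | t <- r1]) => s t sn0 tn0.
rewrite mem_cat; have [->|s1] := eqVneq s (-1).
  rewrite ev_at_x => /r1P h; apply/orP; right; apply/mapP; by exists t.
have s1' : s + 1 != 0 by rewrite addr_eq0.
have nz : fz s (fL f (- p)) * fz (s + 1) (fB f (- q)) != 0.
  by rewrite mulf_neq0 ?fz_neq0.
rewrite ev_tw // => /eqP; rewrite mulf_eq0 polyC_eq0 (negPf nz) => /eqP.
have k0 : fz s p * fz (s + 1) q != 0 by rewrite mulf_neq0 ?fz_neq0.
move=> /rP h; apply/orP; left; apply/mapP.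
exists (s, t * fz s p * fz (s + 1) q); first by apply: h => //; rewrite -mulrA mulf_neq0.
by rewrite /= -[t * _ * _]mulrA mulfK.
Qed.

Lemma good0 f : good f -> f`_0 != 0. Proof. by case. Qed.
Lemma goodx f : good f -> xnormal f. Proof. by case. Qed.

Lemma wz_fI f : good f -> wz (fI f) = fR f 0.
Proof.
move=> [f0 fx _]; have s0 : (swapXY f)`_0 != 0 by apply/swap_coef0.
by rewrite /wz size_yrev // -/(wz _) wz_swap.
Qed.

Lemma wz_T p q f : good f ->
  wz (fI (tw p q f)) = (fR f (p + q) + fL f (- p) + fB f (- q))%ZZ.
Proof.
by move=> fG; rewrite (wz_fI (good_tw p q fG)) fR_tw // (good0 fG).
Qed.

Lemma wz_tw p q f : good f -> wz (tw p q f) = wz f.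
Proof. by move=> /good0 f0; rewrite /wz size_tw. Qed.

(** I M^-1 I maps vertical lines to lines through (0, -1). These meet the curve of the twisted
    polynomial away from (0, -1) in its total degree minus its multiplicity at that point. The
    factor (x+1)^q does not change this multiplicity, so q can be set to 0 in it. *)
Lemma wz_Bp p q f : good f ->
  wz (fI (tw 0 (-1) (fI (tw p q f)))) =
  (fR f (1 + p + q) + fL f (- p) + fB f (- q) - mz (tw p 0 f))%ZZ.
Proof.
move=> fG; have gG := good_tw p q fG; set g := tw p q f in gG *.
have s0 : (swapXY g)`_0 != 0 by apply/swap_coef0; exact: goodx gG.
have n1 : (- -1 = 1)%ZZ by [].
have hG := good_fI gG; rewrite (wz_T 0 (-1) hG) Z.add_0_l n1 Z.opp_0.
rewrite (fL0 (good0 hG) (goodx hG)) /fI fR_yrev // fB_yrev // n1 -[Z.opp 1]/(-1)%ZZ.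
rewrite (fR1_swap (good0 gG) (goodx gG)) {1}/g fR_tw ?(good0 fG) //.
rewrite (mz_tw p 0 q (good0 fG)) -/g /mz.
by move: (wz _) (fB (swapXY g) _) (fR _ _) (fL _ _) (fB _ _) => *; lia.
Qed.

Lemma wz_Bm p q f : good f ->
  wz (fI (tw 0 1 (fJ (tw p q f)))) =
  (wz f + fR f (-1 + p + q) + fL f (- p) + fB f (- q) - mz (tw p 0 f))%ZZ.
Proof.
move=> fG; have gG := good_tw p q fG; set g := tw p q f in gG *.
have hG := good_fJ gG; rewrite (wz_T 0 1 hG) Z.add_0_l Z.opp_0.
rewrite (fL0 (good0 hG) (goodx hG)) /fJ (fB_swap_yrev _ (good0 gG) (goodx gG)).
have y0 := yrev0 (good0 gG); have yx := yrev_xnormal (good0 gG) (goodx gG).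
rewrite (fR1_swap y0 yx) fR_yrev ?(good0 gG) // (wz_tw p q fG) -![Z.opp 1]/(-1)%ZZ.
rewrite {1}/g fR_tw ?(good0 fG) // (mz_tw p 0 q (good0 fG)) -/g /mz.
by move: (wz _) (fB (swapXY g) _) (fR _ _) (fL _ _) (fB _ _) => *; lia.
Qed.

Definition fII f := fI (fI f).

Lemma good_fII f : good f -> good (fII f).
Proof. by move=> fG; apply/good_fI/good_fI. Qed.

(** * The link data of a polynomial, seen from x = 0 and from infinity *)

Section Dual.
Variable f : {poly {poly E}}.
Hypothesis fG : good f.
Let h := swapXY f.
(** This is x^n f(1/x, y) with n the degree of f in x; reversing it in y as well gives [fII f], the
    pull-back by Q. *)
Let g := swapXY (yrev h).
Let h0 : h`_0 != 0. Proof. by apply/swap_coef0; exact: goodx fG. Qed.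
Let hx : xnormal h. Proof. exact: swap_xnormal (good0 fG). Qed.
Let g0 : g`_0 != 0. Proof. by apply/swap_coef0; apply: yrev_xnormal. Qed.

Lemma coef_g i j : g`_j`_i != 0 ->
  exists2 k, f`_j`_k != 0 & (Z.of_nat i = wz h - Z.of_nat k)%ZZ.
Proof.
rewrite /g coef_swapXY => gij.
have yi : (yrev h)`_i != 0 by apply: contraNneq gij => ->; rewrite coef0.
have [k E1 E2] := coef_yrevE h0 yi; exists k => //.
by move: gij; rewrite E1 /h coef_swapXY.
Qed.

Lemma coef_g_ex j k : f`_j`_k != 0 ->
  exists2 i, g`_j`_i != 0 & (Z.of_nat i = wz h - Z.of_nat k)%ZZ.
Proof.
rewrite -coef_swapXY -/h => hkj.
have hk : (k <= (size h).-1)%N by apply: coef2_le hkj.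
exists ((size h).-1 - k)%N; last exact: wzB.
by rewrite /g coef_swapXY coef_yrev.
Qed.

Lemma fR_g a : fR g a = (wz h + fL f a)%ZZ.
Proof.
apply: fR_unique g0 _ _ _ _ => [i j /coef_g[k fjk]|].
  by have := fL_ge (good0 fG) a fjk; lia.
have [k [j [fjk ->]]] := fL_ex (good0 fG) a.
by have [i gji iE] := coef_g_ex fjk; exists i, j; split=> //; lia.
Qed.

Lemma fL_g b : fL g b = (fR f b - wz h)%ZZ.
Proof.
apply: fL_unique g0 _ _ _ _ => [i j /coef_g[k fjk]|].
  by have := fR_ge (good0 fG) b fjk; lia.
have [k [j [fjk ->]]] := fR_ex (good0 fG) b.
by have [i gji iE] := coef_g_ex fjk; exists i, j; split=> //; lia.
Qed.

Lemma fB_g c : fB g c = fB f c.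
Proof. by rewrite /g fB_swap_yrev // /h swapXYK. Qed.

Lemma wz_g : wz g = wz f.
Proof.
have y0 := yrev0 h0; rewrite /g wz_swap // fR_yrev // Z.mul_0_l Z.add_0_l Z.opp_0.
by rewrite -wz_swap // /h swapXYK.
Qed.

Lemma fR_II a : fR (fII f) a = (a * wz f + wz h + fL f (- a))%ZZ.
Proof. by rewrite /fII /fI -/h -/g fR_yrev // wz_g fR_g; lia. Qed.
Lemma fL_II b : fL (fII f) b = (b * wz f - wz h + fR f (- b))%ZZ.
Proof. by rewrite /fII /fI -/h -/g fL_yrev // wz_g fL_g; lia. Qed.
Lemma fB_II c : fB (fII f) c = (c * wz f + fB f (- c))%ZZ.
Proof. by rewrite /fII /fI -/h -/g fB_yrev // wz_g fB_g. Qed.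
Lemma wz_II : wz (fII f) = wz f.
Proof. by rewrite /fII /fI -/h -/g /wz size_yrev // -/(wz g) wz_g. Qed.

(** [lm] looks at (0, -1) after the twist by x^-b; [ln] does the same on the fibre at x = infinity,
    which Q brings to x = 0. *)
Definition link_of := LData (fR f) (fL f) (fB f) (fun b => mz (tw (- b) 0 f))
  (fun a => mz (tw a 0 (fII f))) (wz f).

Lemma link_ok : lok link_of.
Proof.
have f0 := good0 fG; have IIG := good_fII fG; have II0 := good0 IIG.
split; [by split; [exact: fR_wconvex|exact: fL_wconvex|exact: fB_wconvex]|split|].
- move=> b /=; have := mz_kink (tw0 (- b) 0 f0) (tw_xnormal (- b) 0 f0).
  rewrite !fL_tw // Z.opp_involutive.
  have -> : (1 - - b = b + 1)%ZZ by lia.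
  have -> : (-1 - - b = b - 1)%ZZ by lia.
  have := mz_ge0 (tw0 (- b) 0 f0) (tw_xnormal (- b) 0 f0); lia.
- move=> a /=; have := mz_kink (tw0 a 0 II0) (tw_xnormal a 0 II0).
  rewrite !fL_tw // !fL_II.
  have -> : (- (1 - a) = a - 1)%ZZ by lia.
  have -> : (- (-1 - a) = a + 1)%ZZ by lia.
  rewrite Z.opp_involutive; lia.
split=> b c /=; last exact: fRLB_ge0.
have := fRLB_ge f0 (2 - b - c) b c.
by have -> : (2 - b - c + b + c = 2)%ZZ by lia.
Qed.

(** The vertices of type A of g are those of type B of g Q; the signs are exchanged because Q also
    inverts y. *)
Lemma wz_Ap b c : wz (fI (tw 0 1 (fJ (tw (1 - b - c) c (fII f))))) =
  lval link_of (VAp b c).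
Proof.
rewrite (wz_Bm _ _ (good_fII fG)) wz_II fR_II fL_II fB_II /=.
have -> : (- (-1 + (1 - b - c) + c) = b)%ZZ by lia.
rewrite !Z.opp_involutive; lia.
Qed.

Lemma wz_Am b c : wz (fI (tw 0 (-1) (fI (tw (-1 - b - c) c (fII f))))) =
  lval link_of (VAm b c).
Proof.
rewrite (wz_Bp _ _ (good_fII fG)) fR_II fL_II fB_II /=.
have -> : (- (1 + (-1 - b - c) + c) = b)%ZZ by lia.
rewrite !Z.opp_involutive; lia.
Qed.

Lemma wz_VT b c : wz (fI (tw (- b) (- c) f)) = lval link_of (VT b c).
Proof.
rewrite wz_T // !Z.opp_involutive /=.
by have -> : (- b + - c = - b - c)%ZZ by lia.
Qed.

Lemma wz_VBp b c : wz (fI (tw 0 (-1) (fI (tw (- b) (- c) f)))) =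
  lval link_of (VBp b c).
Proof.
rewrite wz_Bp // !Z.opp_involutive /=.
by have -> : (1 + - b + - c = 1 - b - c)%ZZ by lia.
Qed.

Lemma wz_VBm b c : wz (fI (tw 0 1 (fJ (tw (- b) (- c) f)))) =
  lval link_of (VBm b c).
Proof.
rewrite wz_Bm // !Z.opp_involutive /=.
by have -> : (-1 + - b + - c = -1 - b - c)%ZZ by lia.
Qed.
End Dual.
End Moves.
Local Close Scope ring_scope.

Local Open Scope group_scope.

(** * Cosets of J in the presented group *)

Section ZPowers.
Variable G : groupType.
Implicit Types x y : G.

Definition gz x (n : Z) : G := match n with
  | Z0 => 1 | Zpos k => x ^+ Pos.to_nat k | Zneg k => x ^- Pos.to_nat k end.

Lemma gz_nat x n : gz x (Z.of_nat n) = x ^+ n.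
Proof. by case: n => // n; rewrite /= SuccNat2Pos.id_succ. Qed.

Lemma gzN x n : gz x (- n) = (gz x n)^-1.
Proof. by case: n => [|k|k] /=; rewrite ?invg1 ?invgK. Qed.

Lemma gzS x n : gz x (n + 1) = gz x n * x.
Proof.
have [n0|n0] := Z.le_gt_cases 0 n.
  have -> : n = Z.of_nat (Z.to_nat n) by lia.
  have -> : (Z.of_nat (Z.to_nat n) + 1 = Z.of_nat (Z.to_nat n).+1)%ZZ by lia.
  by rewrite !gz_nat expgSr.
have -> : n = (- Z.of_nat (Z.to_nat (- n - 1)).+1)%ZZ by lia.
have -> : (- Z.of_nat (Z.to_nat (- n - 1)).+1 + 1 =
  - Z.of_nat (Z.to_nat (- n - 1)))%ZZ by lia.
by rewrite !gzN !gz_nat expgS invgM mulgVK.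
Qed.

Lemma gz_ind (P : Z -> Prop) : P 0%ZZ -> (forall n, P n <-> P (n + 1)%ZZ) ->
  forall n, P n.
Proof.
move=> P0 PS n; have [n0|n0] := Z.le_gt_cases 0 n.
  have -> : n = Z.of_nat (Z.to_nat n) by lia.
  elim: (Z.to_nat n) => // k /PS; by have -> : (Z.of_nat k + 1 = Z.of_nat k.+1)%ZZ by lia.
have -> : n = (- Z.of_nat (Z.to_nat (- n)))%ZZ by lia.
elim: (Z.to_nat (- n)) => // k IHk; apply/PS.
by have -> : (- Z.of_nat k.+1 + 1 = - Z.of_nat k)%ZZ by lia.
Qed.

Lemma gzD x m n : gz x (m + n) = gz x m * gz x n.
Proof.
elim/gz_ind: n => [|n]; first by rewrite Z.add_0_r mulg1.
rewrite Z.add_assoc !gzS mulgA; split=> [-> //|]; exact: mulIg.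
Qed.

Lemma gz_commute x y n : commute x y -> commute (gz x n) y.
Proof.
move=> xy; case: n => [|k|k] /=; first by rewrite /commute mul1g mulg1.
  by apply/commute_sym/commuteX/commute_sym.
by apply/commute_sym/commuteV/commuteX/commute_sym.
Qed.

Lemma gz_conj x y n z : x * y = z * x -> x * gz y n = gz z n * x.
Proof.
move=> xy; elim/gz_ind: n => [|n]; first by rewrite mulg1 mul1g.
rewrite !gzS mulgA -[gz z n * z * x]mulgA -xy mulgA.
by split=> [-> //|]; exact: mulIg.
Qed.

Lemma gzMn x y n : commute x y -> gz (x * y) n = gz x n * gz y n.
Proof.
move=> xy; elim/gz_ind: n => [|n]; first by rewrite mulg1.
rewrite !gzS; have -> : gz x n * x * (gz y n * y) = gz x n * gz y n * (x * y).
  rewrite -!mulgA; congr (_ * _); rewrite !mulgA; congr (_ * _).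
  exact/commute_sym/gz_commute/commute_sym.
by split=> [-> //|]; exact: mulIg.
Qed.

Lemma gzV x n : gz x^-1 n = gz x (- n).
Proof.
case: n => [|k|k] //=; first by rewrite expVgn.
by rewrite expVgn invgK.
Qed.
End ZPowers.

(** * The subgroup J and the planes through a coset *)

Section Relations.
Variable G : groupType.
Variables I C P Q U M : G.
Hypotheses (QE : I * I = Q) (UE : U = C^-1 * I^-1) (ME : M = P * I).
Hypotheses (I4 : I ^+ 4 = 1) (C3 : C ^+ 3 = 1) (CQ : commute C Q).
Hypotheses (P5 : P ^+ 5 = 1) (PCP : P * C * P = I).

Lemma QQ : Q * Q = 1. Proof. by rewrite -I4 -QE -!mulgA. Qed.
Lemma QK x : Q * (Q * x) = x. Proof. by rewrite mulgA QQ mul1g. Qed.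
Lemma QI : Q * I = I * Q. Proof. by rewrite -QE mulgA. Qed.
Lemma QIK x : Q * (I * x) = I * (Q * x). Proof. by rewrite !mulgA QI. Qed.
Lemma IIK x : I * (I * x) = Q * x. Proof. by rewrite mulgA QE. Qed.
Lemma IV : I^-1 = I * Q.
Proof. by apply: (mulgI I); rewrite mulgV mulgA QE QQ. Qed.
Lemma CE : C = I * (Q * U^-1).
Proof. by rewrite mulgA -IV UE invgM !invgK mulKg. Qed.
Lemma CVE : C^-1 = U * I. Proof. by rewrite UE mulgVK. Qed.
Lemma QU : Q * U = U * Q.
Proof.
rewrite UE; apply/commuteM; first by apply/commuteV/commute_sym.
by apply/commuteV/QI.
Qed.
Lemma QUK x : Q * (U * x) = U * (Q * x). Proof. by rewrite !mulgA QU. Qed.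
Lemma QUV : Q * U^-1 = U^-1 * Q. Proof. exact/commuteV/QU. Qed.
Lemma QUVK x : Q * (U^-1 * x) = U^-1 * (Q * x). Proof. by rewrite !mulgA QUV. Qed.
Lemma PE : P = M * (I * Q). Proof. by rewrite -IV ME mulgK. Qed.
Lemma PVE : P^-1 = I * M^-1. Proof. by rewrite ME invgM mulVKg. Qed.

(** With P = M I^-1 and C = I^-1 U^-1, the relation PCP = I becomes M Q U^-1 M = Q. *)
Lemma QM : Q * M = U * (M^-1 * Q).
Proof.
have E : M * (Q * (U^-1 * M)) = Q.
  have := PCP; rewrite {1}PE CE => /(congr1 (fun x => x * I)) /=.
  by rewrite -[_ * P * I]mulgA -ME QE -!mulgA QIK QK IIK.
have := congr1 (fun x => M^-1 * x) E; rewrite mulKg QUVK => /(congr1 (fun x => U * x)).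
by rewrite mulVKg.
Qed.
Lemma QMK x : Q * (M * x) = U * (M^-1 * (Q * x)).
Proof. by rewrite mulgA QM !mulgA. Qed.

Lemma QMV0 : Q * M^-1 = M * (U^-1 * Q).
Proof.
have QV : Q^-1 = Q by apply: (mulgI Q); rewrite mulgV QQ.
have := congr1 (fun x : G => x^-1) QM; rewrite !invgM invgK QV => E.
by apply: (mulIg Q); rewrite -!mulgA QQ mulg1 E -mulgA QK.
Qed.

(** Q is an involution that commutes with U, so conjugating twice by it with [QM] gives M = U M
    U^-1. *)
Lemma UM : U * M = M * U.
Proof.
have := congr1 (fun x => Q * x) QM; rewrite QK QUK [Q * (M^-1 * _)]mulgA QMV0 => E.
have {}E : M = U * (M * U^-1) by move: E; rewrite -!mulgA QQ mulg1.
by rewrite {2}E -!mulgA mulVg mulg1.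
Qed.
Lemma UVM : U^-1 * M = M * U^-1.
Proof. by apply: (mulgI U); rewrite mulVKg mulgA UM mulgK. Qed.
Lemma QMV : Q * M^-1 = U^-1 * (M * Q).
Proof. by rewrite QMV0 !mulgA UVM. Qed.
Lemma QMVK x : Q * (M^-1 * x) = U^-1 * (M * (Q * x)).
Proof. by rewrite mulgA QMV !mulgA. Qed.

Definition inJ (j : G) := exists p q : Z, exists e : bool,
  j = gz U p * (gz M q * (if e then Q else 1)).

Lemma QgU n : Q * gz U n = gz U n * Q.
Proof. exact: gz_conj QU. Qed.
Lemma QgM n : Q * gz M n = gz U n * (gz M (- n) * Q).
Proof.
rewrite (@gz_conj _ Q M n (U * M^-1)); last by rewrite QM mulgA.
by rewrite gzMn ?gzV -?mulgA //; apply/commuteV/UM.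
Qed.
Lemma gUM m n : gz U m * gz M n = gz M n * gz U m.
Proof. by apply: gz_commute; apply/commute_sym/gz_commute/commute_sym/UM. Qed.

Lemma inJ_Z p q : inJ (gz U p * gz M q).
Proof. by exists p, q, false; rewrite mulg1. Qed.
Lemma inJ_Q : inJ Q. Proof. by exists 0%ZZ, 0%ZZ, true; rewrite !mul1g. Qed.
Lemma inJ_1 : inJ 1. Proof. by exists 0%ZZ, 0%ZZ, false; rewrite !mul1g. Qed.

Lemma inJM j k : inJ j -> inJ k -> inJ (j * k).
Proof.
move=> [p [q [e ->]]] [p' [q' [e' ->]]]; case: e.
  exists (p + p' + q')%ZZ, (q - q')%ZZ, (~~ e').
  have -> : (if ~~ e' then Q else 1) = Q * (if e' then Q else 1).
    by case: e'; rewrite ?QQ ?mulg1.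
  rewrite -!mulgA [Q * (gz U p' * _)]mulgA QgU -!mulgA.
  rewrite [Q * (gz M q' * _)]mulgA QgM -!mulgA !gzD -!mulgA; congr (_ * _).
  rewrite ![gz M q * (gz U _ * _)]mulgA -[gz M q * gz U p']gUM -!mulgA; congr (_ * _).
  by rewrite ![gz M q * (gz U _ * _)]mulgA -[gz M q * gz U _]gUM -!mulgA.
exists (p + p')%ZZ, (q + q')%ZZ, e'.
rewrite mulg1 -!mulgA !gzD -!mulgA; congr (_ * _).
by rewrite !mulgA gUM.
Qed.

Lemma inJV j : inJ j -> inJ j^-1.
Proof.
move=> [p [q [e ->]]]; rewrite !invgM -!gzN -mulgA.
apply: inJM; last by rewrite -gUM; exact: inJ_Z.
case: e; last by rewrite invg1; exact: inJ_1.
have -> : Q^-1 = Q by apply: (mulgI Q); rewrite mulgV QQ.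
exact: inJ_Q.
Qed.

Lemma inJ_U : inJ U. Proof. by exists 1%ZZ, 0%ZZ, false; rewrite /= expg1 !mulg1. Qed.
Lemma inJ_M : inJ M. Proof. by exists 0%ZZ, 1%ZZ, false; rewrite /= expg1 mulg1 mul1g. Qed.

Definition tau b c := gz U (- b) * gz M (- c).

Lemma gz1 x : gz x 1 = x :> G. Proof. exact: expg1. Qed.

Lemma tauD b c b' c' : tau (b + b') (c + c') = tau b c * tau b' c'.
Proof.
rewrite /tau !Z.opp_add_distr !gzD -!mulgA; congr (_ * _).
by rewrite !mulgA gUM.
Qed.
Lemma tau_U : tau (-1) 0 = U.
Proof. exact: mulg1. Qed.
Lemma tau_UV : tau 1 0 = U^-1. Proof. exact: mulg1. Qed.
Lemma tau_M : tau 0 (-1) = M. Proof. exact: mul1g. Qed.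
Lemma tau_MV : tau 0 1 = M^-1. Proof. exact: mul1g. Qed.
Lemma tauUV b c : tau (b + 1) c = tau b c * U^-1.
Proof. by rewrite -{1}[c]Z.add_0_r tauD tau_UV. Qed.
Lemma tauMV b c : tau b (c + 1) = tau b c * M^-1.
Proof. by rewrite -{1}[b]Z.add_0_r tauD tau_MV. Qed.
Lemma tauU b c : tau (b - 1) c = tau b c * U.
Proof. by rewrite -{1}[c]Z.add_0_r -Z.add_opp_r tauD tau_U. Qed.
Lemma tauM b c : tau b (c - 1) = tau b c * M.
Proof. by rewrite -{1}[b]Z.add_0_r -Z.add_opp_r tauD tau_M. Qed.

Definition pp (e : bool) := if e then P else 1.
Definition in_plane k g := exists i e j, inJ j /\ g = k * (C ^+ i * (pp e * j)).
Definition adjacent g h := exists k, in_plane k g /\ in_plane k h.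

Definition link_elt g v := match v with
  | VT b c => g * (tau b c * I)
  | VBp b c => g * (tau b c * (I * (M^-1 * I)))
  | VBm b c => g * (tau b c * (I^-1 * (M * I)))
  | VAp b c => g * (tau b c * (U * (I * (M * I))))
  | VAm b c => g * (tau b c * (U^-1 * (I^-1 * (M^-1 * I))))
  end.
Definition link_elt_opt g v := if v is Some v then link_elt g v else g.

(** If g = k j or g = k P j, then k is g j^-1 or g j^-1 P^-1; with or without Q in j^-1, this makes
    four families. *)
Definition plane_elt g pl := match pl with
  | PlP b c => g * tau b c
  | PlM b c => g * (tau b c * (U^-1 * Q))
  | PlB b c => g * (tau b c * P^-1)
  | PlA b c => g * (tau b c * (Q * P^-1))
  end.

(** [None] is the coset g J itself, which belongs to each of these planes. *)
Definition plane_vertex pl (i : nat) (e : bool) : option lvert := match pl with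
  | PlP b c => match i, e with
    | 0%N, false => None
    | 0%N, true => Some (VT b (c - 1))
    | 1%N, false => Some (VT b c)
    | 1%N, true => Some (VBp b c)
    | _, false => Some (VT (b - 1) c)
    | _, true => Some (VAp b c)
    end
  | PlM b c => match i, e with
    | 0%N, false => None
    | 0%N, true => Some (VT b (c + 1))
    | 1%N, false => Some (VT (b + 1) c)
    | 1%N, true => Some (VAm b c)
    | _, false => Some (VT b c)
    | _, true => Some (VBm b c)
    end
  | PlB b c => match i, e with
    | 0%N, false => Some (VT b c)
    | 0%N, true => None
    | 1%N, false => Some (VBp b c)
    | 1%N, true => Some (VBm b (c - 1))
    | _, false => Some (VBm b c)
    | _, true => Some (VBp b (c + 1))
    end
  | PlA b c => match i, e with
    | 0%N, false => Some (VT b c)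
    | 0%N, true => None
    | 1%N, false => Some (VAm (b - 1) c)
    | 1%N, true => Some (VAp b (c + 1))
    | _, false => Some (VAp (b + 1) c)
    | _, true => Some (VAm b (c - 1))
    end
  end.

Lemma C2 : C ^+ 2 = U * I.
Proof. by rewrite -CVE; apply: (mulIg C); rewrite mulVg -expgSr. Qed.

Lemma P3 : P * (P * P) = P^-1 * P^-1.
Proof. by apply: (mulgI P); apply: (mulgI P); rewrite mulVKg mulgV; exact: P5. Qed.

Lemma P2I : P^-1 * (P^-1 * I) = P * (P * M).
Proof. by rewrite mulgA -P3 -!mulgA -ME. Qed.
Lemma VIP : P^-1 * C^-1 = I^-1 * P.
Proof. by rewrite -PCP !invgM mulgA mulgVK. Qed.
Lemma VCP : C * P = I * (M^-1 * I).
Proof. by apply: (mulgI P); rewrite mulgA PCP ME invgM -mulgA !mulVKg. Qed.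

Lemma mul2_eq (g t x y : G) : x = y -> g * (t * x) = g * (t * y).
Proof. by move->. Qed.

Lemma MVU : M^-1 * U = U * M^-1.
Proof. by apply: (mulgI M); rewrite mulVKg mulgA -UM mulgK. Qed.
Lemma VUI : P^-1 * (U * I) = I^-1 * P. Proof. by rewrite -CVE VIP. Qed.
Lemma CP : C * P = P^-1 * I.
Proof. by apply: (mulgI P); rewrite mulgA PCP mulVKg. Qed.
Lemma plane_vertex_B1 : M * (I^-1 * (M * I)) = P^-1 * (C * (P * (M^-1 * Q))).
Proof.
have -> : C * (P * (M^-1 * Q)) = P^-1 * (I * (M^-1 * Q)) by rewrite mulgA CP -mulgA.
have -> : P^-1 * (P^-1 * (I * (M^-1 * Q))) = P^-1 * (P^-1 * I) * (M^-1 * Q).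
  by rewrite -!mulgA.
by rewrite P2I PE IV -!mulgA mulVKg QQ mulg1.
Qed.
Lemma plane_vertex_B2 : M^-1 * (I * (M^-1 * I)) = P^-1 * (U * (I * (P * M))).
Proof.
have -> : P^-1 * (U * (I * (P * M))) = I^-1 * (P * (P * M)).
  by rewrite [U * _]mulgA [P^-1 * _]mulgA VUI -mulgA.
by rewrite -P2I PVE -!mulgA mulKg.
Qed.
(** A check of the six positions in each of the four planes: Q is pushed to the right by [nf], and
    the witness j is the factor in J left at the end. P^5 = 1 enters through [plane_vertex_B1] and
    [plane_vertex_B2], for the planes in which g J is of the form k P J. *)
Lemma plane_vertexP g pl i e : (i < 3)%N ->
  exists2 j, inJ j & link_elt_opt g (plane_vertex pl i e) = plane_elt g pl * (C ^+ i * (pp e * j)).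
Proof.
have jU := inJ_U; have jM := inJ_M; have jQ := inJ_Q; have j1 := inJ_1.
have jUQ : inJ (U * Q) by apply: inJM.
have jMQ : inJ (M * Q) by apply: inJM.
have jVQ : inJ (M^-1 * Q) by apply: inJM jQ; apply: inJV.
have nf := (QIK, QK, QUK, QUVK, QI, QU, QUV, QMK, QMVK, QM, QMV, QQ, IIK, QE).
have cn := (@mulg1 G, @mul1g G, @mulKg G, @mulVKg G, @mulgV G, @mulVg G).
case: pl => b c; (have tJ : inJ (tau b c) by exact: inJ_Z); case: i => [|[|[|//]]] _;
  case: e; rewrite /= ?(tauU, tauM, tauUV, tauMV);
  move: (tau b c) tJ => t tJ.
- exists Q => //; rewrite ?expg0 ?expg1 ?C2 ?mul1g ?IV -!mulgA; apply: mul2_eq.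
  by rewrite PE -!mulgA !(nf, cn).
- exists (t^-1); first by apply: inJV.
  by rewrite ?expg0 -!mulgA !cn.
- exists 1 => //; rewrite ?expg0 ?expg1 ?C2 ?mul1g ?IV -!mulgA; apply: mul2_eq.
  by rewrite mulg1 VCP.
- exists (U * Q) => //; rewrite ?expg0 ?expg1 ?C2 ?mul1g ?IV -!mulgA; apply: mul2_eq.
  by rewrite CE -!mulgA !(nf, cn).
- exists Q => //; rewrite ?expg0 ?expg1 ?C2 ?mul1g ?IV -!mulgA; apply: mul2_eq.
  by rewrite PE -!mulgA !(nf, cn).
- by exists 1 => //; rewrite C2 -!mulgA !cn.
- exists 1 => //; rewrite ?expg0 ?expg1 ?C2 ?mul1g ?IV -!mulgA; apply: mul2_eq.
  by rewrite PE -!mulgA !(nf, cn).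
- exists (Q * (U * t^-1)); first by apply: inJM => //; apply: inJM => //; apply: inJV.
  by rewrite expg0 -!mulgA !(cn, QK).
- exists 1 => //; rewrite ?expg0 ?expg1 ?C2 ?mul1g ?IV -!mulgA; apply: mul2_eq.
  by rewrite mulg1 VCP !(nf, cn).
- exists U => //; rewrite ?expg0 ?expg1 ?C2 ?mul1g ?IV -!mulgA; apply: mul2_eq.
  by rewrite CE -!mulgA !(nf, cn).
- exists Q => //; rewrite ?expg0 ?expg1 ?C2 ?mul1g ?IV -!mulgA; apply: mul2_eq.
  by rewrite PE -!mulgA !(nf, cn).
- exists Q => //; rewrite ?expg0 ?expg1 ?C2 ?mul1g ?IV -!mulgA; apply: mul2_eq.
  by rewrite !(nf, cn).
- exists (t^-1); first by apply: inJV.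
  by rewrite ?expg0 -!mulgA !cn.
- exists M => //; rewrite ?expg0 ?expg1 ?C2 ?mul1g ?IV -!mulgA; apply: mul2_eq.
  by rewrite PVE -!mulgA !(nf, cn).
- exists (M^-1 * Q) => //; rewrite ?expg0 ?expg1 ?C2 ?mul1g ?IV -!mulgA; apply: mul2_eq.
  by rewrite -plane_vertex_B1 IV -!mulgA.
- exists (U * Q) => //; rewrite ?expg0 ?expg1 ?C2 ?mul1g ?IV -!mulgA; apply: mul2_eq.
  by rewrite PVE CE -!mulgA !(nf, cn).
- exists M => //; rewrite ?expg0 ?expg1 ?C2 ?mul1g ?IV -!mulgA; apply: mul2_eq. 
  exact: plane_vertex_B2.
- exists Q => //; rewrite ?expg0 ?expg1 ?C2 ?mul1g ?IV -!mulgA; apply: mul2_eq.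
  by rewrite [U * _]mulgA [P^-1 * _]mulgA VUI PE IV -!mulgA !(nf, cn).
- exists (t * Q)^-1; first by apply: inJV; apply: inJM.
  by rewrite expg0 invgM -!mulgA !cn.
- exists (M * Q) => //; rewrite ?expg0 ?expg1 ?C2 ?mul1g ?IV -!mulgA; apply: mul2_eq.
  by rewrite PVE -!mulgA !(nf, cn) [M * _]mulgA -UM -mulgA !cn.
- exists (M^-1 * Q) => //; rewrite ?expg0 ?expg1 ?C2 ?mul1g ?IV -!mulgA; apply: mul2_eq.
  by rewrite -plane_vertex_B1 IV -!mulgA !(nf, cn) [M^-1 * (U * _)]mulgA MVU -!mulgA.
- exists (U * Q) => //; rewrite ?expg0 ?expg1 ?C2 ?mul1g ?IV -!mulgA; apply: mul2_eq.
  by rewrite PVE CE -!mulgA !(nf, cn).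
- exists M => //; rewrite ?expg0 ?expg1 ?C2 ?mul1g ?IV -!mulgA; apply: mul2_eq.
  by rewrite -plane_vertex_B2 !(nf, cn) [M * (U^-1 * _)]mulgA -UVM -!mulgA.
- exists Q => //; rewrite ?expg0 ?expg1 ?C2 ?mul1g ?IV -!mulgA; apply: mul2_eq.
  by rewrite mulKg [U * _]mulgA [P^-1 * _]mulgA VUI PE IV -!mulgA !(nf, cn).
Qed.

Lemma CX3 i : C ^+ (i %% 3) = C ^+ i.
Proof. by rewrite [in RHS](divn_eq i 3) expgnDr mulnC expgnA C3 expg1n mul1g. Qed.

Lemma in_plane_vertex g pl i e j h : inJ j -> h = plane_elt g pl * (C ^+ i * (pp e * j)) ->
  exists2 j', inJ j' & h = link_elt_opt g (plane_vertex pl (i %% 3) e) * j'.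
Proof.
move=> jJ ->; have [k kJ ->] := @plane_vertexP g pl (i %% 3) e (ltn_pmod _ (isT : 0 < 3)).
exists (k^-1 * j); first exact: inJM (inJV kJ) jJ.
by rewrite CX3 -!mulgA mulVKg.
Qed.

Lemma on_plane_vertex pl u : on_plane pl u -> exists i e, (i < 3)%N /\ plane_vertex pl i e = Some u.
Proof.
case: pl => b c /=; case=> [||| []] ->;
 first [by exists 0%N, false | by exists 0%N, true | by exists 1%N, false
       | by exists 1%N, true | by exists 2, false | by exists 2, true].
Qed.

Lemma in_plane_link g pl u : on_plane pl u -> in_plane (plane_elt g pl) (link_elt g u).
Proof.
move=> /on_plane_vertex[i [e [i3 E]]]; have [j jJ] := @plane_vertexP g pl i e i3.
by rewrite E /= => ->; exists i, e, j.
Qed.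

Lemma ladj_adjacent g u v : ladj u v -> adjacent (link_elt g u) (link_elt g v).
Proof. by case=> pl [/in_plane_link pu /in_plane_link pv]; exists (plane_elt g pl). Qed.

Lemma in_planeJ k g j : inJ j -> in_plane k g -> in_plane k (g * j).
Proof.
move=> jJ [i [e [j' [j'J ->]]]]; exists i, e, (j' * j); split; first exact: inJM.
by rewrite -!mulgA.
Qed.

Lemma adjacentJ g h j j' : inJ j -> inJ j' -> adjacent g h -> adjacent (g * j) (h * j').
Proof. by move=> jJ j'J [k [kg kh]]; exists k; split; apply: in_planeJ. Qed.

Lemma in_planeC k i g : in_plane (k * C ^+ i) g <-> in_plane k g.
Proof.
suff H k' i' : in_plane (k' * C ^+ i') g -> in_plane k' g.
  split; first exact: H.
  move=> kg; apply: (H _ (i * 2)%N).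
  rewrite -mulgA -expgnDr; have -> : (i + i * 2 = 3 * i)%N by lia.
  by rewrite expgnA C3 expg1n mulg1.
move=> [i1 [e [j [jJ ->]]]]; exists (i' + i1)%N, e, j; split=> //.
by rewrite expgnDr -!mulgA.
Qed.

Lemma adjacent_link g h : adjacent g h -> exists2 j, inJ j &
  h = g * j \/ exists u, h = link_elt g u * j.
Proof.
move=> [k [[i [e [j [jJ gE]]]] kh]].
have [pl E] : exists pl, k * C ^+ i = plane_elt g pl.
  have -> : k * C ^+ i = g * (j^-1 * (pp e)^-1).
    by rewrite gE -!mulgA mulVKg mulgV mulg1.
  have [p [q [e' jE]]] := inJV jJ; rewrite {}jE; case: e {gE}; case: e'.
  - exists (PlA (- p) (- q)); by rewrite /= /tau !Z.opp_involutive -!mulgA.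
  - exists (PlB (- p) (- q)); by rewrite /= /tau !Z.opp_involutive -!mulgA mul1g.
  (* The shift of p makes up for the factor U^-1 in the representative of [PlM]. *)
  - exists (PlM (- (p + 1)) (- q)).
    rewrite /= /tau !Z.opp_involutive gzS -!mulgA invg1 mulg1.
    by rewrite [U * (gz M q * _)]mulgA (_ : U * _ = gz M q * U)
      -?mulgA ?mulVKg //; rewrite -[U]gz1 gUM.
  - exists (PlP (- p) (- q)); by rewrite /= /tau !Z.opp_involutive -!mulgA invg1 !mulg1.
have {kh} := (in_planeC k i h).2 kh; rewrite E => -[i' [e' [j' [j'J /(in_plane_vertex j'J)]]]].
move=> [j'' j''J ->]; exists j'' => //.
by case: (plane_vertex _ _ _) => [u|]; [right; exists u | left].
Qed.

Lemma adjacent_sym g h : adjacent g h -> adjacent h g.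
Proof. by move=> [k [kg kh]]; exists k. Qed.
Lemma inJV' j : inJ j^-1 -> inJ j. Proof. by move/inJV; rewrite invgK. Qed.

Lemma Q_tau k b c x : Q * (gz U (k - b - c) * (gz M c * x)) =
  tau b c * (gz U k * (Q * x)).
Proof.
rewrite [Q * (gz U _ * _)]mulgA QgU -!mulgA [Q * (gz M _ * _)]mulgA QgM.
rewrite -!mulgA [gz U _ * (gz U _ * _)]mulgA -gzD.
have -> : (k - b - c + c = - b + k)%ZZ by lia.
rewrite gzD /tau -!mulgA; congr (_ * _).
by rewrite !mulgA gUM.
Qed.

Lemma link_elt_VAp g b c :
  g * Q * (gz U (1 - b - c) * gz M c) * I^-1 * (gz U 0 * gz M 1) * I = link_elt g (VAp b c).
Proof.
rewrite -!mulgA Q_tau !gz1 mul1g /=; congr (_ * (_ * (_ * _))).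
by rewrite IV -!mulgA QIK QK.
Qed.

Lemma link_elt_VAm g b c :
  g * Q * (gz U (-1 - b - c) * gz M c) * I * (gz U 0 * gz M (-1)) * I = link_elt g (VAm b c).
Proof.
rewrite -!mulgA Q_tau (gzN U 1) (gzN M 1) !gz1 mul1g /=; congr (_ * (_ * (_ * _))).
by rewrite QIK IV -!mulgA.
Qed.

Lemma in_plane_id k : in_plane k k.
Proof.
exists 0%N, false, 1; split; first exact: inJ_1.
by rewrite expg0 !mulg1.
Qed.
Lemma adjacent_C g : adjacent g (g * C).
Proof.
exists g; split; first exact: in_plane_id.
exists 1%N, false, 1; split; first exact: inJ_1.
by rewrite expg1 !mulg1.
Qed.
Lemma adjacent_P g : adjacent g (g * P).
Proof.
exists g; split; first exact: in_plane_id.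
exists 0%N, true, 1; split; first exact: inJ_1.
by rewrite expg0 mul1g mulg1.
Qed.
Lemma adjacent_I g : adjacent g (g * I).
Proof.
exists g; split; first exact: in_plane_id.
have := @in_plane_link g (PlP 0 0) (VT 0 0) (Or41 _ _ _ erefl).
by rewrite /= /tau !mul1g mulg1.
Qed.

(** * Pushing paths down *)

Section Heights.
Variable height : G -> Z.
Hypothesis heightJ : forall g j, inJ j -> height (g * j) = height g.
Hypothesis height_link : forall g,
  exists D, [/\ lok D, lw D = height g & forall u, lval D u = height (link_elt g u)].

(** The bound concerns interior vertices only; paths grow at the end y, which serves the induction
    of [walk_lower]. *)
Inductive walk (b : Z) (x : G) : G -> Prop :=
  | walk1 y : adjacent x y -> walk b x y
  | walkS z y : walk b x z -> (height z < b)%ZZ -> adjacent z y -> walk b x y.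

Lemma walk_cat b x z y : walk b x z -> (height z < b)%ZZ -> walk b z y -> walk b x y.
Proof.
move=> xz zb; elim=> [{}y|u {}y _ xu]; first exact: walkS xz zb.
exact: walkS xu.
Qed.

Lemma walk_mono b c x y : (b <= c)%ZZ -> walk b x y -> walk c x y.
Proof.
move=> bc; elim=> [{}y|z {}y _ xz zb]; first exact: walk1.
by apply: walkS xz _; lia.
Qed.

Lemma walkJ b x y j : inJ j -> walk b x y -> walk b x (y * j).
Proof.
move=> jJ [{}y xy|z {}y xz zb zy].
  by apply: walk1; rewrite -[x]mulg1; apply: adjacentJ inJ_1 jJ xy.
by apply: walkS xz zb _; rewrite -[z]mulg1; apply: adjacentJ inJ_1 jJ zy.
Qed.

Lemma lnk_walk g D u v : lw D = height g -> (forall u, lval D u = height (link_elt g u)) ->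
  lnk D u v -> walk (height g) (link_elt g u) (link_elt g v).
Proof.
move=> wE vE; elim=> [{}u {}v uv|{}u z {}v zw _ uz _ zv].
  exact/walk1/ladj_adjacent.
by apply: walk_cat uz _ zv; rewrite -vE -wE.
Qed.

Lemma walk_peak x z y : adjacent x z -> adjacent z y ->
  (height x < height z)%ZZ -> (height y <= height z)%ZZ ->
  walk (height z) x y.
Proof.
move=> xz zy hx hy; have [D [Dok wE vE]] := height_link z.
have [j jJ [xE|[u xE]]] := adjacent_link (adjacent_sym xz).
  by move: hx; rewrite xE heightJ //; lia.
have [k kJ [yE|[v yE]]] := adjacent_link zy.
  by apply: walk1; rewrite yE -[x]mulg1; apply: adjacentJ inJ_1 kJ xz.
have hu : height (link_elt z u) = height x by rewrite xE heightJ.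
have hv : height (link_elt z v) = height y by rewrite yE heightJ.
have uv : walk (height z) (link_elt z u) (link_elt z v).
  by apply: (lnk_walk wE vE); apply: lnk_low => //; split; rewrite !vE wE ?hu ?hv; lia.
rewrite yE; apply: walkJ kJ _.
have xu : x * j^-1 = link_elt z u by rewrite xE mulgK.
elim: uv => [w uw|w w' _ xw ww ww']; last exact: walkS xw ww ww'.
apply: walk1; rewrite xE -[w]mulg1; exact: adjacentJ jJ inJ_1 uw.
Qed.

(** When a last interior vertex z of height b is removed, the path up to z has already been lowered.
    The predecessor of z is then strictly below b, and [walk_peak] needs strictness on one side
    only. *)
Lemma walk_lower b x y : (height x < b)%ZZ -> (height y <= b)%ZZ -> walk (b + 1) x y -> walk b x y.
Proof.
move=> hx hy xy; elim: xy hy => [{}y xy _|z {}y _ IH hz zy hy]; first exact: walk1.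
have {}IH : walk b x z by apply: IH; lia.
have [zb|zb] := Z.lt_ge_cases (height z) b; first exact: walkS IH zb zy.
have zE : height z = b by lia.
case: IH zy zE => [{zb hz}z xz|{zb hz}t {}z xt tb tz] zy zE.
  by rewrite -zE; apply: walk_peak xz zy _ _; lia.
apply: (walk_cat xt tb); rewrite -zE; apply: walk_peak tz zy _ _; lia.
Qed.

Lemma walk_low b c x y : (height x < b)%ZZ -> (height y <= b)%ZZ -> walk c x y -> walk b x y.
Proof.
move=> hx hy; have [cb|bc] := Z.le_gt_cases c b; first exact: walk_mono.
have -> : c = (b + Z.of_nat (Z.to_nat (c - b)))%ZZ by lia.
elim: (Z.to_nat _) => [|n IHn]; first by rewrite Z.add_0_r.
have -> : (b + Z.of_nat n.+1 = b + Z.of_nat n + 1)%ZZ by lia.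
by move=> /walk_lower w; apply/IHn/w; lia.
Qed.

(* The functions attached to the polynomials [a + b x + c y] and
   [x (a + b y) + c (1 + y)] of the cosets of [C ^+ i] and [C ^+ i * P]. *)
Definition link_base D := [/\ lw D = 1%ZZ, forall a, lR D a = Z.max 1 a,
  forall b, lL D b = Z.max 0 b & forall c, lB D c = Z.max 0 c].
Definition link_baseP D := [/\ lw D = 1%ZZ, forall a, lR D a = (1 + Z.max 0 a)%ZZ,
  forall b, lL D b = Z.max 0 b & forall c, lB D c = Z.max 0 c].

Hypothesis height_base : forall i, exists D,
  [/\ lok D, link_base D & forall u, lval D u = height (link_elt (C ^+ i) u)].
Hypothesis height_baseP : forall i, exists D,
  [/\ lok D, link_baseP D & forall u, lval D u = height (link_elt (C ^+ i * P) u)].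

Lemma link_elt0 g : link_elt g (VT 0 0) = g * I. Proof. by rewrite /= /tau !mul1g. Qed.

(** C^i J is the neighbour [VT 0 0] of C^(i+2) J, because C^2 I = U Q lies in J. *)
Lemma height_C i : height (C ^+ i) = 1%ZZ.
Proof.
have [D [_ [_ R L B] vE]] := height_base (i + 2); have := vE (VT 0 0).
rewrite link_elt0 expgnDr; have -> : C ^+ i * C ^+ 2 * I = C ^+ i * (U * Q).
  by rewrite C2 -mulgA -[U * I * I]mulgA QE.
by rewrite heightJ /= ?R ?L ?B; [move=> <- | apply: inJM inJ_U inJ_Q].
Qed.

Lemma height_CP i : height (C ^+ i * P) = 1%ZZ.
Proof.
have [D [_ [_ R L B] vE]] := height_base i; have := vE (VT 0 (-1)).
have -> : link_elt (C ^+ i) (VT 0 (-1)) = C ^+ i * P * Q.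
  by rewrite /= tau_M PE -!mulgA QQ mulg1.
by rewrite heightJ /= ?R ?L ?B; [move=> <- | exact: inJ_Q].
Qed.

(** Multiplicities are bounded by kinks, so only [lm D 0] and [ln D 1] could be positive. The
    neighbours in the base plane whose heights involve them have height 1, which makes them 0; what
    remains are inequalities between explicit maxima. *)
Lemma star_C i u : (height (link_elt (C ^+ i) u) <= 1)%ZZ -> on_plane (PlP 0 0) u.
Proof.
have [D [[_ [mk nk] _] [w1 R L B] vE]] := height_base i; rewrite -vE.
have m0 : lm D 0 = 0%ZZ.
  have := vE (VBp 0 0).
  have -> : link_elt (C ^+ i) (VBp 0 0) = C ^+ i.+1 * P.
    by rewrite /= /tau !mul1g expgSr -[_ * P]mulgA VCP.
  by rewrite height_CP /= R L B; lia.
have n1 : ln D 1 = 0%ZZ.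
  have := vE (VAp 0 0).
  have -> : link_elt (C ^+ i) (VAp 0 0) = C ^+ (i + 2) * P * Q.
    rewrite /= /tau !mul1g expgnDr C2 PE -!mulgA QQ mulg1.
    reflexivity.
  by rewrite heightJ ?height_CP /= ?R ?L ?B -?[(1 - 0 - 0)%ZZ]/1%ZZ; [lia | exact: inJ_Q].
have mle b : (lm D b <= 0)%ZZ.
  have [->|b0] : b = 0%ZZ \/ b <> 0%ZZ by lia.
    by rewrite m0.
  by have := mk b; rewrite !L; lia.
have nle a : (ln D a <= 0)%ZZ.
  have [->|b0] : a = 1%ZZ \/ a <> 1%ZZ by lia.
    by rewrite n1.
  by have := nk a; rewrite !R; lia.
case: u => b c /=; rewrite ?w1 ?R ?L ?B; have := mle b; have := nle (1 - b - c)%ZZ;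
  have := nle (-1 - b - c)%ZZ => h1 h2 h3 h.
- have : (b = 0 /\ c = 0 \/ b = -1 /\ c = 0 \/ b = 0 /\ c = -1)%ZZ by lia.
  by case=> [[-> ->]|[[-> ->]|[-> ->]]]; [constructor 1|constructor 2|constructor 3].
- have [-> ->] : b = 0%ZZ /\ c = 0%ZZ by lia.
  constructor 4; by left.
- exfalso; lia.
- have [-> ->] : b = 0%ZZ /\ c = 0%ZZ by lia.
  constructor 4; by right.
- exfalso; lia.
Qed.

Lemma star_CP i u : (height (link_elt (C ^+ i * P) u) <= 1)%ZZ -> on_plane (PlB 0 0) u.
Proof.
have [D [[_ [mk nk] _] [w1 R L B] vE]] := height_baseP i; rewrite -vE.
have n0 : ln D 0 = 0%ZZ.
  (* This neighbour of C^i P J is also the neighbour [VT 0 (-2)] of C^i J, whose height 2 is known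
     from the affine data; this determines [ln D 0]. *)
  have := vE (VAp 1 0); have [D' [_ [_ R' L' B'] vE']] := height_base i.
  have -> : link_elt (C ^+ i * P) (VAp 1 0) = link_elt (C ^+ i) (VT 0 (-2)).
    have -> : link_elt (C ^+ i) (VT 0 (-2)) = C ^+ i * (M * M * I).
      congr (_ * (_ * _)); exact: mul1g.
    by rewrite /= tau_UV mulKg -!mulgA [P * (I * _)]mulgA -ME.
  by rewrite -vE' /= ?R ?L ?B ?R' ?L' ?B' -?[(1 - 1 - 0)%ZZ]/0%ZZ; lia.
have nle a : (ln D a <= 0)%ZZ.
  have [->|b0] : a = 0%ZZ \/ a <> 0%ZZ by lia.
    by rewrite n0.
  by have := nk a; rewrite !R; lia.
case: u => b c /=; rewrite ?w1 ?R ?L ?B; have := mk b; rewrite !L;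
  have := nle (1 - b - c)%ZZ; have := nle (-1 - b - c)%ZZ => h1 h2 h3 h.
- have [-> ->] : b = 0%ZZ /\ c = 0%ZZ by lia.
  by constructor 1.
- have : (b = 0 /\ c = 0 \/ b = 0 /\ c = 1)%ZZ by lia.
  by case=> [[-> ->]|[-> ->]]; [constructor 2|constructor 3].
- have : (b = 0 /\ c = 0 \/ b = 0 /\ c = -1)%ZZ by lia.
  by case=> [[-> ->]|[-> ->]]; constructor 4; [left|right].
- exfalso; lia.
- exfalso; lia.
Qed.

Lemma star_step x y : in_plane 1 x -> adjacent x y -> (height y <= 1)%ZZ -> in_plane 1 y.
Proof.
move=> [i [e [j [jJ xE]]]] xy hy; rewrite mul1g in xE.
have {}xy : adjacent (C ^+ i * pp e) y.
  rewrite -[y]mulg1; have -> : C ^+ i * pp e = x * j^-1 by rewrite xE mulgA mulgK.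
  exact: adjacentJ (inJV jJ) inJ_1 xy.
have [k kJ [yE|[u yE]]] := adjacent_link xy.
  by rewrite yE; exists i, e, k; rewrite mul1g mulgA.
rewrite yE heightJ // in hy; rewrite yE; apply: in_planeJ kJ _.
apply/(in_planeC 1 i); rewrite mul1g.
case: e {xE xy yE} hy => /= hy.
  have := in_plane_link (C ^+ i * P) (star_CP hy).
  by rewrite /plane_elt /tau !mul1g mulgK.
rewrite mulg1 in hy *; have := in_plane_link (C ^+ i) (star_C hy).
by rewrite /plane_elt /tau !mulg1.
Qed.

Lemma star_walk b y : (height y <= 1)%ZZ -> walk b 1 y -> in_plane 1 y.
Proof.
move=> hy xy; have h1 : height 1 = 1%ZZ by rewrite -(height_C 0).
(* The bound has to exceed the height 1 of the origin; below 2, interior heights are at most 1,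
   being integers. *)
have {xy} : walk 2 1 y by apply: walk_low xy; rewrite ?h1; lia.
have m1 := in_plane_id 1.
move=> w; elim: w hy => [{}y xy|z {}y _ IH zb zy] hy; first exact: star_step m1 xy hy.
by apply: star_step zy hy; apply: IH; lia.
Qed.
End Heights.
End Relations.

(** * The group of classes of words *)

Section WordClasses.
Variables (X : Type) (rels : set (word X * word X)).
Implicit Types u v w : word X.
Local Notation "u ~ v" := (pres_eq rels u v) (at level 70).

Lemma pres_ctx u v w w' : w ~ w' -> u ++ w ++ v ~ u ++ w' ++ v.
Proof.
elim=> [{}w|{}w {}w' _|{}w z {}w' _ wz _ zw|{}w x b {}w'|{}w l r {}w' lr].
- exact: pres_refl.
- exact: pres_sym.
- exact: pres_trans wz zw.
- by have := @pres_free _ rels (u ++ w) x b (w' ++ v); rewrite -!catA.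
- by have := @pres_rel _ rels (u ++ w) l r (w' ++ v) lr; rewrite -!catA.
Qed.

Lemma pres_cat u u' v v' : u ~ u' -> v ~ v' -> u ++ v ~ u' ++ v'.
Proof.
move=> uu vv; apply: (@pres_trans _ _ _ (u' ++ v)).
  exact: (@pres_ctx [::] v).
by have := @pres_ctx u' [::] _ _ vv; rewrite !cats0.
Qed.

Lemma winv_cat u v : winv (u ++ v) = winv v ++ winv u.
Proof. by rewrite /winv map_cat rev_cat. Qed.

Lemma winvK : involutive (@winv X).
Proof.
move=> w; rewrite /winv map_rev revK -map_comp -[RHS]map_id.
by apply: eq_map => -[x b] /=; rewrite negbK.
Qed.

Lemma pres_mulV w : w ++ winv w ~ [::].
Proof.
elim: w => [|[x b] w IHw]; first exact: pres_refl.
rewrite -cat1s winv_cat -catA; apply: pres_trans (@pres_free _ _ [::] x b [::]).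
by have := @pres_ctx [:: (x, b)] (winv [:: (x, b)]) _ _ IHw; rewrite -!catA.
Qed.

Lemma pres_Vmul w : winv w ++ w ~ [::].
Proof. by have := pres_mulV (winv w); rewrite winvK. Qed.

Lemma pres_inv u v : u ~ v -> winv u ~ winv v.
Proof.
move=> uv; have E : winv u ++ v ++ winv v ~ winv u.
  by have := @pres_ctx (winv u) [::] _ _ (pres_mulV v); rewrite !cats0.
apply: pres_trans (pres_sym E) _; rewrite catA.
apply: (@pres_ctx [::] (winv v) _ [::]); apply: pres_trans (pres_Vmul u).
exact/pres_cat/pres_sym/uv/pres_refl.
Qed.

End WordClasses.

HB.instance Definition _ := gen_eqMixin Hgen.
HB.instance Definition _ := gen_choiceMixin Hgen.

Local Notation "u ~ v" := (pres_eq relations u v) (at level 70).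

(** [pres_eq] is only a congruence on words. Choosing one word per class turns the quotient into a
    subtype, hence into a [groupType] to which the results on cosets apply. *)
Definition canon (w : seq (Hgen * bool)) : seq (Hgen * bool) :=
  xget [::] [set v | w ~ v]%classic.

Lemma canon_pres w : w ~ canon w.
Proof. by apply: xgetPex; exists w; exact: pres_refl. Qed.

Lemma canon_eq v w : v ~ w -> canon v = canon w.
Proof.
move=> vw; rewrite /canon; congr xget; apply/predeqP => u; split=> h.
  exact: pres_trans (pres_sym vw) h.
exact: pres_trans vw h.
Qed.

Lemma canonK w : `[< canon (canon w) = canon w >].
Proof. by apply/asboolP/esym/canon_eq/canon_pres. Qed.

Record pgrp := Pgrp { pword : seq (Hgen * bool);
  pwordP : `[< canon pword = pword >] }.
HB.instance Definition _ := [isSub for pword].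
HB.instance Definition _ := [Choice of pgrp by <:].

Definition cl (w : word Hgen) : pgrp := Pgrp (canonK w).
Lemma cl_eq v w : cl v = cl w <-> v ~ w.
Proof.
split=> [/(congr1 pword) /= E|vw]; last by apply: val_inj; exact: canon_eq.
apply: pres_trans (canon_pres v) _; rewrite E; exact/pres_sym/canon_pres.
Qed.

Lemma pwordK : cancel pword cl.
Proof. by move=> g; apply: val_inj; exact/asboolP/pwordP. Qed.
Lemma pword_cl w : pword (cl w) ~ w.
Proof. exact/pres_sym/canon_pres. Qed.

Definition pmul g h := cl (pword g ++ pword h).
Definition pinv g := cl (winv (pword g)).

Lemma pmul_cl v w : pmul (cl v) (cl w) = cl (v ++ w).
Proof. by apply/cl_eq/pres_cat; exact: pword_cl. Qed.

Lemma pmulA : associative pmul.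
Proof.
by move=> f g h; rewrite -[f]pwordK -[g]pwordK -[h]pwordK !pmul_cl catA.
Qed.
Lemma pmul1 : left_id (cl [::]) pmul.
Proof. by move=> g; rewrite -[g]pwordK pmul_cl. Qed.
Lemma pmulr1 : right_id (cl [::]) pmul.
Proof. by move=> g; rewrite -[g]pwordK pmul_cl cats0. Qed.
Lemma pmulV : left_inverse (cl [::]) pinv pmul.
Proof. by move=> g; rewrite -{2}[g]pwordK pmul_cl; apply/cl_eq/pres_Vmul. Qed.
Lemma pmulrV : right_inverse (cl [::]) pinv pmul.
Proof. by move=> g; rewrite -{1}[g]pwordK pmul_cl; apply/cl_eq/pres_mulV. Qed.

HB.instance Definition _ := isGroup.Build pgrp pmulA pmul1 pmulr1 pmulV pmulrV.

Lemma cl_cat v w : cl (v ++ w) = cl v * cl w. Proof. by rewrite -pmul_cl. Qed.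
Lemma cl_nil : cl [::] = 1. Proof. by []. Qed.
Lemma cl_winv w : cl (winv w) = (cl w)^-1.
Proof. by apply/cl_eq/pres_inv/pres_sym/pword_cl. Qed.
Lemma cl_wpow w k : cl (wpow w k) = cl w ^+ k.
Proof. by elim: k => [|k IHk]; [rewrite expg0 | rewrite expgS -IHk -cl_cat]. Qed.
Lemma cl_rel l r : relations (l, r) -> cl l = cl r.
Proof.
by move=> lr; apply/cl_eq; have := @pres_rel _ _ [::] l r [::] lr; rewrite !cats0.
Qed.

Definition pI := cl (letter HgenI).
Definition pC := cl (letter HgenC).
Definition pP := cl (letter HgenP).

Lemma pI4 : pI ^+ 4 = 1.
Proof. by rewrite -cl_wpow -cl_nil; apply: cl_rel; do 4!left. Qed.
Lemma pC3 : pC ^+ 3 = 1.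
Proof. by rewrite -cl_wpow -cl_nil; apply: cl_rel; do 3!left; right. Qed.
Lemma pP5 : pP ^+ 5 = 1.
Proof. by rewrite -cl_wpow -cl_nil; apply: cl_rel; left; right. Qed.
Lemma pPCP : pP * pC * pP = pI.
Proof.
have <- : cl (letter HgenP ++ letter HgenC ++ letter HgenP) = pP * pC * pP.
  by rewrite !cl_cat mulgA.
by apply: cl_rel; right.
Qed.
Lemma pCQ : commute pC (pI * pI).
Proof.
have : cl (wcomm (letter HgenC) (wpow (letter HgenI) 2)) = 1.
  by apply: cl_rel; do 2!left; right.
rewrite !cl_cat !cl_winv cl_wpow -[pI ^+ 2]/(pI * pI).
move=> /(congr1 (fun x => pC * x)); rewrite mulVKg mulg1.
move=> /(congr1 (fun x => pI * pI * x)); rewrite mulVKg mulg1 => E; exact: E.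
Qed.
Local Close Scope group_scope.

Local Open Scope ring_scope.

(** * The action on positive points and the heights *)

Section PlaneMaps.
Variable K : fieldType.
Implicit Types z : K * K.

(** These formulas are stated over any field, as they serve twice: for points with positive
    coordinates, and for components of birational maps in the field of rational functions. *)
Definition aC z : K * K := (z.2 / z.1, z.1^-1).
Definition aP z : K * K := (z.2, (z.2 + 1) / z.1).

Lemma aI4 z : aI (aI (aI (aI z))) = z.
Proof. by rewrite /aI /= !invrK -surjective_pairing. Qed.

Lemma aC3 z : z.1 != 0 -> z.2 != 0 -> aC (aC (aC z)) = z.
Proof.
case: z => s t /= s0 t0; rewrite /aC /=; congr pair; field; by rewrite ?oner_eq0 ?s0 ?t0.
Qed.

Lemma aCI2 z : z.1 != 0 -> z.2 != 0 -> aC (aI (aI z)) = aI (aI (aC z)).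
Proof.
case: z => s t /= s0 t0; rewrite /aC /aI /=; congr pair; field; by rewrite ?oner_eq0 ?s0 ?t0.
Qed.

Lemma aPCP z : z.1 != 0 -> z.2 != 0 -> (aP z).2 != 0 -> aP (aC (aP z)) = aI z.
Proof.
case: z => s t /= s0 t0; rewrite mulf_eq0 negb_or => /andP[t1 _].
by rewrite /aP /aC /aI /=; congr pair; field; rewrite ?oner_eq0 ?s0 ?t0 ?t1.
Qed.

(** The pentagon recurrence u'' = (u' + 1) / u has the five terms s, t, (t+1)/s, (s+t+1)/(st),
    (s+1)/t. The last three hypotheses provide the nonzero numerators needed as denominators. *)
Lemma aP5 z : z.1 != 0 -> z.2 != 0 -> (aP z).2 != 0 -> (aP (aP z)).2 != 0 ->
  (aP (aP (aP z))).2 != 0 -> aP (aP (aP (aP (aP z)))) = z.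
Proof.
case: z => s t /= s0 t0 u0 v0 w0.
have t1 : t + 1 != 0 by apply: contraNneq u0 => ->; rewrite mul0r.
have st : (t + 1 + s) != 0.
  apply: contraNneq v0 => E; have -> : (t + 1) / s + 1 = (t + 1 + s) / s.
    by rewrite [RHS]mulrDl divff.
  by rewrite E !mul0r.
have s1 : s + 1 != 0.
  apply: contraNneq w0 => E.
  have -> : ((t + 1) / s + 1) / t + 1 = (s + 1) * (t + 1) / (s * t).
    by field; rewrite ?oner_eq0 s0 t0.
  by rewrite E !mul0r.
have st1 : t + 1 + s + s * t != 0.
  have -> : t + 1 + s + s * t = (s + 1) * (t + 1) by ring.
  exact: mulf_neq0.
by rewrite /aP /=; congr pair; field; rewrite ?oner_eq0 ?s0 ?t0 ?t1 ?st ?s1 ?st1.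
Qed.
End PlaneMaps.
Arguments aC {K} z.
Arguments aP {K} z.

Section Action.
Variable F : numClosedFieldType.
Implicit Types (z : F * F).

Definition ag (g : Hgen) :=
  match g return F * F -> F * F with HgenI => aI | HgenC => aC | HgenP => aP end.
Definition gorder (g : Hgen) := match g with HgenI => 4%N | HgenC => 3%N | HgenP => 5%N end.
(** An inverse letter acts as the power of its generator given by the finite order, so the inverse
    maps need no formulas of their own. *)
Definition actl (l : Hgen * bool) z : F * F :=
  if l.2 then iter (gorder l.1).-1 (ag l.1) z else ag l.1 z.
Definition actw (w : word Hgen) z : F * F := foldr actl z w.

Lemma pos_ag g z : pos z -> pos (ag g z).
Proof.
case: z => s t [] /= s0 t0; case: g; split; rewrite /= ?divr_gt0 ?invr_gt0 //.
by rewrite addr_gt0.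
Qed.

Lemma pos_iter g k z : pos z -> pos (iter k (ag g) z).
Proof. by move=> z0; elim: k => //= k; exact: pos_ag. Qed.

Lemma pos_actl l z : pos z -> pos (actl l z).
Proof. by case: l => g [] z0; [exact: pos_iter | exact: pos_ag]. Qed.

Lemma pos_actw w z : pos z -> pos (actw w z).
Proof. by move=> z0; elim: w => //= l w; exact: pos_actl. Qed.

Lemma pos_neq0 z : pos z -> [/\ z.1 != 0, z.2 != 0, z.1 + 1 != 0 & z.2 + 1 != 0].
Proof. by case=> a b; rewrite !gt_eqF ?addr_gt0. Qed.

Lemma ag_order g z : pos z -> iter (gorder g) (ag g) z = z.
Proof.
move=> z0; have [s0 t0 _ _] := pos_neq0 z0; case: g.
- exact: aI4.
- exact: aC3.
have P0 k : (iter k (@aP F) z).2 != 0.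
  by have [] := pos_neq0 (pos_iter HgenP k z0).
by apply: aP5; [exact: s0 | exact: t0 | exact: (P0 1%N) | exact: (P0 2) | exact: (P0 3)].
Qed.

Lemma actw_cat v w z : actw (v ++ w) z = actw v (actw w z).
Proof. by rewrite /actw foldr_cat. Qed.

Lemma actw_free g b z : pos z -> actw [:: (g, b); (g, ~~ b)] z = z.
Proof.
move=> z0; rewrite -[RHS](ag_order g z0); case: b => /=; rewrite /actl /=.
  by rewrite -iterSr; case: g.
by rewrite -iterS; case: g.
Qed.

Lemma actw_rel l r z : relations (l, r) -> pos z -> actw l z = actw r z.
Proof.
move=> lr z0; have [s0 t0 _ t1] := pos_neq0 z0.
case: lr => [[[[]|]|]|] [-> ->].
- exact: (ag_order HgenI z0).
- exact: (ag_order HgenC z0).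
- by rewrite /actw /= /actl /= (aCI2 s0 t0) !aI4 aC3.
- exact: (ag_order HgenP z0).
- by apply: aPCP => //; have [] := pos_neq0 (pos_ag HgenP z0).
Qed.

Lemma actw_pres v w z : pres_eq relations v w -> pos z -> actw v z = actw w z.
Proof.
move=> vw z0; elim: vw => [//|{}v {}w _ -> //|u {}v {}w _ -> _ -> //|u g b {}v|u l r {}v lr].
  by rewrite !actw_cat actw_free //; exact: pos_actw.
by rewrite !actw_cat (actw_rel lr) //; exact: pos_actw.
Qed.

Definition act (g : pgrp) z := actw (pword g) z.

Lemma act_cl w z : pos z -> act (cl w) z = actw w z.
Proof. exact/actw_pres/pword_cl. Qed.

Lemma pos_act g z : pos z -> pos (act g z). Proof. exact: pos_actw. Qed.

Lemma act1 z : pos z -> act 1%g z = z.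
Proof. exact: act_cl. Qed.

Lemma actM g h z : pos z -> act (g * h)%g z = act g (act h z).
Proof. by move=> z0; rewrite act_cl // actw_cat. Qed.

Lemma actV g w z : pos w -> act g w = z -> act g^-1%g z = w.
Proof. by move=> w0 <-; rewrite -actM // mulVg act1. Qed.

Definition pQ := (pI * pI)%g.
Definition pU := (pC^-1 * pI^-1)%g.
Definition pM := (pP * pI)%g.

Lemma act_I z : pos z -> act pI z = aI z. Proof. exact: act_cl. Qed.
Lemma act_C z : pos z -> act pC z = aC z. Proof. exact: act_cl. Qed.
Lemma act_P z : pos z -> act pP z = aP z. Proof. exact: act_cl. Qed.
Lemma act_IV z : pos z -> act pI^-1%g z = aJ z.
Proof.
move=> z0; apply: actV; first exact: pos_aJ.
by rewrite act_I; [rewrite /aI /aJ /= invrK -surjective_pairing | exact: pos_aJ].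
Qed.
Lemma act_Q z : pos z -> act pQ z = aI (aI z).
Proof. by move=> z0; rewrite actM // !act_I //; exact: pos_aI. Qed.

Lemma aT_aT p q p' q' z : pos z -> aT p q (aT p' q' z) = aT (p + p') (q + q') z.
Proof.
move=> /pos_neq0[s0 _ s1 _]; rewrite /aT /= !fzD //; congr pair; ring.
Qed.

Lemma aT0 z : aT 0 0 z = z :> F * F.
Proof. by rewrite /aT /= !mulr1 -surjective_pairing. Qed.

Lemma act_gz x p q n z : (forall z, pos z -> act x z = aT p q z) -> pos z ->
  act (gz x n) z = aT (n * p) (n * q) z.
Proof.
move=> xE; have xV z' : pos z' -> act x^-1%g z' = aT (- p) (- q) z'.
  move=> z0; have T0 := pos_aT (- p) (- q) z0; apply: actV => //.
  by rewrite xE // aT_aT // !Z.add_opp_diag_r aT0.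
move: z; elim/gz_ind: n => [z z0|n]; first by rewrite act1 // !Z.mul_0_l aT0.
split=> IH z z0.
  rewrite gzS actM // xE // IH; last exact: pos_aT.
  by rewrite aT_aT // !Z.mul_add_distr_r !Z.mul_1_l.
have -> : gz x n = (gz x (n + 1) * x^-1)%g by rewrite gzS mulgK.
rewrite actM // xV // IH; last exact: pos_aT.
rewrite aT_aT //; congr (aT _ _ z); lia.
Qed.

Lemma act_U z : pos z -> act pU z = aT 1 0 z.
Proof.
move=> z0; have J0 := pos_aJ z0; have T0 := pos_aT 1 0 z0.
rewrite actM // act_IV //; apply: actV => //.
have [s0 t0 _ _] := pos_neq0 z0; rewrite act_C //.
rewrite /aC /aT /aJ /= mulr1 [z.1 ^+ _]expr1; congr pair; field; by rewrite ?s0 ?t0.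
Qed.

Lemma act_M z : pos z -> act pM z = aT 0 1 z.
Proof.
move=> z0; have [s0 t0 _ _] := pos_neq0 z0; have I0 := pos_aI z0.
rewrite actM // act_I // act_P // /aP /aI /aT /=; congr pair.
by rewrite mulr1 [(_ + 1) ^+ _]expr1 invrK mulrC.
Qed.

Lemma act_UM p q z : pos z -> act (gz pU p * gz pM q)%g z = aT p q z.
Proof.
move=> z0; rewrite actM // (act_gz q act_M) // (act_gz p act_U); last exact: pos_aT.
by rewrite aT_aT // !Z.mul_1_r !Z.mul_0_r Z.add_0_r Z.add_0_l.
Qed.
End Action.

(** * Polynomial models of group elements *)

Section Heights.
Variable F : numClosedFieldType.
Local Notation E := {poly F}.
Implicit Types (z : F * F) (f : {poly {poly E}}) (g : pgrp).

Lemma rep_ext phi psi f : (forall z, pos z -> phi z = psi z) -> rep phi f -> rep psi f.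
Proof.
move=> phipsi fR s t s0 t0; have [c c0 ->] := fR s t s0 t0.
by exists c => //; rewrite phipsi.
Qed.

Definition models g f := good f /\ rep (@act F g) f.

Lemma models_I g f : models g f -> models (g * pI)%g (fI f).
Proof.
move=> [fG fR]; split; first exact: good_fI.
apply: rep_ext (rep_fI fR) => z z0; by rewrite actM // act_I.
Qed.

Lemma models_J g f : models g f -> models (g * pI^-1)%g (fJ f).
Proof.
move=> [fG fR]; split; first exact: good_fJ.
apply: rep_ext (rep_fJ fR) => z z0; by rewrite actM // act_IV.
Qed.

Lemma models_tw p q g f : models g f -> models (g * (gz pU p * gz pM q))%g (tw p q f).
Proof.
move=> [fG fR]; split; first exact: good_tw.
apply: rep_ext (rep_tw p q (good0 fG) fR) => z z0; by rewrite actM // act_UM.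
Qed.

Lemma models_Q g f : models g f -> models (g * pQ)%g (fII f).
Proof. by move=> fM; rewrite /pQ mulgA; apply/models_I/models_I. Qed.

Definition affine (a b c : E) : {poly {poly E}} :=
  (a%:P + b%:P * 'X)%:P + (c%:P)%:P * 'X.
(* [x (a + b y) + c (1 + y)]: up to the factor [x], the polynomial [affine a b c]
   at [(y, (y + 1) / x)]. *)
Definition bilin (a b c : E) : {poly {poly E}} :=
  (c%:P + a%:P * 'X)%:P + (c%:P + b%:P * 'X)%:P * 'X.

Lemma ev_lin u v s t : ev (u%:P + v%:P * 'X) s t = u.[s%:P] + v.[s%:P] * t%:P :> E.
Proof. by rewrite /ev !hornerE. Qed.

Lemma ev_affine a b c s t : ev (affine a b c) s t = a + b * s%:P + c * t%:P.
Proof. by rewrite ev_lin !hornerE. Qed.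

Lemma ev_bilin a b c s t : ev (bilin a b c) s t =
  c + a * s%:P + (c + b * s%:P) * t%:P.
Proof. by rewrite ev_lin !hornerE. Qed.

Lemma coef_lin (R : nzRingType) (u v : R) j : (u%:P + v%:P * 'X)`_j =
  if j == 0%N then u else if j == 1%N then v else 0.
Proof.
by rewrite coefD coefC coefMX coefC; case: j => [|[|j]] //=; rewrite ?addr0 ?add0r.
Qed.

Lemma size_lin (R : nzRingType) (u v : R) : v != 0 -> size (u%:P + v%:P * 'X) = 2.
Proof.
by move=> v0; rewrite addrC size_MXaddC polyC_eq0 (negPf v0) size_polyC v0.
Qed.

Lemma affine_coef a b c i j : a != 0 -> b != 0 -> c != 0 ->
  ((affine a b c)`_j`_i != 0) =
  [|| (i == 0%N) && (j == 0%N), (i == 1%N) && (j == 0%N) | (i == 0%N) && (j == 1%N)].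
Proof.
move=> a0 b0 c0; rewrite coef_lin; case: j => [|[|j]] //=.
- by rewrite coef_lin; case: i => [|[|i]] //=; rewrite ?a0 ?b0 ?eqxx.
- by rewrite coefC; case: i => [|i]; rewrite /= ?c0 ?eqxx ?andbF.
by rewrite coef0 eqxx; case: i => [|[|i]].
Qed.

Lemma bilin_coef a b c i j : a != 0 -> b != 0 -> c != 0 ->
  ((bilin a b c)`_j`_i != 0) = (i <= 1)%N && (j <= 1)%N.
Proof.
move=> a0 b0 c0; rewrite coef_lin; case: j => [|[|j]] //=.
- by rewrite coef_lin; case: i => [|[|i]] //=; rewrite ?a0 ?b0 ?c0 ?eqxx.
- by rewrite coef_lin; case: i => [|[|i]] //=; rewrite ?a0 ?b0 ?c0 ?eqxx.
by rewrite coef0 eqxx andbF.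
Qed.

Section Frame.
Variables a b c : E.
Hypotheses (a0 : a != 0) (b0 : b != 0) (c0 : c != 0).
Hypotheses (ab : a != b) (ac : a != c) (bc : b != c).

Lemma lin_neq0 (u v : E) : u != 0 -> u%:P + v%:P * 'X != 0.
Proof.
move=> u0; apply: contraNneq u0 => /(congr1 (fun p : {poly E} => p`_0)).
by rewrite coef_lin coef0 /= => ->.
Qed.

Lemma affine_0 : (affine a b c)`_0 != 0.
Proof. by rewrite coef_lin lin_neq0. Qed.
Lemma bilin_0 : (bilin a b c)`_0 != 0.
Proof. by rewrite coef_lin lin_neq0. Qed.

Lemma wz_affine : wz (affine a b c) = 1%ZZ.
Proof. by rewrite /wz size_lin // polyC_eq0. Qed.
Lemma wz_bilin : wz (bilin a b c) = 1%ZZ.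
Proof. by rewrite /wz size_lin // lin_neq0. Qed.

Lemma fR_affine k : fR (affine a b c) k = Z.max 1 k.
Proof.
apply: fR_unique affine_0 _ _ _ _ => [i j|].
  by rewrite affine_coef // => /or3P[] /andP[/eqP-> /eqP->]; lia.
have [k1|k1] := Z.le_gt_cases 1 k.
  by exists 0%N, 1%N; rewrite affine_coef //; split=> //; lia.
by exists 1%N, 0%N; rewrite affine_coef //; split=> //; lia.
Qed.

Lemma fL_affine k : fL (affine a b c) k = Z.max 0 k.
Proof.
apply: fL_unique affine_0 _ _ _ _ => [i j|].
  by rewrite affine_coef // => /or3P[] /andP[/eqP-> /eqP->]; lia.
have [k1|k1] := Z.le_gt_cases 0 k.
  by exists 0%N, 1%N; rewrite affine_coef //; split=> //; lia.
by exists 0%N, 0%N; rewrite affine_coef //; split=> //; lia.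
Qed.

Lemma fR_bilin k : fR (bilin a b c) k = (1 + Z.max 0 k)%ZZ.
Proof.
apply: fR_unique bilin_0 _ _ _ _ => [i j|].
  by rewrite bilin_coef // => /andP[i1 j1]; nia.
have [k1|k1] := Z.le_gt_cases 0 k.
  by exists 1%N, 1%N; rewrite bilin_coef //; split=> //; lia.
by exists 1%N, 0%N; rewrite bilin_coef //; split=> //; lia.
Qed.

Lemma fL_bilin k : fL (bilin a b c) k = Z.max 0 k.
Proof.
apply: fL_unique bilin_0 _ _ _ _ => [i j|].
  by rewrite bilin_coef // => /andP[i1 j1]; nia.
have [k1|k1] := Z.le_gt_cases 0 k.
  by exists 0%N, 1%N; rewrite bilin_coef //; split=> //; lia.
by exists 0%N, 0%N; rewrite bilin_coef //; split=> //; lia.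
Qed.

Lemma oz1_lin (u v : E) : u != v -> oz1 (u%:P + v%:P * 'X) = 0%ZZ.
Proof. by move=> uv; rewrite /oz1 ordp0 // !hornerE mulrN1 subr_eq0. Qed.

Lemma fB_lin (u v : {poly E}) k : u != 0 -> v != 0 -> oz1 u = 0%ZZ -> oz1 v = 0%ZZ ->
  fB (u%:P + v%:P * 'X) k = Z.max 0 k.
Proof.
move=> u0 v0 u1 v1; have s j : (j \in supp (u%:P + v%:P * 'X)) = (j <= 1)%N.
  by rewrite mem_supp coef_lin; case: j => [|[|j]] //=; rewrite eqxx.
apply: supz_unique => [|j|]; first by rewrite s.
  by rewrite s coef_lin; case: j => [|[|j]] //= _; rewrite ?u1 ?v1; lia.
have [k1|k1] := Z.le_gt_cases 0 k.
  by exists 1%N; rewrite ?s // coef_lin /= v1; lia.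
by exists 0%N; rewrite ?s // coef_lin /= u1; lia.
Qed.

Lemma fB_affine k : fB (affine a b c) k = Z.max 0 k.
Proof.
apply: fB_lin; rewrite ?lin_neq0 ?polyC_eq0 ?oz1_lin //.
by rewrite /oz1 ordp0 // hornerC.
Qed.

Lemma fB_bilin k : fB (bilin a b c) k = Z.max 0 k.
Proof. by apply: fB_lin; rewrite ?lin_neq0 ?oz1_lin // eq_sym. Qed.

Lemma link_affine : link_base (link_of (affine a b c)).
Proof.
by split=> [|k|k|k] /=; rewrite ?wz_affine ?fR_affine ?fL_affine ?fB_affine.
Qed.

Lemma link_bilin : link_baseP (link_of (bilin a b c)).
Proof.
by split=> [|k|k|k] /=; rewrite ?wz_bilin ?fR_bilin ?fL_bilin ?fB_bilin.
Qed.
End Frame.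

Lemma affine_good k l m : uniq [:: k; l; m] ->
  good (affine ('X^k) ('X^l) ('X^m) : {poly {poly E}}).
Proof.
move=> /= /andP[]; rewrite !inE negb_or => /andP[kl km] _.
have X0 n : 'X^n != 0 :> E by rewrite expf_neq0 // polyX_eq0.
split; first exact: affine_0.
  by exists 0%N; rewrite affine_coef.
exists [::] => s t _ _; rewrite ev_affine => /(congr1 (fun p : E => p`_k)).
rewrite !coefD !coefMC !coefXn eqxx (negPf kl) (negPf km) coef0 !mul0r !addr0.
by move/eqP; rewrite oner_eq0.
Qed.

Lemma bilin_good k l m : uniq [:: k; l; m] ->
  good (bilin ('X^k) ('X^l) ('X^m) : {poly {poly E}}).
Proof.
move=> /= /andP[]; rewrite !inE negb_or => /andP[kl km] _.
have X0 n : 'X^n != 0 :> E by rewrite expf_neq0 // polyX_eq0.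
split; first exact: bilin_0.
  by exists 0%N; rewrite bilin_coef.
exists [::] => s t s0 _; rewrite ev_bilin => /(congr1 (fun p : E => p`_k)).
rewrite !(coefMC, coefD, coefXn) eqxx (negPf kl) (negPf km) coef0.
rewrite !(mul0r, add0r, addr0, mul1r).
by move/eqP; rewrite (negPf s0).
Qed.

Lemma rep_affine_C phi (a b c : E) : rep phi (affine a b c) ->
  rep (phi \o aC) (affine c a b).
Proof.
apply: rep_sub => [z|s t s0 t0]; first exact: (pos_ag HgenC).
have sn0 : s != 0 by rewrite gt_eqF.
exists s => //; rewrite !ev_affine /= !mulrDr.
have E1 : s%:P * (c * (s^-1)%:P) = c :> E.
  by rewrite mulrCA -polyCM mulfV // mulr1.
have E2 : s%:P * (b * (t / s)%:P) = b * t%:P :> E.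
  by rewrite mulrCA -polyCM mulrC -[s * _]mulrC divfK // mulrC.
rewrite E1 E2 [s%:P * a]mulrC; ring.
Qed.

Lemma rep_affine_P phi (a b c : E) : rep phi (affine a b c) ->
  rep (phi \o aP) (bilin a b c).
Proof.
apply: rep_sub => [z|s t s0 t0]; first exact: (pos_ag HgenP).
have sn0 : s != 0 by rewrite gt_eqF.
exists s => //; rewrite ev_affine ev_bilin /= !mulrDr.
have E2 : s%:P * (c * ((t + 1) / s)%:P) = c * (t%:P + 1) :> E.
  by rewrite mulrCA -polyCM mulrC -[s * _]mulrC divfK // mulrC polyCD.
rewrite E2; ring.
Qed.

(** C permutes the three homogeneous coordinates cyclically, so the exponents are a rotation of 0,
    1, 2. *)
Lemma models_C i : exists k l m, uniq [:: k; l; m] /\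
  models (pC ^+ i)%g (affine ('X^k) ('X^l) ('X^m)).
Proof.
elim: i => [|i [k [l [m [klm [_ fR]]]]]].
  exists 0%N, 1%N, 2; split=> //; split; first exact: affine_good.
  move=> s t s0 t0; exists 1; rewrite ?oner_eq0 // expg0 act1 //.
  by rewrite ev_affine mul1r expr0 expr1.
have mkl : uniq [:: m; k; l] by rewrite -(rot_uniq 1).
exists m, k, l; split=> //; split; first exact: affine_good.
by apply: rep_ext (rep_affine_C fR) => z z0; rewrite expgSr actM // act_C.
Qed.

Lemma models_CP i : exists k l m, uniq [:: k; l; m] /\
  models (pC ^+ i * pP)%g (bilin ('X^k) ('X^l) ('X^m)).
Proof.
have [k [l [m [klm [_ fR]]]]] := models_C i.
exists k, l, m; split=> //; split; first exact: bilin_good.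
by apply: rep_ext (rep_affine_P fR) => z z0; rewrite actM // act_P.
Qed.

(** C = I^-1 U^-1 and P = M I^-1, so every letter is a product of elements whose pull-backs are
    [fI], [fJ] and the twists. *)
Lemma models_ex g : exists f, models g f.
Proof.
pose ex g := exists f, models g f.
have exI h : ex h -> ex (h * pI)%g by move=> [f fM]; exists (fI f); exact: models_I.
have exJ h : ex h -> ex (h * pI^-1)%g by move=> [f fM]; exists (fJ f); exact: models_J.
have exT p q h : ex h -> ex (h * (gz pU p * gz pM q))%g.
  by move=> [f fM]; exists (tw p q f); exact: models_tw.
have exU h : ex h -> ex (h * pU)%g.
  by move/(exT 1%ZZ 0%ZZ); rewrite /= expg1 mulg1.
have exUV h : ex h -> ex (h * pU^-1)%g.
  by move/(exT (-1)%ZZ 0%ZZ); rewrite /= expg1 mulg1.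
have exM h : ex h -> ex (h * pM)%g.
  by move/(exT 0%ZZ 1%ZZ); rewrite /= expg1 mul1g.
have exMV h : ex h -> ex (h * pM^-1)%g.
  by move/(exT 0%ZZ (-1)%ZZ); rewrite /= expg1 mul1g.
rewrite -[g]pwordK; elim/last_ind: (pword g) => [|w [x b] IHw].
  have [k [l [m [_ fM]]]] := models_C 0; by eexists; exact: fM.
rewrite -cats1 cl_cat.
have -> : cl [:: (x, b)] = (if b then (cl (letter x))^-1 else cl (letter x))%g.
  by case: b => //; rewrite -cl_winv.
case: x b => [] [].
- exact: exJ.
- exact: exI.
- by have := exI _ (exU _ IHw); rewrite -mulgA /pU mulgVK.
- by have := exUV _ (exJ _ IHw); rewrite -mulgA /pU invgM !invgK mulKg.
- by have := exMV _ (exI _ IHw); rewrite -mulgA /pM invgM mulVKg.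
- by have := exJ _ (exM _ IHw); rewrite -mulgA /pM mulgK.
Qed.

Definition height g : Z := wz (projT1 (cid (models_ex g))).

Lemma heightE g f : models g f -> height g = wz f.
Proof.
move=> [fG fR]; rewrite /height; case: cid => h [hG hR] /=.
by rewrite /wz (rep_unique fG hG fR hR).
Qed.

Local Notation linkp := (link_elt pI pU pM).

Lemma pQE : (pI * pI)%g = pQ. Proof. by []. Qed.
Lemma pUE : pU = (pC^-1 * pI^-1)%g. Proof. by []. Qed.
Lemma pME : pM = (pP * pI)%g. Proof. by []. Qed.

Lemma heightJ g j : inJ pQ pU pM j -> height (g * j)%g = height g.
Proof.
move=> [p [q [e ->]]]; have [f fM] := models_ex g; have [fG _] := fM.
have tM := models_tw p q fM; rewrite (heightE fM) -(wz_tw p q fG) !mulgA -mulgA.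
case: e; last by rewrite mulg1 -(heightE tM) mulgA.
have [tG _] := tM; rewrite -(wz_II tG) -(heightE (models_Q tM)).
by rewrite -!mulgA.
Qed.

Lemma lval_height g f u : models g f -> lval (link_of f) u = height (linkp g u).
Proof.
move=> fM; have [fG _] := fM; case: u => b c.
- have := models_I (models_tw (- b) (- c) fM).
  by rewrite -mulgA => /heightE ->; rewrite wz_VT.
- have := models_I (models_tw 0 (-1) (models_I (models_tw (- b) (- c) fM))).
  by move=> /heightE; rewrite (wz_VBp fG b c) => <-; rewrite /= /tau mul1g expg1 !mulgA.
- have := models_I (models_tw 0 1 (models_J (models_tw (- b) (- c) fM))).
  by move=> /heightE; rewrite (wz_VBm fG b c) => <-; rewrite /= /tau mul1g expg1 !mulgA.
- have := models_I (models_tw 0 1 (models_J (models_tw (1 - b - c) c (models_Q fM)))).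
  by rewrite (link_elt_VAp pQE pUE pME pI4 pCQ pPCP) => /heightE ->; rewrite wz_Ap.
have := models_I (models_tw 0 (-1) (models_I (models_tw (-1 - b - c) c (models_Q fM)))).
by rewrite (link_elt_VAm pQE pUE pME pI4 pCQ pPCP) => /heightE ->; rewrite wz_Am.
Qed.

Lemma height_link g : exists D, [/\ lok D, lw D = height g &
  forall u, lval D u = height (linkp g u)].
Proof.
have [f fM] := models_ex g; have [fG _] := fM; exists (link_of f); split.
- exact: link_ok.
- by rewrite (heightE fM).
- by move=> u; exact: lval_height.
Qed.

Lemma monos_neq k l m : uniq [:: k; l; m] -> [/\ 'X^k != 'X^l :> E, 'X^k != 'X^m :> E &
  'X^l != 'X^m :> E].
Proof.
have H n n' : n != n' -> 'X^n != 'X^n' :> E.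
  apply: contraNneq => /(congr1 (fun p : E => size p)).
  by rewrite !size_polyXn => -[->].
rewrite /= !inE negb_or andbT => /andP[/andP[kl km] lm].
by split; apply: H.
Qed.

Lemma X_neq0 n : 'X^n != 0 :> E. Proof. by rewrite expf_neq0 // polyX_eq0. Qed.

Lemma height_base i : exists D,
  [/\ lok D, link_base D & forall u, lval D u = height (linkp (pC ^+ i)%g u)].
Proof.
have [k [l [m [klm fM]]]] := models_C i; have [fG _] := fM.
have [kl km lm] := monos_neq klm.
eexists; split; [exact: (link_ok fG)| |by move=> u; exact: lval_height].
by apply: link_affine; rewrite ?X_neq0.
Qed.

Lemma height_baseP i : exists D,
  [/\ lok D, link_baseP D & forall u, lval D u = height (linkp (pC ^+ i * pP)%g u)].
Proof.
have [k [l [m [klm fM]]]] := models_CP i; have [fG _] := fM.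
have [kl km lm] := monos_neq klm.
eexists; split; [exact: (link_ok fG)| |by move=> u; exact: lval_height].
by apply: link_bilin; rewrite ?X_neq0.
Qed.
End Heights.

(** * The action on positive points is faithful *)

Section Faithful.
Variable F : numClosedFieldType.
Implicit Types (z : F * F) (g : pgrp).

Lemma walk_ex g : exists b, walk pC pP pQ pU pM (@height F) b 1%g g.
Proof.
have adjC := adjacent_C pC pP pQ pU pM; have adjP := adjacent_P pC pP pQ pU pM.
have adjI := adjacent_I pQE pUE pME pI4 pC3 pCQ pP5 pPCP.
rewrite -[g]pwordK; elim/last_ind: (pword g) => [|w [x b] [c IHw]].
  by exists 0%ZZ; apply: walk1; exists 1%g; split; exact: in_plane_id.
rewrite -cats1 cl_cat; exists (Z.max c (height F (cl w) + 1))%ZZ.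
apply: (@walkS _ _ _ _ _ _ _ _ _ (cl w)); first by apply: walk_mono IHw; lia.
  lia.
have -> : cl [:: (x, b)] = (if b then (cl (letter x))^-1 else cl (letter x))%g.
  by case: b => //; rewrite -cl_winv.
have H : forall h, adjacent pC pP pQ pU pM h (h * cl (letter x))%g.
  by case: x => h; [exact: adjI | exact: adjC | exact: adjP].
case: b; last exact: H.
by apply: adjacent_sym; have := H (cl w * (cl (letter x))^-1)%g; rewrite mulgVK.
Qed.

(** The affine polynomial of the identity is then a model of g as well. *)
Lemma height_trivial g : (forall z, pos z -> act g z = z) -> height F g = 1%ZZ.
Proof.
move=> gE; have [D [_ [w1 _ _ _] _]] := height_base F 0.
have [k [l [m [klm [fG fR]]]]] := models_C F 0.
have gM : models g (affine ('X^k) ('X^l) ('X^m) : {poly {poly {poly F}}}).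
  by split=> //; apply: rep_ext fR => z z0; rewrite expg0 act1 // gE.
by rewrite (heightE gM) wz_affine // X_neq0.
Qed.

Lemma fz_eq1 (n : nat) k : (1 < n)%N -> fz (n%:R : F) k = 1 -> k = 0%ZZ.
Proof.
move=> n1; have N m : (n%:R : F) ^+ m = 1 -> m = 0%N.
  move/eqP; rewrite -natrX -[1]/(1%:R) eqr_nat.
  by case: m => // m; rewrite expnS muln_eq1 => /andP[/eqP nE _]; rewrite nE in n1.
case: k => [//|k|k] /=; first by move/N; lia.
by move/eqP; rewrite invr_eq1 => /eqP/N; lia.
Qed.

Lemma star_trivial g : in_plane pC pP pQ pU pM 1%g g ->
  (forall z, pos z -> act g z = z) -> g = 1%g.
Proof.
move=> [i [e [j [[p [q [e' jE]]] gE]]]] gid; rewrite mul1g in gE.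
rewrite -(CX3 pC3) in gE; have := ltn_pmod i (isT : (0 < 3)%N).
set k := (i %% 3)%N in gE *; clearbody k => k3.
have act_j z : pos z -> act j z = aT p q (if e' then aI (aI z) else z).
  move=> z0; rewrite jE mulgA actM // act_UM //; last exact: pos_act.
  by case: e' {jE}; rewrite ?act_Q ?act1.
(* The element j sends z to a point whose first coordinate x is 2 or 1/2. Each of the five
   nontrivial C^k P^e sending that point back to z forces an equation n x = m; the numbers 2 and 5
   are such that neither value of x solves any of them. *)
pose z : F * F := (2%:R, 5%:R).
have z0 : pos z by split; rewrite /= ltr0n.
have [x [y [xy0 zE xE]]] : exists x y : F, [/\ pos (x, y),
    act (pC ^+ k * (if e then pP else 1))%g (x, y) = z & x = 2%:R \/ x = 2%:R^-1].
  exists (act j z).1, (act j z).2; rewrite -surjective_pairing.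
  have J0 := pos_act j z0; split=> //.
    by rewrite -actM // -mulgA; have := gid z z0; rewrite gE.
  by rewrite act_j // /aT /=; case: (e'); [right | left].
have [x0 y0 _ y1] := pos_neq0 xy0; rewrite /= in x0 y0 y1.
have test n m : n%:R * x = m%:R -> (n * 2 == m)%N || (n == m * 2)%N.
  case: xE => -> E; first by move/eqP: E; rewrite -natrM eqr_nat => ->.
  have : n%:R = (m * 2)%N%:R :> F by rewrite natrM -E divfK ?pnatr_eq0.
  by move/eqP; rewrite eqr_nat => ->; rewrite orbT.
have two0 : (2 : F) != 0 by rewrite pnatr_eq0.
have pC0 (u : F * F) (u0 : pos u) : pos (aC u) := pos_ag HgenC u0.
have pP0 (u : F * F) (u0 : pos u) : pos (aP u) := pos_ag HgenP u0.
have C0 := pC0 _ xy0; have P0 := pP0 _ xy0; have CP0 := pC0 _ P0.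
case: k k3 gE zE => [|[|[|//]]] _ gE; case: e gE => gE;
  rewrite ?expg0 ?expg1 ?expg2 ?mul1g ?mulg1.
- rewrite act_P // => -[E1 E2].
  suff /test/orP[/eqP|/eqP] : 5%:R * x = 3%:R by [].
  by rewrite -E2 divfK // E1 natr1.
- move=> _; have gj : g = j by rewrite gE expg0 mul1g /= mul1g.
  have jid (u : F * F) : pos u -> aT p q (if e' then aI (aI u) else u) = u.
    by move=> u0; rewrite -act_j // -gj gid.
  case: e' jE {act_j} jid => jE jid.
    have := jid z z0; case=> /= E1 _.
    have : (2 * 2)%N%:R = 1%:R :> F by rewrite natrM -{2}E1 mulfV.
    by move/eqP; rewrite eqr_nat.
  have [q0 p0] : q = 0%ZZ /\ p = 0%ZZ.
    (* At (1, 1) only the power of x + 1 is visible and gives 2^q = 1; at (2, 1), with q = 0, the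
       power of x gives 2^p = 1. *)
    have pos1 (n : nat) : (0 < n)%N -> pos (n%:R, 1 : F).
      by move=> n0; split; rewrite /= ?ltr0n ?ltr01.
    have := jid _ (pos1 1%N isT); case; rewrite mul1r.
    have -> : fz (1 : F) p = 1 by case: (p) => [|m|m] //=; rewrite expr1n ?invr1.
    rewrite mul1r -[1 + 1]/(2%:R) => /(fz_eq1 (isT : (1 < 2)%N)) q0; split=> //.
    by have := jid _ (pos1 2%N isT); rewrite q0; case; rewrite mul1r mulr1;
      move/(fz_eq1 (isT : (1 < 2)%N)).
  by rewrite gj jE p0 q0 !mul1g.
- rewrite actM // act_P // act_C // => -[E1 E2].
  suff /test/orP[/eqP|/eqP] : 2%:R * x = 6%:R by [].
  rewrite -E1; have -> : 6%:R = 1 + 5%:R :> F by rewrite addrC natr1.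
  by rewrite -E2; field; rewrite ?x0 ?y0.
- rewrite act_C // => -[E1 E2].
  suff /test/orP[/eqP|/eqP] : 5%:R * x = 1%:R by [].
  by rewrite -E2 mulVf.
- rewrite !actM ?act_P ?act_C // => -[E1 E2].
  suff /test/orP[/eqP|/eqP] : 1%:R * x = 7%:R by [].
  have -> : 7%:R = 2%:R + 5%:R :> F by rewrite -natrD.
  by rewrite -E1 -E2; field; rewrite ?x0 ?y0 ?y1.
- rewrite !actM ?act_C // => -[E1 E2].
  suff /test/orP[/eqP|/eqP] : 2%:R * x = 5%:R by [].
  by rewrite -E1 -E2; field; rewrite ?x0 ?y0.
Qed.

Lemma act_trivial g : (forall z, pos z -> act g z = z) -> g = 1%g.
Proof.
move=> gid; apply: (star_trivial _ gid); have h1 := height_trivial gid.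
have [b w] := walk_ex g.
have h : (height F g <= 1)%ZZ by rewrite h1; lia.
exact: (star_walk pQE pUE pME pI4 pC3 pCQ pP5 pPCP (@heightJ F) (@height_link F) (@height_base F)
  (@height_baseP F) h w).
Qed.
End Faithful.

(** * Birational maps *)

Section Words.
Variables (X : Type) (G : groupType) (g : X -> G).
Local Open Scope group_scope.

Lemma weval_cat v w : weval g (v ++ w) = weval g v * weval g w.
Proof. exact: big_cat. Qed.
Lemma weval_letter x : weval g (letter x) = g x.
Proof. exact: big_seq1. Qed.
Lemma weval_nil : weval g [::] = 1. Proof. exact: big_nil. Qed.
Lemma weval_wpow w k : weval g (wpow w k) = weval g w ^+ k.
Proof.
elim: k => [|k IHk]; first exact: weval_nil.
by rewrite expgS -IHk -weval_cat.
Qed.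
Lemma weval_winv w : weval g (winv w) = (weval g w)^-1.
Proof.
elim: w => [|[x b] w IHw]; first by rewrite weval_nil invg1.
rewrite -cat1s winv_cat !weval_cat IHw invgM; congr (_ * _).
by rewrite /weval !big_seq1; case: b; rewrite /= ?invgK.
Qed.
End Words.

(** * The relations between birational maps *)

Section Coordinates.
Variable F : fieldType.
Local Notation K := (ratfun F 2).
Implicit Types f t : bir F 2.

Lemma ord2P (i : 'I_2) : i = 0 \/ i = 1.
Proof. by case: i => [[|[|//]]] ?; [left|right]; apply: val_inj. Qed.

(** As the product is composition, multiplying on the left by a generator applies [aI], [aC] or [aP]
    to this pair, so the relations reduce to the identities already proved over a field. *)
Definition crd f : K * K := (bir_map f 0, bir_map f 1).

Lemma crd_inj : injective crd.
Proof.
move=> f h [E0 E1]; apply: val_inj; apply/ffunP => i.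
by case: (ord2P i) => ->.
Qed.

Lemma bir_dominant f : dominant (bir_map f).
Proof. by case: (bir_birational f). Qed.

Lemma bir_neq0 f i : bir_map f i != 0.
Proof.
rewrite -psubstX; apply: bir_dominant.
by have := rcoord_neq0 F i; rewrite rpoly_eq0.
Qed.

Lemma crd_neq0 f : (crd f).1 != 0 /\ (crd f).2 != 0.
Proof. by split; exact: bir_neq0. Qed.

Lemma pullV f h : rsubst (bir_map f) h^-1 = (rsubst (bir_map f) h)^-1.
Proof. exact: (fmorphV (rsubst_morph (@bir_dominant f))). Qed.
Lemma pullM f h k : rsubst (bir_map f) (h * k) = rsubst (bir_map f) h * rsubst (bir_map f) k.
Proof. exact: (rmorphM (rsubst_morph (@bir_dominant f))). Qed.
Lemma pullD1 f h : rsubst (bir_map f) (h + 1) = rsubst (bir_map f) h + 1.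
Proof.
have E := rmorphD (rsubst_morph (@bir_dominant f)) h 1.
by rewrite rmorph1 in E; exact: E.
Qed.
Lemma pullX f i : rsubst (bir_map f) (rcoord F i) = bir_map f i.
Proof. by rewrite rsubst_rpoly ?psubstX //; exact: bir_dominant. Qed.

Lemma mulE f t i : bir_map (f * t)%g i = rsubst (bir_map t) (bir_map f i).
Proof. by rewrite [LHS]ffunE. Qed.

Lemma crd1 : crd 1%g = (rcoord F 0, rcoord F 1).
Proof. by rewrite /crd /= !ffunE. Qed.

Lemma monmap2E (A : 'M[int]_2) i :
  monmap F A i = rcoord F 0 ^ A i 0 * rcoord F 1 ^ A i 1.
Proof.
rewrite ffunE !big_ord_recl big_ord0 mulr1.
by congr (_ * rcoord F _ ^ A i _); apply: val_inj.
Qed.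

Lemma crd_I t : crd (birI F * t)%g = aI (crd t).
Proof.
congr pair; rewrite mulE [bir_map (birI F) _]monmap2E !mxE /=.
  by rewrite expr0z mul1r exprN1 pullV pullX.
by rewrite expr0z expr1z mulr1 pullX.
Qed.

Lemma crd_C t : crd (birC F * t)%g = aC (crd t).
Proof.
congr pair; rewrite mulE [bir_map (birC F) _]monmap2E !mxE /=.
  by rewrite exprN1 expr1z mulrC pullM pullV !pullX.
by rewrite expr0z exprN1 mulr1 pullV pullX.
Qed.

Lemma crd_P t : crd (birP F * t)%g = aP (crd t).
Proof.
congr pair; rewrite mulE [bir_map (birP F) _]ffunE /=.
  by rewrite pullX.
by rewrite pullM pullD1 pullV !pullX.
Qed.

Local Open Scope group_scope.

Lemma birI4 : birI F ^+ 4 = 1.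
Proof. by apply: crd_inj; rewrite !expgS expg0 !crd_I aI4. Qed.

Lemma birC3 : birC F ^+ 3 = 1.
Proof.
by have [x0 y0] := crd_neq0 1; apply: crd_inj; rewrite !expgS expg0 !crd_C aC3.
Qed.

Lemma birCI2 : birC F * (birI F * (birI F * 1)) = birI F * (birI F * (birC F * 1)).
Proof.
have [x0 y0] := crd_neq0 1; apply: crd_inj.
by rewrite crd_C !crd_I crd_C aCI2.
Qed.

Lemma birPCP : birP F * (birC F * (birP F * 1)) = birI F * 1.
Proof.
have [x0 y0] := crd_neq0 1; have [_ u0] := crd_neq0 (birP F * 1).
rewrite crd_P in u0; apply: crd_inj; by rewrite crd_P crd_C crd_P crd_I aPCP.
Qed.

Lemma birP5 : birP F ^+ 5 = 1.
Proof.
have [x0 y0] := crd_neq0 1; have [_ u0] := crd_neq0 (birP F * 1).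
have [_ v0] := crd_neq0 (birP F * (birP F * 1)).
have [_ w0] := crd_neq0 (birP F * (birP F * (birP F * 1))).
rewrite !crd_P in u0 v0 w0.
by apply: crd_inj; rewrite !expgS expg0 !crd_P aP5.
Qed.

Local Notation gen := (Hgen_bir F).

Lemma weval_rel l r : relations (l, r) -> weval gen l = weval gen r.
Proof.
case=> [[[[]|]|]|] [-> ->]; rewrite ?weval_nil ?weval_wpow ?weval_letter.
- exact: birI4.
- exact: birC3.
- rewrite /wcomm !weval_cat !weval_winv weval_wpow !weval_letter /=.
  have := birCI2; rewrite !weval_nil !mulg1 expg2 => ->.
  by rewrite [_ * (birI F * _)]mulgA mulKg mulVg.
- exact: birP5.
- by rewrite /weval !big_cons big_nil /=; have := birPCP; rewrite !mulg1.
Qed.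

Lemma weval_pres v w : pres_eq relations v w -> weval gen v = weval gen w.
Proof.
elim=> [//|{}v {}w _ -> //|u {}v {}w _ -> _ -> //|u x b {}v|u l r {}v lr].
  rewrite !weval_cat -cat1s weval_cat; congr (_ * _).
  rewrite -[[:: (x, ~~ b)]]/(winv [:: (x, b)]) weval_winv mulgV.
  by rewrite mul1g.
by rewrite !weval_cat (weval_rel lr).
Qed.
End Coordinates.

(** * Values of birational maps at positive points *)

Section Values.
Variable F : numClosedFieldType.
Local Notation gen := (Hgen_bir F).
Implicit Types (f g : bir F 2) (z u v : F * F).

Definition cst z : ratmap F 2 := ratmap2 (rconst 2 z.1) (rconst 2 z.2).

(** Some representative of each component is regular at z. Substitution by [rsubst] would be tied to
    the fraction chosen by [repr], whose denominator may vanish there. *)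
Definition bval f z v := forall i, reval (cst z) (bir_map f i) (cst v i).

Lemma reval_coord z i : reval (cst z) (rcoord F i) (cst z i).
Proof. by rewrite -(psubstX (cst z)); apply: reval_rpoly. Qed.

Lemma bval_mul f g z u v : bval g z v -> bval f v u -> bval (f * g)%g z u.
Proof.
move=> gv fu i; rewrite mulE; have [a [b [b0 -> ->]]] := fu i.
have nz : b != 0 by apply: contraNneq b0 => ->; rewrite rmorph0.
rewrite rsubst_frac //; last exact: bir_dominant.
apply: revalM; first exact: reval_psubst.
by apply: revalV => //; exact: reval_psubst.
Qed.

Lemma bval_1 z : bval 1%g z z.
Proof. by move=> i; rewrite [bir_map _ i]ffunE; exact: reval_coord. Qed.

Lemma bval_1_eq z v : bval 1%g z v -> v = z.
Proof.
move=> zv; have E i : cst v i = cst z i by exact: reval_fun (zv i) (bval_1 z i).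
have := E 0; have := E 1; rewrite !ffunE /= => /fmorph_inj E1 /fmorph_inj E0.
by case: v z E0 E1 {zv E} => [? ?] [? ?] /= -> ->.
Qed.

Lemma bval_gen x z : pos z -> bval (gen x) z (ag x z).
Proof.
move=> /pos_neq0[z1 z2 _ _].
have r0 : reval (cst z) (rcoord F 0) (rconst 2 z.1).
  by have := reval_coord z 0; rewrite [cst z _]ffunE.
have r1 : reval (cst z) (rcoord F 1) (rconst 2 z.2).
  by have := reval_coord z 1; rewrite [cst z _]ffunE.
have n0 : rconst 2 z.1 != 0 by rewrite fmorph_eq0.
have n1 : rconst 2 z.2 != 0 by rewrite fmorph_eq0.
have gE : crd (gen x) = match x with HgenI => aI (crd 1%g)
    | HgenC => aC (crd 1%g) | HgenP => aP (crd 1%g) end.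
  by rewrite -[gen x]mulg1; case: x; rewrite ?crd_I ?crd_C ?crd_P.
have i0 := revalV r0 n0; have i1 := revalV r1 n1.
have d0 := congr1 fst gE; have d1 := congr1 snd gE; rewrite /= in d0 d1.
move=> i; case: (ord2P i) => -> {i}; rewrite [cst _ _]ffunE ?d0 ?d1 {gE d0 d1};
  case: x; rewrite crd1 /= ?rmorphM ?rmorphD ?rmorph1 ?fmorphV //; do ?[exact: revalM].
by apply: revalM i0; apply: revalD => //; exact: reval1.
Qed.

Lemma gen_order x : (gen x ^+ gorder x = 1)%g.
Proof. by case: x; [exact: birI4 | exact: birC3 | exact: birP5]. Qed.

Lemma bval_iter x k z : pos z -> bval (gen x ^+ k)%g z (iter k (ag x) z).
Proof.
move=> z0; elim: k => [|k IHk]; first exact: bval_1.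
rewrite expgS /=; apply: bval_mul IHk _; exact/bval_gen/pos_iter.
Qed.

Lemma bval_weval w z : pos z -> bval (weval gen w) z (actw w z).
Proof.
move=> z0; elim: w => [|[x b] w IHw]; first by rewrite weval_nil; exact: bval_1.
have wz0 := pos_actw w z0; rewrite -cat1s weval_cat; apply: bval_mul IHw _.
rewrite /weval big_seq1 /=; case: b; last exact: bval_gen.
have -> : ((gen x)^-1 = gen x ^+ (gorder x).-1)%g.
  apply: (mulgI (gen x)); rewrite mulgV -expgS.
  by have := gen_order x; case: x.
exact: bval_iter.
Qed.

(** A word that evaluates to the identity map has identity values at all positive points, so its
    class acts trivially there. *)
Lemma weval_faithful (v w : word Hgen) : weval gen v = weval gen w -> pres_eq relations v w.
Proof.
move=> vw; have vw1 : weval gen (v ++ winv w) = 1%g.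
  by rewrite weval_cat weval_winv vw mulgV.
have : cl (v ++ winv w) = 1%g.
  apply: (@act_trivial F) => z z0; rewrite act_cl //.
  by have := bval_weval (v ++ winv w) z0; rewrite vw1 => /bval_1_eq.
rewrite cl_cat cl_winv => E; apply/cl_eq; apply: (mulIg (cl w)^-1%g).
by rewrite E mulgV.
Qed.
End Values.

(** * SL(2, Z) is generated by I and C *)

Section Generation.
Variable F : fieldType.
Local Notation gen := (Hgen_bir F).

Lemma mat2M a b c d a' b' c' d' : mat2 a b c d *m mat2 a' b' c' d' =
  mat2 (a * a' + b * c') (a * b' + b * d') (c * a' + d * c') (c * b' + d * d').
Proof.
apply/matrixP => i j; rewrite !mxE !big_ord_recl big_ord0 !mxE /= addr0.
by case: (ord2P i) => ->; case: (ord2P j) => ->.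
Qed.

Lemma mat2E (A : 'M[int]_2) : A = mat2 (A 0 0) (A 0 1) (A 1 0) (A 1 1).
Proof.
apply/matrixP => i j; rewrite !mxE.
by case: (ord2P i) => ->; case: (ord2P j) => ->.
Qed.

Lemma mat2_1 : mat2 1 0 0 1 = 1%:M.
Proof.
apply/matrixP => i j; rewrite !mxE.
by case: (ord2P i) => ->; case: (ord2P j) => ->.
Qed.

Definition mono w (A : 'M[int]_2) := bir_map (weval gen w) = monmap F A.

Lemma mono_cat v w A B : mono v A -> mono w B -> mono (v ++ w) (A *m B).
Proof.
move=> vA wB; rewrite /mono weval_cat; apply/ffunP => i.
rewrite mulE vA wB; apply: rsubst_reval; last exact: reval_monmap.
by rewrite -wB; exact: bir_dominant.
Qed.

Lemma mono_nil : mono [::] (mat2 1 0 0 1).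
Proof. by rewrite /mono weval_nil mat2_1 monmap1. Qed.

Lemma mono_I : mono (letter HgenI) matI.
Proof. by rewrite /mono weval_letter. Qed.
Lemma mono_C : mono (letter HgenC) matC.
Proof. by rewrite /mono weval_letter. Qed.

Lemma mono_eq w A B : mono w A -> A = B -> mono w B.
Proof. by move=> wA <-. Qed.

Lemma mono_shear (k : int) : exists w, mono w (mat2 1 0 k 1).
Proof.
have shear w (e : int) : mono w (mat2 1 0 e 1) -> forall n : nat,
    mono (wpow w n) (mat2 1 0 (e *+ n) 1).
  move=> we; elim=> [|n IHn]; first exact: mono_nil.
  have := mono_cat we IHn; rewrite mat2M mulrS.
  by rewrite !(mul0r, mulr0, mul1r, mulr1, addr0, add0r).
(* C^2 I^3 = C^-1 I^-1 = U is the elementary shear, and I C is its inverse. *)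
have pos1 := mono_cat mono_C (mono_cat mono_C
  (mono_cat mono_I (mono_cat mono_I mono_I))).
have neg1 := mono_cat mono_I mono_C.
have E1 : matC *m (matC *m (matI *m (matI *m matI))) = mat2 1 0 1 1.
  by rewrite /matC /matI !mat2M; congr mat2.
have E2 : matI *m matC = mat2 1 0 (-1) 1 by rewrite /matC /matI !mat2M; congr mat2.
rewrite E1 in pos1; rewrite E2 in neg1.
case: k => n.
  by eexists; have := shear _ _ pos1 n; rewrite natz; exact.
by eexists; have := shear _ _ neg1 n.+1; rewrite mulNrn natz -NegzE; exact.
Qed.

(** Euclid's algorithm on the first column: a shear replaces c by its remainder modulo a, and I
    moves this remainder, up to sign, to the place of a. *)
Lemma mono_ex a b c d : a * d - b * c = 1 -> exists w, mono w (mat2 a b c d).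
Proof.
have [n] := ubnP `|a|%N; elim: n a b c d => // n IHn a b c d an det1.
have [a0|a0] := eqVneq a 0.
  have [w wd] := mono_shear (b * d).
  have II := mono_cat mono_I (mono_cat mono_I mono_I).
  have : (b == -1) && (c == 1) || (b == 1) && (c == -1).
    have bc : b * c = -1 by rewrite -[LHS]opprK -[- (b * c)]add0r -(mul0r d) -a0 det1.
    have /eqP : (`|b| * `|c| = 1)%N by rewrite -abszM bc.
    rewrite muln_eq1 => /andP[/eqP b1 /eqP c1].
    have [bE|bE] : b = 1 \/ b = -1 by lia.
      by move: bc; rewrite bE mul1r => ->; rewrite eqxx orbT.
    by move: bc; rewrite bE mulN1r => /oppr_inj ->; rewrite eqxx.
  case/orP => /andP[/eqP bE /eqP cE].
    exists (w ++ letter HgenI); apply: (mono_eq (mono_cat wd mono_I)).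
    by rewrite /matI mat2M a0 bE cE; congr mat2; ring.
  eexists; apply: (mono_eq (mono_cat wd II)).
  by rewrite /matI !mat2M a0 bE cE; congr mat2; ring.
pose q := (c %/ a)%Z; pose r := (c %% a)%Z.
have cE : c = q * a + r by rewrite -divz_eq.
have ra : (`|- r| < n)%N.
  have := ltz_mod c a0; have := modz_ge0 c a0; rewrite -/r; lia.
have det2 : - r * b - (- (d - q * b)) * a = 1 by rewrite -det1 cE; ring.
have [w1 w1P] := mono_shear q; have [w2 w2P] := IHn _ _ _ _ ra det2.
have II := mono_cat mono_I (mono_cat mono_I mono_I).
eexists; apply: (mono_eq (mono_cat w1P (mono_cat II w2P))).
by rewrite /matI !mat2M; congr mat2; rewrite ?cE; ring.
Qed.

Lemma range_gen : (range (weval gen) = groupH F)%classic.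
Proof.
apply/seteqP; split=> [f [w _ <-] A [[A1 AM AV] SA]|].
  elim: w => [|[x b] w IHw]; first by rewrite weval_nil.
  rewrite -cat1s weval_cat; apply: AM => //.
  have Ax : A (gen x).
    apply: SA; case: x; [left|left|by right].
      by exists matI; rewrite det_mat2.
    by exists matC; rewrite det_mat2.
  by rewrite /weval big_seq1 /=; case: b => //; exact: AV.
apply: smallest_sub.
  split; first by exists [::]; rewrite ?weval_nil.
    by move=> _ _ [v _ <-] [w _ <-]; exists (v ++ w); rewrite ?weval_cat.
  by move=> _ [w _ <-]; exists (winv w); rewrite ?weval_winv.
move=> f [[A [A1 fA]]|->]; last by exists (letter HgenP); rewrite ?weval_letter.
rewrite [A]mat2E det_mat2 in A1; have [w wA] := mono_ex A1.
by exists w => //; apply: val_inj; rewrite [LHS]wA -mat2E -fA.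
Qed.
End Generation.

Theorem theorem2 (R : realType) :
  presents (groupH R[i]) (Hgen_bir R[i]) relations.
Proof.
split=> [|v w]; first exact: range_gen.
by split=> [|vw]; [exact: (@weval_faithful R[i]) | exact: weval_pres].
Qed.
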